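(* Let $V=\coprod_{n\in\frac12\mathbb{Z}}V_{(n)}$ be a $\frac12\mathbb{Z}$-graded complex vector space with $V_{(n)}=0$ for $n$ sufficiently negative and $\dim V_{(n)}<\infty$ for all $n$. Let $\phi^i$, $i\in I$, be analytic maps from $\mathbb{C}^\times$ to $\mathrm{Hom}(V,\overline{V})$, $L_V(-1)$ an operator on $V$ and $\mathbf{1}\in V_{(0)}$. Assume: (1) For each $i\in I$ there exists $\mathrm{wt}\,\phi^i\in\frac12\mathbb{Z}$ such that $[L_V(0),\phi^i(z)]=z\frac{d}{dz}\phi^i(z)+(\mathrm{wt}\,\phi^i)\phi^i(z)$. (2) $L_V(-1)\mathbf{1}=0$ and $[L_V(-1),\phi^i(z)]=\frac{d}{dz}\phi^i(z)$ for $i\in I$. (3) For each $i\in I$ the limit $\lim_{z\to0}\phi^i(z)\mathbf{1}$ exists; this limit $\phi^i_{-1}\mathbf{1}$ is either in $V^0$ or in $V^1$, and one sets $|\phi^i|=0$ in the first case and $|\phi^i|=1$ in the second. (4) $V$ is spanned by the elements $\phi^{i_1}_{n_1}\cdots\phi^{i_k}_{n_k}\mathbf{1}$ for $k\ge0$, $i_1,\dots,i_k\in I$, $n_1,\dots,n_k\in\mathbb{Z}$. (5) For $v'\in V'$, $v\in V$ and $i_1,\dots,i_k\in I$, the series $\langle v',\phi^{i_1}(z_1)\cdots\phi^{i_k}(z_k)v\rangle$ is absolutely convergent in the region $|z_1|>\cdots>|z_k|>0$ to a rational function $R(\langle v',\phi^{i_1}(z_1)\cdots\phi^{i_k}(z_k)v\rangle)$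 in $z_1,\dots,z_k$ with the only possible poles at $z_j=0$ ($1\le j\le k$) and $z_j=z_l$ ($j\ne l$). In addition, the order of the pole $z_j=z_l$ is independent of $\phi^{i_n}$ for $n\ne j,l$, of $v$ and of $v'$, and the order of the pole $z_j=0$ is independent of $\phi^{i_n}$ for $n\neq j$ and of $v'$ (in the sense that these orders are bounded above by integers not depending on the listed data). (6) For $v\in V$, $v'\in V'$, $i_1,i_2\in I$, $R(\langle v',\phi^{i_1}(z_1)\phi^{i_2}(z_2)v\rangle)=(-1)^{|\phi^{i_1}||\phi^{i_2}|}R(\langle v',\phi^{i_2}(z_2)\phi^{i_1}(z_1)v\rangle)$. Let $Y_V:\mathbb{C}^\times\to\mathrm{Hom}(V\otimes V,\overline{V})$ be the map defined by $$\langle v',Y_V(\phi^{i_1}_{m_1}\cdots\phi^{i_k}_{m_k}\mathbf{1},z)v\rangle=\mathrm{Res}_{\xi_1=0}\cdots\mathrm{Res}_{\xi_k=0}\,\xi_1^{m_1}\cdots\xi_k^{m_k}R(\langle v',\phi^{i_1}(\xi_1+z)\cdots\phi^{i_k}(\xi_k+z)v\rangle)$$ for $v'\in V'$, $v\in V$, $i_1,\dots,i_k\in I$, $m_1,\dots,m_k\in\mathbb{Z}$. Then $(V,Y_V,\mathbf{1})$ is a grading-restricted vertex superalgebra (a grading-restricted vertex algebra when $V^1=0$) generated by $\phi^i_{-1}\mathbf{1}$ for $i\in I$. Moreover, this is the unique grading-restricted vertex superalgebra structure on $V$ with vacuum $\mathbf{1}$ such that $Y_V(\phi^i_{-1}\mathbf{1},z)=\phi^i(z)$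 for all $i\in I$.
   Context: Notation. $V^0=\coprod_{n\in\mathbb{Z}}V_{(n)}$ (even part), $V^1=\coprod_{n\in\mathbb{Z}+\frac12}V_{(n)}$ (odd part); $V'=\coprod_nV_{(n)}^*$ is the graded dual and $\overline{V}=\prod_nV_{(n)}=(V')^*$ the algebraic completion. $L_V(0)v=nv$ for $v\in V_{(n)}$. A map $z\mapsto f(z)\in\mathrm{Hom}(V^{\otimes n},\overline{V})$ is analytic (convergent, etc.) if all matrix coefficients $\langle v',f(z)(v_1\otimes\cdots\otimes v_n)\rangle$ with $v'\in V'$, $v_j\in V$ are. Under condition (1), $\phi^i$ has a Laurent expansion $\phi^i(z)=\sum_{n\in\mathbb{Z}}\phi^i_nz^{-n-1}$ with $\phi^i_n\in\mathrm{Hom}(V,V)$ homogeneous of weight $\mathrm{wt}\,\phi^i-n-1$ (i.e. $[L_V(0),\phi^i_n]=(\mathrm{wt}\,\phi^i-n-1)\phi^i_n$). The commutator formula in (2) is understood coefficientwise in $z$, and products $\langle v',\phi^{i_1}(z_1)\cdots\phi^{i_k}(z_k)v\rangle$ as the Laurent series $\sum\langle v',\phi^{i_1}_{n_1}\cdots\phi^{i_k}_{n_k}v\rangle z_1^{-n_1-1}\cdots z_k^{-n_k-1}$. $R(\langle v',\phi^{i_1}(\xi_1+z)\cdots\phi^{i_k}(\xi_k+z)v\rangle)$ is the rational function of (5) evaluated at $z_j=\xi_j+z$. For a meromorphic function $f(\xi)$, $\mathrm{Res}_{\xi=0}f(\xi)$ is the coefficient of $\xi^{-1}$ in the Laurent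 expansion of $f$ in $0<|\xi|<r$ with $r$ small enough that there are no other poles in this disk. The residues are iterated: $\mathrm{Res}_{\xi_k=0}$ is taken first (other variables fixed and generic), $\mathrm{Res}_{\xi_1=0}$ last. For $k=0$ the formula reads $Y_V(\mathbf{1},z)=1_V$. The formula gives a well-defined map $Y_V$ (independent of how an element is written as a linear combination of the spanning elements). A grading-restricted vertex superalgebra is a $\frac12\mathbb{Z}$-graded vector space $V=\coprod_{n\in\frac12\mathbb{Z}}V_{(n)}=V^0\oplus V^1$, where $V^0=\coprod_{n\in\mathbb{Z}}V_{(n)}$ and $V^1=\coprod_{n\in\mathbb{Z}+\frac12}V_{(n)}$, with an analytic map $Y_V:\mathbb{C}^\times\to\mathrm{Hom}(V\otimes V,\overline{V})$, $z\mapsto(u\otimes v\mapsto Y_V(u,z)v)$, and a vacuum $\mathbf{1}\in V_{(0)}$ such that: (i) $V_{(n)}=0$ for $n$ sufficiently negative, $\dim V_{(n)}<\infty$ for all $n$, and $[L_V(0),Y_V(v,z)]=z\frac{d}{dz}Y_V(v,z)+Y_V(L_V(0)v,z)$ for $v\in V$; (ii) $Y_V(\mathbf{1},z)=1_V$, and $\lim_{z\to0}Y_V(u,z)\mathbf{1}$ exists and equals $u$ for $u\in V$; (iii) with $L_V(-1)v:=\lim_{z\to0}\frac{d}{dz}Y_V(v,z)\mathbf{1}$, one has $\frac{d}{dz}Y_V(v,z)=Y_V(L_V(-1)v,z)=[L_V(-1),Y_V(v,z)]$; (iv) (duality) for $u_1\in V^{|u_1|}$, $u_2\in V^{|u_2|}$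 ($|u_1|,|u_2|\in\{0,1\}$), $v\in V$, $v'\in V'$, the series $\langle v',Y_V(u_1,z_1)Y_V(u_2,z_2)v\rangle$, $(-1)^{|u_1||u_2|}\langle v',Y_V(u_2,z_2)Y_V(u_1,z_1)v\rangle$, $\langle v',Y_V(Y_V(u_1,z_1-z_2)u_2,z_2)v\rangle$ (sums over the homogeneous components of the intermediate vector in $\overline{V}$) are absolutely convergent in the regions $|z_1|>|z_2|>0$, $|z_2|>|z_1|>0$, $|z_2|>|z_1-z_2|>0$, respectively, to a common rational function in $z_1,z_2$ with the only possible poles at $z_1=0$, $z_2=0$ and $z_1=z_2$. It is a grading-restricted vertex algebra if $V^1=0$. It is generated by a subset $S$ if $V$ is the smallest vertex sub(super)algebra containing $S$. *)

(* Defs.v *)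
From HB Require Import structures.
From mathcomp Require Import all_boot all_order all_algebra.
From mathcomp Require Import finmap.
From mathcomp Require Import all_classical all_reals all_analysis.
From mathcomp Require Import summability.
From mathcomp Require Import complex.
From mathcomp Require mpoly.

Set Implicit Arguments.
Unset Strict Implicit.
Unset Printing Implicit Defensive.

Import Order.TTheory GRing.Theory Num.Theory.
Import numFieldNormedType.Exports.

Local Open Scope classical_set_scope.
Local Open Scope ring_scope.

(* Packed so that the topology which MathComp-Analysis puts on every
   numClosedFieldType is inferred. *)
Definition Cplx (R : realType) : numClosedFieldType := R[i].

Section ComplexAnalysis.
Context {R : realType}.
Local Notation C := (Cplx R).

Definition holomorphic_at (f : C -> C) (z : C) : Prop := derivable f z 1.

Definition abs_converges_to {I : choiceType} (a : I -> C) (s : C) : Prop :=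
  (exists M : C, forall J : {fset I}, partial_sum (fun i => `|a i|) J <= M) /\
  partial_sum a @ totally --> s.

Definition is_laurent_expansion (f : C -> C) (a : int -> C) : Prop :=
  exists2 r : C, 0 < r & forall z : C, 0 < `|z| < r ->
    abs_converges_to (fun n : int => a n * z ^ n) (f z).

(* The coefficient of z ^ n in the Laurent expansion of f at 0
   (0 if f has no such expansion). *)
Definition laurent_coef (f : C -> C) (n : int) : C :=
  xget (fun=> 0) [set a | is_laurent_expansion f a] n.

Definition residue0 (f : C -> C) : C := laurent_coef f (-1).

(* Res_{xi_1 = 0} ... Res_{xi_k = 0} F(xi_1, ..., xi_k), the rightmost
   residue being taken first. *)
Fixpoint iterated_residue (k : nat) : (k.-tuple C -> C) -> C :=
  match k with
  | 0 => fun F => F [tuple]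
  | k'.+1 => fun F => residue0 (fun x =>
      iterated_residue (fun xs : k'.-tuple C => F [tuple of x :: xs]))
  end.

(* A rational function in z_1, ..., z_k whose only possible poles are
   z_j = 0, of order at most a j, and z_j = z_l (j < l), of order at most
   b j l, is P(z) / (prod_j z_j ^ (a j) * prod_(j < l) (z_j - z_l) ^ (b j l))
   with P a polynomial.  Its value matters only off the poles. *)
Definition rat_eval (k : nat) (a : 'I_k -> nat) (b : 'I_k -> 'I_k -> nat)
    (P : mpoly.mpoly k C) (z : k.-tuple C) : C :=
  mpoly.meval (tnth z) P /
  ((\prod_(j < k) tnth z j ^+ a j) *
   (\prod_(j < k) \prod_(l < k | (j < l)%N) (tnth z j - tnth z l) ^+ b j l)).

Definition is_rational (k : nat) (F : k.-tuple C -> C) : Prop :=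
  exists a b (P : mpoly.mpoly k C), F = rat_eval a b P.

(* |z_1| > ... > |z_k| > 0 *)
Definition radially_ordered (k : nat) (z : k.-tuple C) : Prop :=
  (forall j, 0 < `|tnth z j|) /\
  (forall j l : 'I_k, (j < l)%N -> `|tnth z l| < `|tnth z j|).

End ComplexAnalysis.

(* A (1/2)Z-grading is indexed by twice the weight: graded_proj n is the
   projection of V onto V_(n/2), and V is the direct sum of these spaces. *)
Record grading (R : realType) (V : lmodType (Cplx R)) := Grading {
  graded_proj : int -> {linear V -> V};
  graded_projK : forall m n v,
    graded_proj m (graded_proj n v) = if m == n then graded_proj n v else 0;
  graded_proj_finite : forall v, finite_set [set n | graded_proj n v != 0];
  graded_proj_sum : forall v, v = \sum_(n \in [set: int]) graded_proj n v
}.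

Section Graded.
Context {R : realType} {V : lmodType (Cplx R)} (G : grading V).
Local Notation C := (Cplx R).

(* V_(n/2) *)
Definition homog (n : int) : set V := [set v | graded_proj G n v = v].

(* V^0 for p = false, V^1 for p = true *)
Definition parity_part (p : bool) : set V :=
  [set v | forall n : int, odd `|n|%N != p -> graded_proj G n v = 0].

Definition grading_restricted : Prop :=
  (exists N : int, forall n : int, n < N -> homog n `<=` [set 0]) /\
  (forall n : int, exists s : seq V, forall v, homog n v ->
     exists c : nat -> C, v = \sum_(j < size s) c j *: s`_j).

(* V': the linear functionals vanishing on all but finitely many V_(n/2) *)
Record graded_dual := GradedDual {
  gd_fun :> {scalar V};
  gd_finite : exists N : nat, forall (n : int) (v : V),
    (N < `|n|)%N -> homog n v -> gd_fun v = 0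
}.

(* An element of the completion prod_n V_(n/2) is a function x : int -> V
   with x n in V_(n/2). *)
Definition in_completion (x : int -> V) : Prop := forall n, homog n (x n).

Definition to_completion (v : V) : int -> V := fun n => graded_proj G n v.

Definition pairing (v' : graded_dual) (x : int -> V) : C :=
  \sum_(n \in [set: int]) v' (x n).

(* f is an element of Hom(V, completion of V) *)
Definition is_hom (f : V -> int -> V) : Prop :=
  (forall v, in_completion (f v)) /\
  (forall (a : C) (u v : V) n, f (a *: u + v) n = a *: f u n + f v n).

Definition L0 (v : V) : V :=
  \sum_(n \in [set: int]) (n%:~R / 2 : C) *: graded_proj G n v.

(* The action on the completion of an operator T on V that maps each V_(n/2)
   into some V_(n/2 + d); the sum then has at most one nonzero term. *)
Definition extend (T : V -> V) (x : int -> V) : int -> V :=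
  fun n => \sum_(m \in [set: int]) graded_proj G n (T (x m)).

(* [T, f], for T as above and f in Hom(V, completion of V) *)
Definition bracket (T : V -> V) (f : V -> int -> V) : V -> int -> V :=
  fun v n => extend T (f v) n - f (T v) n.

(* A map from C^x to Hom(V, completion of V) is given by a function on C
   whose value at 0 is irrelevant. *)
Definition matrix_coef (v' : graded_dual) (f : C -> V -> int -> V) (v : V) :
    C -> C := fun z => pairing v' (f z v).

Definition analytic_field (f : C -> V -> int -> V) : Prop :=
  (forall z, z != 0 -> is_hom (f z)) /\
  (forall v' v z, z != 0 -> holomorphic_at (matrix_coef v' f v) z).

(* The coefficient f_n in f(z) = sum_n f_n z ^ (- n - 1); this expansion is
   meant for fields f for which f_n v lies in V. *)
Definition mode (f : C -> V -> int -> V) (n : int) (v : V) : V :=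
  xget 0 [set w | forall v' : graded_dual,
                    v' w = laurent_coef (matrix_coef v' f v) (- n - 1)].

Section Correlations.
Context {I : Type} (phi : I -> C -> V -> int -> V).

(* phi^{i_1}_{n_1} ... phi^{i_k}_{n_k} v for s = [:: (i_1, n_1); ...; (i_k, n_k)] *)
Definition mode_product (s : seq (I * int)) (v : V) : V :=
  foldr (fun p w => mode (phi p.1) p.2 w) v s.

(* |phi^i|, as a boolean; it is even if phi^i_{-1} 1 = 0. *)
Definition field_parity (vac : V) (i : I) : bool :=
  ~~ `[< parity_part false (mode (phi i) (-1) vac) >].

(* The series < v', phi^{i_1}(z_1) ... phi^{i_k}(z_k) v > converges
   absolutely to F(z) in |z_1| > ... > |z_k| > 0. *)
Definition correlation_converges (k : nat) (v' : graded_dual)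
    (i : k.-tuple I) (v : V) (F : k.-tuple C -> C) : Prop :=
  forall z : k.-tuple C, radially_ordered z ->
    abs_converges_to
      (fun n : k.-tuple int =>
         v' (mode_product (zip i n) v) *
         \prod_(j < k) tnth z j ^ (- tnth n j - 1))
      (F z).

(* R(< v', phi^{i_1}(z_1) ... phi^{i_k}(z_k) v >), determined off the poles *)
Definition rational_correlation (k : nat) (v' : graded_dual)
    (i : k.-tuple I) (v : V) : k.-tuple C -> C :=
  xget (fun=> 0)
    [set F | is_rational F /\ correlation_converges v' i v F].

End Correlations.

Section Vertex.
Context (vac : V) (Y : V -> C -> V -> int -> V).

(* Y is a map from C^x to Hom(V tensor V, completion of V), Y u z v being
   Y(u, z) v. *)
Definition is_vertex_map : Prop :=
  (forall u z, z != 0 -> is_hom (Y u z)) /\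
  (forall (a : C) (u1 u2 : V) z v n, z != 0 ->
     Y (a *: u1 + u2) z v n = a *: Y u1 z v n + Y u2 z v n).

Definition L0_bracket_formula : Prop :=
  forall u v v' z, z != 0 ->
    pairing v' (bracket L0 (Y u z) v) =
      z * derive1 (matrix_coef v' (Y u) v) z + pairing v' (Y (L0 u) z v).

Definition identity_property : Prop :=
  forall z v n, z != 0 -> Y vac z v n = to_completion v n.

Definition creation_property : Prop :=
  forall u v', matrix_coef v' (Y u) vac z @[z --> 0^'] --> v' u.

(* D u is lim_{z -> 0} d/dz Y(u, z) 1. *)
Definition is_translation_operator (D : V -> V) : Prop :=
  forall u v', derive1 (matrix_coef v' (Y u) vac) z @[z --> 0^'] --> v' (D u).

(* The limit defining L(-1) u is of weight one more than u. *)
Definition translation_property : Prop :=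
  exists D : V -> V,
    is_translation_operator D /\
    (forall n, D @` homog n `<=` homog (n + 2)) /\
    (forall u v v' z, z != 0 ->
       derive1 (matrix_coef v' (Y u) v) z = pairing v' (Y (D u) z v) /\
       derive1 (matrix_coef v' (Y u) v) z = pairing v' (bracket D (Y u z) v)).

Definition duality : Prop :=
  forall (p1 p2 : bool) (u1 u2 v : V) (v' : graded_dual),
    parity_part p1 u1 -> parity_part p2 u2 ->
  exists F : 2.-tuple C -> C, is_rational F /\
  forall z1 z2 : C,
    (0 < `|z2| < `|z1| ->
       abs_converges_to (fun n : int => pairing v' (Y u1 z1 (Y u2 z2 v n)))
         (F [tuple z1; z2])) /\
    (0 < `|z1| < `|z2| ->
       abs_converges_to
         (fun n : int => (-1) ^+ (p1 && p2) * pairing v' (Y u2 z2 (Y u1 z1 v n)))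
         (F [tuple z1; z2])) /\
    (0 < `|z1 - z2| < `|z2| ->
       abs_converges_to
         (fun n : int => pairing v' (Y (Y u1 (z1 - z2) u2 n) z2 v))
         (F [tuple z1; z2])).

Record is_vertex_superalgebra : Prop := {
  vsa_vacuum_weight : homog 0 vac;
  vsa_map : is_vertex_map;
  vsa_analytic : forall u, analytic_field (Y u);
  vsa_restricted : grading_restricted;
  vsa_L0 : L0_bracket_formula;
  vsa_identity : identity_property;
  vsa_creation : creation_property;
  vsa_translation : translation_property;
  vsa_duality : duality
}.

Definition is_vertex_algebra : Prop :=
  is_vertex_superalgebra /\ parity_part true `<=` [set 0].

(* A graded subspace W containing the vacuum and such that Y(u, z) w lies in
   the completion of W for u, w in W. *)
Definition is_vertex_subalgebra (W : set V) : Prop :=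
  [/\ W vac,
      forall (a : C) (u v : V), W u -> W v -> W (a *: u + v),
      forall n v, W v -> W (graded_proj G n v) &
      forall u w z n, W u -> W w -> z != 0 -> W (Y u z w n)].

Definition generated_by (S : set V) : Prop :=
  forall W : set V, is_vertex_subalgebra W -> S `<=` W -> W = [set: V].

End Vertex.

End Graded.

(* Main.v *)
Require Import Defs.
From HB Require Import structures.
From mathcomp Require Import all_boot all_order all_algebra.
From mathcomp Require Import finmap.
From mathcomp Require Import all_classical all_reals all_analysis.
From mathcomp Require Import summability.
From mathcomp Require Import complex.
From mathcomp Require Import zify ring lra.
From mathcomp Require mpoly.
Import -(notations) mpoly.

Set Implicit Arguments.
Unset Strict Implicit.
Unset Printing Implicit Defensive.

Import Order.TTheory GRing.Theory Num.Theory.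
Import numFieldNormedType.Exports.

Local Open Scope classical_set_scope.
Local Open Scope ring_scope.

(** The theorem is proved by passing from analytic fields to their modes, where
    it becomes a statement about operators on V, and back.

    Modes. The condition on the weight of phi^i is an Euler equation for each
    graded component of phi^i(z) v, whose solutions on the punctured plane are
    monomials ([euler_ode], [phi_component]). Hence phi^i is the same thing as
    the family of its modes, and matrix coefficients are finite sums
    ([modes_of_fld], [modeE]). An absolutely convergent expansion on
    |z_1| > ... > |z_k| > 0 has unique coefficients ([multi_unique], by averaging
    over rotations by roots of unity of order a power of 2). The convergence of a
    correlation function to a rational function with prescribed poles is
    therefore an identity between arrays of coefficients ([formal_of_converges]).
    For two fields, together with the symmetry of the rational functions, it says
    that (z_1 - z_2)^N kills the supercommutator of phi^i(z_1) and phi^j(z_2),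
    with N independent of all vectors, because the order of the pole is
    ([gen_local]).

    State-field correspondence. Mutually local fields have n-th products, again
    mutually local by Dong's lemma ([dong]). A field that is covariant under
    translations and local to the generating fields is determined by the vector
    it creates from the vacuum ([goddard]). As the vectors created by iterated
    products of the phi^i span V, every state has a unique field
    ([state_field_exists]), and the field of phi^i_n u is the n-th product of
    phi^i and the field of u. The axioms can be read off the modes. For duality,
    the three series are the expansions at infinity, 0 and 1 of one rational
    function of z_1 / z_2, a Laurent polynomial divided by (z_1 / z_2 - 1)^N
    ([dual_homog]).

    Residue formula. Move the fields of a correlation function one after the
    other from acting on V to acting inside the state. For one field this
    replaces an expansion in powers of z_j by one in powers of z_j - z, according
    to the formula for the field of a product ([interp_reexpands]). The identity of
    arrays is preserved, now with z_j = xi_j + z. On |z| > |xi_1| > ... > |xi_k| > 0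
    the denominators can be divided out again by geometric series, so the
    matrix coefficients of Y(phi^{i_1}_{n_1} ... phi^{i_k}_{n_k} 1, z) are the
    coefficients of an absolutely convergent expansion of that rational function
    ([shifted_converges]), and the iterated residues read them off
    ([iterated_residueE]).

    Uniqueness. In any structure, the first series of the duality axiom
    determines its rational function from phi^i and Y(u, z), and the third one
    gives Y(phi^i_m u, z) as its Laurent coefficients ([product_unique]). *)

(** * Absolutely summable families of complex numbers *)
Section RealNorm.
Context {R : realType}.
Local Notation C := (Cplx R).

(** The norm of [Cplx R] takes its values in [Cplx R], which is only partially
    ordered; bounds and errors are kept in R. *)
Definition nm (z : C) : R := complex.Re `|z|.

Lemma nmE (z : C) : `|z| = ((nm z)%:C)%C :> C.
Proof. by rewrite /nm RRe_real ?normr_real. Qed.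

Lemma nm_ge0 z : 0 <= nm z.
Proof. by rewrite -lecR -nmE normr_ge0. Qed.

Lemma nm0 : nm 0 = 0.
Proof. by rewrite /nm normr0. Qed.

Lemma nm1 : nm 1 = 1.
Proof. by rewrite /nm normr1. Qed.

Lemma nmM x y : nm (x * y) = nm x * nm y.
Proof. by apply: (@complexI R); rewrite -nmE normrM !nmE -rmorphM. Qed.

Lemma nmD x y : nm (x + y) <= nm x + nm y.
Proof. by rewrite -lecR rmorphD -!nmE; exact: (ler_normD (x : C) y). Qed.

Lemma nmN x : nm (- x) = nm x.
Proof. by rewrite /nm normrN. Qed.

Lemma nmB x y : nm (x - y) = nm (y - x).
Proof. by rewrite -nmN opprB. Qed.

Lemma nm_eq0 x : (nm x == 0) = (x == 0).
Proof. by rewrite -(normr_eq0 x) nmE -(inj_eq (@complexI R)) rmorph0. Qed.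

Lemma nm_gt0 x : (0 < nm x) = (x != 0).
Proof. by rewrite lt0r nm_eq0 nm_ge0 andbT. Qed.

Lemma nm_lt x y : (`|x| < `|y|) = (nm x < nm y).
Proof. by rewrite -ltcR -!nmE. Qed.

Lemma nmX x n : nm (x ^+ n) = nm x ^+ n.
Proof. by elim: n => [|n IH]; rewrite ?expr0 ?nm1 // !exprS nmM IH. Qed.

Lemma nmV x : nm x^-1 = (nm x)^-1.
Proof.
have [->|x0] := eqVneq x 0; first by rewrite invr0 nm0 invr0.
have x0' : nm x != 0 by rewrite nm_eq0.
by apply: (mulfI x0'); rewrite -nmM !divff // nm1.
Qed.

Lemma nm_sum (I : Type) (s : seq I) (F : I -> C) :
  nm (\sum_(i <- s) F i) <= \sum_(i <- s) nm (F i).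
Proof.
elim: s => [|i s IH]; first by rewrite !big_nil nm0.
by rewrite !big_cons; apply: le_trans (nmD _ _) _; rewrite lerD2l.
Qed.

Lemma nm_real (x : R) : 0 <= x -> nm (x%:C)%C = x.
Proof. by move=> x0; rewrite /nm ger0_norm ?ler0c. Qed.

Lemma nm_eps (x : C) : (forall e, 0 < e -> nm x < e) -> x = 0.
Proof.
move=> h; apply/eqP; rewrite -nm_eq0 eq_le nm_ge0 andbT leNgt; apply/negP => /h.
by rewrite ltxx.
Qed.

Lemma absRe (x : C) : `|complex.Re x| <= nm x.
Proof. by have := normc_ge_Re x; rewrite nmE lecR. Qed.

Lemma absIm (x : C) : `|complex.Im x| <= nm x.
Proof.
have -> : nm x = nm (x * 'i%C).
  rewrite nmM; have -> : nm 'i%C = 1; last by rewrite mulr1.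
  apply: (@complexI R); rewrite -nmE normc_def /=.
  by rewrite expr0n expr1n add0r sqrtr1.
by rewrite -normrN -ReiNIm absRe.
Qed.

End RealNorm.

Section Summation.
Context {R : realType}.
Local Notation C := (Cplx R).

Definition bsum {I : choiceType} (a : I -> C) : Prop :=
  exists M : R, forall J : {fset I}, \sum_(i <- J) nm (a i) <= M.

(** The sum of an absolutely summable family, as in [abs_converges_to], with the
    bound and the errors in R. *)
Definition hsum {I : choiceType} (a : I -> C) (s : C) : Prop :=
  bsum a /\ forall e : R, 0 < e -> exists J0 : {fset I}, forall J : {fset I},
    (J0 `<=` J)%fset -> nm (\sum_(i <- J) a i - s) < e.

Lemma abs_convP (I : choiceType) (a : I -> C) (s : C) :
  abs_converges_to a s <-> hsum a s.
Proof.
have psE (b : I -> C) (J : {fset I}) : partial_sum b J = \sum_(i <- J) b i.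
  exact: (esym (big_seq_fsetE _ _ predT _)).
have nE (J : {fset I}) :
    \sum_(i <- J) `|a i| = ((\sum_(i <- J) nm (a i))%:C)%C :> C.
  by rewrite rmorph_sum /=; apply: eq_bigr => i _; rewrite nmE.
split=> [[[M HM] Hc]|[[M HM] Hc]]; split.
- exists (complex.Re M) => J; move: (HM J); rewrite psE nE lecE => /andP[_].
  by [].
- move=> e e0; have e0' : (0 : C) < (e%:C)%C by rewrite ltcR.
  have /(_ _ (nbhsx_ballx s _ e0')) := Hc.
  case=> J0 _ HJ0; exists J0 => J /HJ0 /=.
  rewrite -ball_normE /= psE distrC => h.
  by rewrite -ltcR -nmE.
- by exists (M%:C)%C => J; rewrite psE nE lecR.
- have FF : Filter (@totally I) by case: (@totally_filter I).
  apply/cvgrPdist_lt => e e0.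
  have e0' : 0 < complex.Re e by move: e0; rewrite ltcE => /andP[].
  have eE : e = ((complex.Re e)%:C)%C by rewrite RRe_real // gtr0_real.
  have [J0 HJ0] := Hc _ e0'.
  exists J0 => //= J /HJ0 h.
  by rewrite psE distrC eE nmE ltcR.
Qed.

Section Basic.
Context {I : choiceType}.
Implicit Types (a b : I -> C) (s t : C).

Lemma hsum_ext a b s : a =1 b -> hsum a s -> hsum b s.
Proof. by move=> /funext ->. Qed.

Lemma bsum_le a b : (forall i, nm (a i) <= nm (b i)) -> bsum b -> bsum a.
Proof.
move=> h [M HM]; exists M => J; apply: le_trans (HM J).
by apply: ler_sum => i _.
Qed.

Lemma hsum_unique a s t : hsum a s -> hsum a t -> s = t.
Proof.
move=> [_ hs] [_ ht]; apply/eqP; rewrite -subr_eq0; apply/eqP/nm_eps => e e0.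
have e2 : 0 < e / 2 by rewrite divr_gt0.
have [J1 H1] := hs _ e2; have [J2 H2] := ht _ e2.
have h1 := H1 (J1 `|` J2)%fset (fsubsetUl _ _).
have h2 := H2 (J1 `|` J2)%fset (fsubsetUr _ _).
set S := \sum_(i <- _) a i in h1 h2.
have -> : s - t = (S - t) - (S - s) by ring.
apply: le_lt_trans (nmD _ _) _; rewrite nmN; lra.
Qed.

Lemma hsumD a b s t : hsum a s -> hsum b t ->
  hsum (fun i => a i + b i) (s + t).
Proof.
move=> [[M HM] hs] [[N HN] ht]; split.
  exists (M + N) => J; apply: le_trans (lerD (HM J) (HN J)).
  by rewrite -big_split; apply: ler_sum => i _; exact: nmD.
move=> e e0; have e2 : 0 < e / 2 by rewrite divr_gt0.
have [J1 H1] := hs _ e2; have [J2 H2] := ht _ e2.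
exists (J1 `|` J2)%fset => J; rewrite fsubUset => /andP[/H1 h1 /H2 h2].
rewrite big_split /=.
set S := \sum_(i <- J) a i in h1 *; set T := \sum_(i <- J) b i in h2 *.
have -> : S + T - (s + t) = (S - s) + (T - t) by ring.
apply: le_lt_trans (nmD _ _) _; lra.
Qed.

Lemma hsumZ (c : C) a s : hsum a s -> hsum (fun i => c * a i) (c * s).
Proof.
have [->|c0] := eqVneq c 0.
  move=> _; split.
    by exists 0 => J; rewrite big1 // => i _; rewrite mul0r nm0.
  by move=> e e0; exists fset0 => J _; rewrite -mulr_sumr !mul0r subr0 nm0.
move=> [[M HM] hs]; split.
  exists (nm c * M) => J; under eq_bigr do rewrite nmM.
  by rewrite -mulr_sumr ler_wpM2l // nm_ge0.
move=> e e0; have c0' : 0 < nm c by rewrite nm_gt0.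
have [J0 H0] := hs _ (divr_gt0 e0 c0'); exists J0 => J /H0.
by rewrite -mulr_sumr -mulrBr nmM ltr_pdivlMr // mulrC.
Qed.

Lemma hsumN a s : hsum a s -> hsum (fun i => - a i) (- s).
Proof.
by move=> /(hsumZ (-1)); rewrite mulN1r; apply: hsum_ext => i; rewrite mulN1r.
Qed.

Lemma hsumB a b s t : hsum a s -> hsum b t ->
  hsum (fun i => a i - b i) (s - t).
Proof. by move=> ha /hsumN; exact: hsumD. Qed.

Lemma hsum0 : hsum (fun _ : I => 0) 0.
Proof.
split; first by exists 0 => J; rewrite big1 // => i _; rewrite nm0.
by move=> e e0; exists fset0 => J _; rewrite big1 // subr0 nm0.
Qed.

Lemma hsum_sum (T : eqType) (r : seq T) (a : T -> I -> C) (s : T -> C) :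
  (forall x, x \in r -> hsum (a x) (s x)) ->
  hsum (fun i => \sum_(x <- r) a x i) (\sum_(x <- r) s x).
Proof.
elim: r => [|x r IH] h.
  by rewrite big_nil; apply: hsum_ext hsum0 => i; rewrite big_nil.
rewrite big_cons; apply: (@hsum_ext (fun i => a x i + \sum_(x <- r) a x i)).
  by move=> i; rewrite big_cons.
apply: hsumD; first by apply: h; rewrite mem_head.
by apply: IH => y yr; apply: h; rewrite in_cons yr orbT.
Qed.

Lemma sum_fsub (W : nmodType) (A B : {fset I}) (F : I -> W) : (A `<=` B)%fset ->
  \sum_(i <- B) F i = \sum_(i <- A) F i + \sum_(i <- (B `\` A)%fset) F i.
Proof.
move=> AB; rewrite (big_fsetID _ (mem A)) /=; congr (_ + _).
  apply: eq_fbigl => i; rewrite !inE /= andbC.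
  by have [/(fsubsetP AB)->|//] := boolP (i \in A).
by apply: eq_fbigl => i; rewrite !inE /= andbC.
Qed.

Lemma ler_fsub (A B : {fset I}) (F : I -> R) : (A `<=` B)%fset ->
  (forall i, 0 <= F i) -> \sum_(i <- A) F i <= \sum_(i <- B) F i.
Proof.
by move=> AB F0; rewrite (sum_fsub _ AB) lerDl sumr_ge0.
Qed.

Lemma hsum_fin (S : {fset I}) a : (forall i, i \notin S -> a i = 0) ->
  hsum a (\sum_(i <- S) a i).
Proof.
move=> h; split.
  exists (\sum_(i <- S) nm (a i)) => J.
  rewrite [leRHS](big_fset_incl _ (fsubsetUr J S)); last first.
    by move=> i _ /h ->; rewrite nm0.
  by apply: ler_fsub => [|i]; [exact: fsubsetUl | exact: nm_ge0].
move=> e e0; exists S => J SJ; rewrite -(big_fset_incl _ SJ) ?subrr ?nm0 //.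
by move=> i _ /h.
Qed.

(** A finite set whose sum of norms is within e of the supremum leaves less than
    e for all the others. *)
Lemma bsum_tail a : bsum a -> forall e, 0 < e -> exists J0 : {fset I},
  forall K : {fset I}, [disjoint K & J0]%fset -> \sum_(i <- K) nm (a i) < e.
Proof.
move=> [M HM] e e0.
pose E : set R := [set x | exists J : {fset I}, x = \sum_(i <- J) nm (a i)].
have hE : has_sup E.
  split; first by exists (\sum_(i <- fset0) nm (a i)); exists fset0.
  by exists M => _ [J ->].
have [_ [J0 ->] hJ0] := sup_adherent e0 hE.
exists J0 => K; rewrite fdisjoint_sym => dis.
have : \sum_(i <- (J0 `|` K)%fset) nm (a i) <= sup E.
  by apply: ub_le_sup; [case: hE | exists (J0 `|` K)%fset].
rewrite (sum_fsub _ (fsubsetUl J0 K)).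
have -> : ((J0 `|` K) `\` J0 = K)%fset.
  apply/fsetP => i; rewrite !inE; case: (boolP (i \in J0)) => //= iJ.
  by symmetry; apply/negbTE; exact: (fdisjointP dis).
by move: hJ0; set x := \sum_(i <- K) _; set y := \sum_(i <- J0) _; lra.
Qed.

Lemma bsum_filter a (p : pred I) :
  bsum a -> bsum (fun i => if p i then a i else 0).
Proof.
by apply: bsum_le => i; case: ifP => // _; rewrite nm0 nm_ge0.
Qed.

Lemma hsum_nonneg (f : I -> R) : (forall i, 0 <= f i) ->
  bsum (fun i => (f i)%:C%C : C) -> exists s, hsum (fun i => (f i)%:C%C : C) s.
Proof.
move=> f0 [M HM].
have nE (J : {fset I}) :
    \sum_(i <- J) nm ((f i)%:C%C : C) = \sum_(i <- J) f i.
  by apply: eq_bigr => i _; rewrite nm_real.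
pose E : set R := [set x | exists J : {fset I}, x = \sum_(i <- J) f i].
have hE : has_sup E.
  split; first by exists (\sum_(i <- fset0) f i); exists fset0.
  by exists M => _ [J ->]; rewrite -nE.
exists (sup E)%:C%C; split; first by exists M.
move=> e e0; have [_ [J0 ->] hJ0] := sup_adherent e0 hE.
exists J0 => J JJ; rewrite -rmorph_sum -rmorphB /= -nmN -rmorphN /=.
have h1 : \sum_(i <- J) f i <= sup E.
  by apply: ub_le_sup; [case: hE | exists J].
have h2 := ler_fsub JJ f0.
by rewrite nm_real opprB ?subr_ge0 //; move: hJ0 h2;
  set x := \sum_(i <- J) _; set y := \sum_(i <- J0) _; lra.
Qed.

(** The positive and negative parts of the real and imaginary parts are
    summable, being bounded families of nonnegative reals. *)
Lemma hsum_exists a : bsum a -> exists s, hsum a s.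
Proof.
move=> ba.
have h (g : C -> R) : (forall i, 0 <= g (a i) <= nm (a i)) ->
    exists s, hsum (fun i => (g (a i))%:C%C : C) s.
  move=> hg; apply: hsum_nonneg => [i|]; first by case/andP: (hg i).
  by apply: bsum_le ba => i; case/andP: (hg i) => h0 h1; rewrite nm_real.
have [|s1 h1] := h (fun z => Num.max (complex.Re z) 0).
  by move=> i; have := absRe (a i); have := nm_ge0 (a i); rewrite ler_norml;
    case: (leP (complex.Re (a i)) 0); lra.
have [|s2 h2] := h (fun z => Num.max (- complex.Re z) 0).
  by move=> i; have := absRe (a i); have := nm_ge0 (a i); rewrite ler_norml;
    case: (leP (- complex.Re (a i)) 0); lra.
have [|s3 h3] := h (fun z => Num.max (complex.Im z) 0).
  by move=> i; have := absIm (a i); have := nm_ge0 (a i); rewrite ler_norml;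
    case: (leP (complex.Im (a i)) 0); lra.
have [|s4 h4] := h (fun z => Num.max (- complex.Im z) 0).
  by move=> i; have := absIm (a i); have := nm_ge0 (a i); rewrite ler_norml;
    case: (leP (- complex.Im (a i)) 0); lra.
exists ((s1 - s2) + 'i%C * (s3 - s4)).
apply: hsum_ext (hsumD (hsumB h1 h2) (hsumZ 'i%C (hsumB h3 h4))) => i.
have maxE (x : R) : Num.max x 0 - Num.max (- x) 0 = x.
  by case: (leP x 0); case: (leP (- x) 0); lra.
by rewrite -!rmorphB /= !maxE -complexE.
Qed.

End Basic.

Section Reindex.
Context {I J : choiceType} (f : I -> J) (f_inj : injective f).

Lemma fpreim_ex (K : {fset J}) :
  exists L : {fset I}, forall i, (i \in L) = (f i \in K).
Proof.
have /choice [g gK] : forall j, exists o : option I,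
    if o is Some i then f i = j else forall i, f i != j.
  move=> j; have [[i fi]|h] := pselect (exists i, f i = j); first by exists (Some i).
  by exists None => i; apply/eqP => fi; apply: h; exists i.
exists [fset i in pmap g K]%fset => i; rewrite !inE mem_pmap.
apply/mapP/idP => [[j jK e]|fK].
  by move: (gK j); rewrite -e => ->.
exists (f i) => //; move: (gK (f i)); case: (g (f i)) => [k /f_inj->//|].
by move=> /(_ i); rewrite eqxx.
Qed.

Lemma sum_fpreim (W : nmodType) (K : {fset J}) (L : {fset I}) (b : J -> W) :
  (forall i, (i \in L) = (f i \in K)) ->
  (forall j, (forall i, f i != j) -> b j = 0) ->
  \sum_(i <- L) b (f i) = \sum_(j <- K) b j.
Proof.
move=> LK b0; transitivity (\sum_(j <- (f @` L)%fset) b j).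
  by rewrite big_imfset //= => i k _ _ /f_inj.
apply: big_fset_incl.
  by apply/fsubsetP => _ /imfsetP[i /= iL ->]; rewrite -LK.
move=> j jK jN; apply: b0 => i; apply: contraNneq jN => fij.
by apply/imfsetP; exists i => //=; rewrite LK fij.
Qed.

Lemma bsum_inj (b : J -> C) : bsum b -> bsum (fun i => b (f i)).
Proof.
move=> [M HM]; exists M => L; apply: le_trans (HM (f @` L)%fset).
by rewrite big_imfset //= => i k _ _ /f_inj.
Qed.

(** Up to indices at which b vanishes, the finite subsets of J are the images of
    the finite subsets of I. *)
Lemma hsum_inj (b : J -> C) s : (forall j, (forall i, f i != j) -> b j = 0) ->
  hsum b s <-> hsum (fun i => b (f i)) s.
Proof.
move=> b0; split=> [[hb hs]|[[M HM] hs]]; split.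
- exact: bsum_inj.
- move=> e e0; have [J0 H0] := hs _ e0; have [I0 HI0] := fpreim_ex J0.
  exists I0 => I1 I01.
  have -> : \sum_(i <- I1) b (f i) = \sum_(j <- (f @` I1 `|` J0)%fset) b j.
    apply: sum_fpreim => // i; rewrite !inE; apply/idP/orP.
      by move=> i1; left; apply/imfsetP; exists i.
    case; first by case/imfsetP => k /= k1 /f_inj ->.
    by rewrite -HI0; apply: (fsubsetP I01).
  by apply: H0; exact: fsubsetUr.
- exists M => K; have [L HL] := fpreim_ex K.
  rewrite -(sum_fpreim (b := fun j => nm (b j)) HL) //.
  by move=> j /b0 ->; rewrite nm0.
- move=> e e0; have [I0 H0] := hs _ e0.
  exists (f @` I0)%fset => K IK; have [L HL] := fpreim_ex K.
  rewrite -(sum_fpreim HL) //; apply: H0; apply/fsubsetP => i iI.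
  by rewrite HL; apply: (fsubsetP IK); apply/imfsetP; exists i.
Qed.

End Reindex.

(** Each of the finitely many inner sums at stake is approximated by a finite
    sum, within a fraction of the error; together these finite sets of indices
    form a finite set of pairs, to which the convergence of the double sum
    applies. *)
Lemma hsum_fubini (I J : choiceType) (a : J * I -> C) (b : J -> C) (s : C) :
  hsum a s -> (forall j, hsum (fun i => a (j, i)) (b j)) -> hsum b s.
Proof.
move=> [[M HM] hs] hb.
have pairE (W : nmodType) (J' : {fset J}) (K : J -> {fset I}) (F : J * I -> W) :
    \sum_(p <- [fset ((j, i) : J * I) | j in J', i in K j]%fset) F p =
    \sum_(j <- J') \sum_(i <- K j) F (j, i).
  by rewrite big_imfset2 // => -[? ?] [? ?] _ _ /= [-> ->].
have approx (J' : {fset J}) (J0 : {fset J * I}) e : 0 < e ->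
    exists K : J -> {fset I}, (forall p, p \in J0 -> p.2 \in K p.1) /\
      \sum_(j <- J') nm (\sum_(i <- K j) a (j, i) - b j) < e.
  move=> e0; pose N : R := (size (J' : seq J)).+1%:R; have N0 : 0 < N by rewrite ltr0n.
  have d0 : 0 < e / N by rewrite divr_gt0.
  have /choice [K HK] : forall j, exists K : {fset I},
      (forall p, p \in J0 -> p.2 \in K) /\
      nm (\sum_(i <- K) a (j, i) - b j) < e / N.
    move=> j; have [_ /(_ _ d0) [K0 HK0]] := hb j.
    exists (K0 `|` [fset p.2 | p in J0])%fset; split.
      move=> p pJ; rewrite in_fsetU; apply/orP; right.
      by apply/imfsetP; exists p.
    by apply: HK0; exact: fsubsetUl.
  exists K; split; first by move=> p pJ; case: (HK p.1) => + _; exact.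
  apply: (@le_lt_trans _ _ (\sum_(j <- J') e / N)).
    by apply: ler_sum => j _; apply: ltW; case: (HK j).
  rewrite big_const_seq count_predT iter_addr_0 -mulr_natr -mulrA.
  rewrite gtr_pMr // mulrC ltr_pdivrMr // mul1r /N.
  by rewrite ltr_nat.
split.
  exists (M + 1) => J'; have [K [_ HK]] := approx J' fset0 1 ltr01.
  apply: (@le_trans _ _ (\sum_(j <- J') (\sum_(i <- K j) nm (a (j, i)) +
      nm (\sum_(i <- K j) a (j, i) - b j)))).
    apply: ler_sum => j _; set S := \sum_(i <- K j) a (j, i).
    have {1}-> : b j = S + (b j - S) by ring.
    apply: le_trans (nmD _ _) _; rewrite (nmB (b j)) lerD2r; exact: nm_sum.
  by rewrite big_split /= -(pairE _ J' K (fun p => nm (a p))) lerD // ltW.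
move=> e e0; have e2 : 0 < e / 2 by rewrite divr_gt0.
have [J0 H0] := hs _ e2; exists [fset p.1 | p in J0]%fset => J' JJ'.
have [K [HK1 HK2]] := approx J' J0 _ e2.
pose P := [fset ((j, i) : J * I) | j in J', i in K j]%fset.
have /H0 : (J0 `<=` P)%fset.
  apply/fsubsetP => p pJ; apply/imfset2P; exists p.1 => /=.
    by apply: (fsubsetP JJ'); apply/imfsetP; exists p.
  by exists p.2; [exact: HK1 | case: (p)].
rewrite pairE => h.
have -> : \sum_(j <- J') b j - s = (\sum_(j <- J') \sum_(i <- K j) a (j, i) - s)
     - \sum_(j <- J') (\sum_(i <- K j) a (j, i) - b j).
  by rewrite sumrB; ring.
apply: le_lt_trans (nmD _ _) _; rewrite nmN.
have := nm_sum J' (fun j => \sum_(i <- K j) a (j, i) - b j).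
by move: h HK2; set x := nm _; set y := \sum_(j <- J') nm _; set z := nm _; lra.
Qed.

(** The geometric series, in the form in which the expansion of a rational
    function is obtained from that of its numerator. The vanishing of f along
    the orbits of tau singles out one of the two expansions of 1 / (1 - q). It
    also gives the bound (1 - |q|) S <= M for every finite sum S of norms of f,
    by induction on the length of the orbits; once f is summable, comparing the
    sums of f and of f o tau determines its value. *)
Lemma hsum_div (I : choiceType) (tau sigma : I -> I) (f : I -> C) (q s : C) :
  cancel tau sigma -> cancel sigma tau -> nm q < 1 ->
  (forall i, exists T, forall t, (T <= t)%N -> f (iter t tau i) = 0) ->
  hsum (fun i => f i - q * f (tau i)) s -> hsum f (s / (1 - q)).
Proof.
move=> tK sK q1 fin hg; have tau_inj := can_inj tK.
pose g i := f i - q * f (tau i).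
have [[M HM] _] := hg.
have bnd T (L : {fset I}) : (forall i, i \in L -> forall t, (T <= t)%N ->
     f (iter t tau i) = 0) -> (1 - nm q) * \sum_(i <- L) nm (f i) <= M.
  elim: T L => [|T IH] L hL.
    rewrite big_seq big1 ?mulr0.
      by apply: le_trans (HM fset0); rewrite big_seq_fset0.
    by move=> i /hL /(_ 0%N) /= ->; rewrite ?nm0.
  have h1 : \sum_(i <- L) nm (f i) <=
      M + nm q * \sum_(i <- (tau @` L)%fset) nm (f i).
    rewrite big_imfset /= => [|i k _ _ /tau_inj//].
    rewrite mulr_sumr; apply: le_trans (lerD (HM L) (lexx _)).
    rewrite -big_split; apply: ler_sum => i _ /=; rewrite -nmM.
    have {1}-> : f i = (f i - q * f (tau i)) + q * f (tau i) by ring.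
    exact: nmD.
  have h2 : (1 - nm q) * \sum_(i <- (tau @` L)%fset) nm (f i) <= M.
    apply: IH => _ /imfsetP[i /= iL ->] t Tt.
    by rewrite -iterSr; apply: hL.
  have q0 := nm_ge0 q; have q1' : 0 < 1 - nm q by rewrite subr_gt0.
  move: h1 h2; set x := \sum_(i <- L) _; set y := \sum_(i <- _) _ => h1 h2.
  have h3 : (1 - nm q) * x <= (1 - nm q) * (M + nm q * y) by rewrite ler_pM2l.
  have h4 : nm q * ((1 - nm q) * y) <= nm q * M by rewrite ler_wpM2l.
  by lra.
have bf : bsum f.
  exists (M / (1 - nm q)) => L; rewrite ler_pdivlMr ?subr_gt0 // mulrC.
  have /choice [T HT] := fin.
  apply: (bnd (\max_(i <- (L : seq I)) T i)%N) => i iL t Tt; apply: HT.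
  by apply: leq_trans Tt; rewrite (big_rem i) //= leq_maxl.
have [u hu] := hsum_exists bf.
have hut : hsum (fun i => f (tau i)) u.
  have h j : (forall i, tau i != j) -> f j = 0.
    by move=> /(_ (sigma j)); rewrite sK eqxx.
  exact: (hsum_inj tau_inj u h).1.
have su := hsum_unique hg (hsumB hu (hsumZ q hut)).
have q1' : 1 - q != 0.
  rewrite subr_eq0; apply: contraTneq q1 => <-.
  by rewrite nm1 ltxx.
have -> : s / (1 - q) = u by rewrite su; field.
exact: hu.
Qed.

End Summation.

(** * Uniqueness of Laurent coefficients *)
Section Uniqueness.
Context {R : realType}.
Local Notation C := (Cplx R).

(** Averaging over the rotations by zeta and zeta eta, where eta is a 2^t-th
    root of -1, kills the terms whose exponent is divisible by 2^t but not by
    2^(t+1). After t averagings the exponents that are left are 0 and nonzero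
    multiples of 2^t, and the latter end up in the tail of the absolutely
    summable family. *)
Lemma hsum_rotate (I : choiceType) (e : I -> int) (a : I -> C) :
  (forall zeta, nm zeta = 1 -> hsum (fun i => a i * zeta ^ e i) 0) ->
  hsum (fun i => if e i == 0 then a i else 0) 0.
Proof.
move=> h.
have P t : forall zeta, nm zeta = 1 ->
    hsum (fun i => if ((2 ^ t)%N%:Z %| e i)%Z then a i * zeta ^ e i else 0) 0.
  elim: t => [|t IH] zeta z1.
    by apply: hsum_ext (h _ z1) => i; rewrite dvd1z.
  have p0 : (0 < 2 ^ t)%N by rewrite expn_gt0.
  pose eta : C := (2 ^ t).-root (-1).
  have etaK : eta ^+ (2 ^ t) = -1 by rewrite rootCK.
  have eta1 : nm eta = 1.
    have : nm eta ^+ (2 ^ t) = 1 by rewrite -nmX etaK nmN nm1.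
    by move/eqP; rewrite pexpr_eq1 ?nm_ge0 // => /eqP.
  have h1 := IH _ z1.
  have h2 : hsum (fun i => if ((2 ^ t)%N%:Z %| e i)%Z then a i * (zeta * eta) ^ e i else 0) 0.
    by apply: IH; rewrite nmM z1 eta1 mul1r.
  have := hsumZ 2^-1 (hsumD h1 h2); rewrite addr0 mulr0.
  apply: hsum_ext => i.
  have [/dvdzP[q eq]|nd] := boolP ((2 ^ t)%N%:Z %| e i)%Z; last first.
    rewrite addr0 mulr0 ifN //; apply: contraNN nd; apply: dvdz_trans.
    by rewrite expnS PoszM dvdz_mull.
  have z0 : zeta \is a GRing.unit.
    by rewrite unitfE -nm_eq0 z1 oner_eq0.
  have e0 : eta \is a GRing.unit.
    by rewrite unitfE -nm_eq0 eta1 oner_eq0.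
  have -> : (zeta * eta) ^ e i = zeta ^ e i * (-1) ^ q.
    rewrite exprzMl // eq; congr (_ * _).
    by rewrite mulrC -exprz_exp -exprnP etaK.
  have -> : ((2 ^ t.+1)%N%:Z %| e i)%Z = (2 %| q)%Z.
    by rewrite eq expnS PoszM dvdz_mul2r // eqz_nat -lt0n.
  have sq : (-1 : C) ^ (2 : int) = 1 by rewrite -exprnP sqrrN expr1n.
  have [p [qE|qE]] : exists p : int, q = 2 * p \/ q = 2 * p + 1.
    exists (q %/ 2)%Z; move: (divz_eq q 2) (modz_ge0 q (isT : 2 != 0 :> int)).
    move: (ltz_pmod q (isT : 0 < 2 :> int)).
    by move: (q %/ 2)%Z (q %% 2)%Z => x y; lia.
  - by rewrite qE -exprz_exp sq exp1rz dvdz_mulr // !mulr1; field.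
  - rewrite qE expfzDr ?oppr_eq0 ?oner_eq0 // -exprz_exp sq exp1rz expr1z mul1r.
    rewrite ifF; first by field.
    by apply/negP => /dvdzP[r]; lia.
have h1 := h 1 (@nm1 R).
have ba : bsum a by case: h1 => + _; apply: bsum_le => i; rewrite exp1rz mulr1.
have [s hs] := hsum_exists (bsum_filter (fun i => e i == 0) ba).
suff s0 : s = 0 by rewrite s0 in hs.
apply: nm_eps => eps eps0; have eps2 : 0 < eps / 2 by rewrite divr_gt0.
have [J0 H0] := bsum_tail ba eps2.
pose t := (\max_(i <- (J0 : seq I)) `|e i|)%N.
have := hsumB (P t 1 (@nm1 R)) hs; set d := fun i => _; rewrite sub0r => hd.
have d0 i : i \in J0 -> d i = 0.
  move=> iJ; rewrite /d exp1rz mulr1; have [->|ei] := eqVneq (e i) 0.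
    by rewrite dvdz0 subrr.
  rewrite subr0 ifN //; apply/negP; rewrite dvdzE absz_nat => /dvdn_leq.
  rewrite absz_gt0 ei => /(_ isT); apply/negP; rewrite -ltnNge /=.
  apply: leq_ltn_trans (ltn_expl t (isT : 1 < 2)%N).
  by rewrite /t (big_rem i) //= leq_maxl.
have dle i : nm (d i) <= nm (a i).
  rewrite /d exp1rz mulr1; case: eqVneq => [->|_]; first by rewrite dvdz0 subrr nm0 nm_ge0.
  by rewrite subr0; case: ifP => //; rewrite nm0 nm_ge0.
have [_ /(_ _ eps2) [J1 H1]] := hd.
have {}H1 := H1 (J0 `|` J1)%fset (fsubsetUr _ _).
have h2 : nm (\sum_(i <- (J0 `|` J1)%fset) d i) < eps / 2.
  rewrite (sum_fsub _ (fsubsetUl J0 J1)) big_seq big1 => [|i /d0 //].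
  rewrite add0r; apply: le_lt_trans (nm_sum _ _) _.
  apply: le_lt_trans (H0 ((J0 `|` J1) `\` J0)%fset _).
    by apply: ler_sum => i _; exact: dle.
  by apply/fdisjointP => i; rewrite inE => /andP[].
move: H1 h2; set S := \sum_(i <- _) d i => H1 h2.
have -> : s = (S - - s) - S by ring.
by apply: le_lt_trans (nmD _ _) _; rewrite nmN; lra.
Qed.

Lemma hsum_single (I : choiceType) (i0 : I) (f : I -> C) s :
  (forall i, i != i0 -> f i = 0) -> hsum f s -> s = f i0.
Proof.
move=> h hs; apply: hsum_unique hs _.
have -> : f i0 = \sum_(i <- [fset i0]%fset) f i by rewrite big_seq_fset1.
by apply: hsum_fin => i; rewrite inE => /h.
Qed.

(** The term of index n0 is isolated by rotating one point z of the annulus,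
    with exponents n - n0. *)
Lemma laurent_unique (r : R) (a : int -> C) : 0 < r ->
  (forall z, 0 < nm z < r -> hsum (fun n => a n * z ^ n) 0) ->
  forall n, a n = 0.
Proof.
move=> r0 h n0; pose z : C := (r / 2)%:C%C.
have r2 : 0 < r / 2 by rewrite divr_gt0.
have nz : nm z = r / 2 by rewrite nm_real // ltW.
have z0 : z \is a GRing.unit by rewrite unitfE -nm_eq0 nz gt_eqF.
have h0 : hsum (fun n => if n - n0 == 0 then a n * z ^ n else 0) 0.
  apply: (hsum_rotate (e := fun n => n - n0)) => zeta z1.
  have zu : zeta \is a GRing.unit by rewrite unitfE -nm_eq0 z1 oner_eq0.
  have hz : 0 < nm (z * zeta) < r by rewrite nmM z1 mulr1 nz; lra.
  have := hsumZ (zeta ^ (- n0)) (h _ hz); rewrite mulr0; apply: hsum_ext => n.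
  rewrite exprzMl // expfzDr ?unitfE -1?nm_eq0 ?z1 ?oner_eq0 //; ring.
have h1 := hsum_single (i0 := n0) _ h0.
have /esym/eqP : 0 = if n0 - n0 == 0 then a n0 * z ^ n0 else 0.
  by apply: h1 => n; rewrite subr_eq0 => /negbTE ->.
rewrite subrr eqxx mulf_eq0 expfz_eq0 -[z == 0]nm_eq0 nz (gt_eqF r2) andbF orbF.
by move/eqP.
Qed.

Definition laurent_exp (f : C -> C) (a : int -> C) : Prop :=
  exists2 r : R, 0 < r & forall z : C, 0 < nm z < r ->
    hsum (fun n : int => a n * z ^ n) (f z).

Lemma laurent_expP f a : is_laurent_expansion f a <-> laurent_exp f a.
Proof.
split=> [[r r0 h]|[r r0 h]].
  move: r0; rewrite ltcE => /andP[/eqP ri r0].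
  exists (complex.Re r) => // z /andP[z0 zr]; apply/abs_convP/h.
  rewrite nmE ltcR z0 /= ltcE /= zr andbT.
  by rewrite ri.
exists (r%:C)%C; first by rewrite ltcR.
by move=> z; rewrite nmE !ltcR => /h /abs_convP.
Qed.

Lemma laurent_coefE f a n : laurent_exp f a -> laurent_coef f n = a n.
Proof.
move=> h; rewrite /laurent_coef; case: xgetP => [b _ /laurent_expP hb|no]; last first.
  by case: (no a); apply/laurent_expP.
case: h hb => [r r0 hr] [s s0 hs].
have m0 : 0 < Num.min r s by rewrite lt_min r0.
apply/eqP; rewrite -subr_eq0; apply/eqP.
apply: (@laurent_unique _ (fun n => b n - a n) m0) => z /andP[z0].
rewrite lt_min => /andP[zr zs].
have hz1 : 0 < nm z < r by rewrite z0.
have hz2 : 0 < nm z < s by rewrite z0.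
have := hsumB (hs _ hz2) (hr _ hz1); rewrite subrr; apply: hsum_ext => m.
by rewrite mulrBl.
Qed.

(** The power of z that multiplies the product of the modes n_1, ..., n_k in the
    expansion of a product of fields. *)
Definition mono (k : nat) (z : k.-tuple C) (n : k.-tuple int) : C :=
  \prod_(j < k) tnth z j ^ (- tnth n j - 1).

Lemma mono_neq0 k (z : k.-tuple C) n : (forall j, tnth z j != 0) -> mono z n != 0.
Proof. by move=> h; apply/prodf_neq0 => j _; rewrite expfz_eq0 negb_and h orbT. Qed.

Lemma mono_cons k (x : C) (z : k.-tuple C) (m : int) (n : k.-tuple int) :
  mono [tuple of x :: z] [tuple of m :: n] = x ^ (- m - 1) * mono z n.
Proof.
rewrite /mono big_ord_recl !tnth0; congr (_ * _).
by apply: eq_bigr => j _; rewrite !tnthS.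
Qed.

Definition turn k (z : k.-tuple C) (j : 'I_k) (zeta : C) : k.-tuple C :=
  [tuple (if i == j then zeta * tnth z i else tnth z i) | i < k].

Lemma mono_turn k (z : k.-tuple C) (j : 'I_k) (zeta : C) (n : k.-tuple int) :
  (forall i, tnth z i != 0) -> zeta != 0 ->
  mono (turn z j zeta) n = zeta ^ (- tnth n j - 1) * mono z n.
Proof.
move=> zn0 zeta0; rewrite /mono.
have E i : tnth (turn z j zeta) i ^ (- tnth n i - 1) =
    (if i == j then zeta ^ (- tnth n i - 1) else 1) * tnth z i ^ (- tnth n i - 1).
  rewrite tnth_mktuple; case: (i == j); last by rewrite mul1r.
  by rewrite exprzMl ?unitfE.
by rewrite (eq_bigr _ (fun i _ => E i)) big_split -big_mkcond big_pred1_eq.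
Qed.

(** The indices are fixed to those of n0 one coordinate at a time, by rotating
    that coordinate; any nonempty domain stable under such rotations will do, in
    particular the region of radially ordered points. *)
Lemma multi_unique k (Om : set (k.-tuple C)) (c : k.-tuple int -> C) z0 :
  (forall z, Om z -> forall j, tnth z j != 0) ->
  (forall z j zeta, Om z -> nm zeta = 1 -> Om (turn z j zeta)) ->
  (forall z, Om z -> hsum (fun n => c n * mono z n) 0) ->
  Om z0 -> forall n, c n = 0.
Proof.
move=> Onz Orot h O0 n0.
have Q m : (m <= k)%N -> forall z, Om z ->
    hsum (fun n => if [forall i : 'I_k, (i < m)%N ==> (tnth n i == tnth n0 i)]
                   then c n * mono z n else 0) 0.
  elim: m => [|m IH] mk z Oz.
    apply: hsum_ext (h _ Oz) => n; rewrite ifT //.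
    by apply/forallP => i; rewrite ltn0.
  pose j := Ordinal mk.
  pose a n := if [forall i : 'I_k, (i < m)%N ==> (tnth n i == tnth n0 i)]
                   then c n * mono z n else 0.
  have := @hsum_rotate _ (fun n : k.-tuple int => tnth n0 j - tnth n j) a.
  case=> [zeta z1|].
    have zu : zeta != 0 by rewrite -nm_eq0 z1 oner_eq0.
    have := hsumZ (zeta ^ (tnth n0 j + 1)) (IH (ltnW mk) _ (Orot _ j _ Oz z1)).
    rewrite mulr0; apply: hsum_ext => n; rewrite /a (mono_turn _ _ (Onz _ Oz) zu).
    case: [forall _, _]; last by rewrite mulr0 mul0r.
    have -> : zeta ^ (tnth n0 j - tnth n j) =
        zeta ^ (tnth n0 j + 1) * zeta ^ (- tnth n j - 1).
      by rewrite -expfzDr //; congr (_ ^ _); ring.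
    move: (zeta ^ _) (zeta ^ _) (mono z n) (c n) => x y u w.
    by rewrite [in RHS]mulrC -!mulrA; congr (_ * _); rewrite mulrCA.
  move=> ha hb; apply: hsum_ext (conj ha hb) => n; rewrite /a subr_eq0 eq_sym.
  case: eqP => [nj|nj].
    have -> : [forall i : 'I_k, (i < m.+1)%N ==> (tnth n i == tnth n0 i)] =
        [forall i : 'I_k, (i < m)%N ==> (tnth n i == tnth n0 i)] => //.
    apply: eq_forallb => i; rewrite ltnS leq_eqVlt.
    have [ij|//] := eqVneq (i : nat) m.
    have -> : i = j by apply: val_inj.
    by rewrite nj eqxx !implybT.
  rewrite ifN //; apply/negP => /forallP/(_ j); rewrite ltnSn /= => /eqP.
  exact: nj.
have /esym/eqP : 0 = if [forall i : 'I_k, (i < k)%N ==> (tnth n0 i == tnth n0 i)]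
    then c n0 * mono z0 n0 else 0.
  apply: (hsum_single (i0 := n0) _ (Q k (leqnn k) _ O0)) => n nn.
  rewrite ifN //; apply: contraNN nn => /forallP hn.
  by apply/eqP/eq_from_tnth => i; move: (hn i); rewrite ltn_ord => /eqP.
rewrite ifT; last by apply/forallP => i; rewrite eqxx implybT.
by rewrite mulf_eq0 (negbTE (mono_neq0 _ (Onz _ O0))) orbF => /eqP.
Qed.

End Uniqueness.

(** * Iterated residues *)
Section Iterated.
Context {R : realType}.
Local Notation C := (Cplx R).

Lemma hsum_cons k (a : k.+1.-tuple int -> C) s :
  hsum a s <-> hsum (fun p : k.-tuple int * int => a [tuple of p.2 :: p.1]) s.
Proof.
apply: (hsum_inj (f := fun p : k.-tuple int * int => [tuple of p.2 :: p.1])).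
  move=> [n m] [n' m'] /= /(congr1 val) /= [-> e].
  by congr (_, _); apply: val_inj.
move=> t /(_ (behead_tuple t, thead t)) /=.
by rewrite -tuple_eta eqxx.
Qed.

Lemma hsum_mul (I J : choiceType) (a : I -> C) (b : J -> C) s t :
  hsum a s -> hsum b t -> hsum (fun p : I * J => a p.1 * b p.2) (s * t).
Proof.
move=> hs ht; have [[M HM] _] := hs; have [[N HN] _] := ht.
have bp : bsum (fun p : I * J => a p.1 * b p.2).
  exists (M * N) => K.
  pose A := [fset p.1 | p in K]%fset; pose B := [fset p.2 | p in K]%fset.
  apply: (@le_trans _ _ (\sum_(i <- A) \sum_(j <- B) nm (a i * b j))).
    have -> : \sum_(i <- A) \sum_(j <- B) nm (a i * b j) =
      \sum_(p <- [fset ((i, j) : I * J) | i in A, j in B]%fset)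
        nm (a p.1 * b p.2).
      by rewrite big_imfset2 // => -[? ?] [? ?] _ _ /= [-> ->].
    apply: ler_fsub => [|p]; last exact: nm_ge0.
    apply/fsubsetP => p pK; apply/imfset2P; exists p.1 => /=.
      by apply/imfsetP; exists p.
    by exists p.2; [apply/imfsetP; exists p | case: (p)].
  under eq_bigr => i _ do under eq_bigr => j _ do rewrite nmM.
  under eq_bigr => i _ do rewrite -mulr_sumr.
  rewrite -mulr_suml ler_pM // sumr_ge0 // => i _; exact: nm_ge0.
have [u hu] := hsum_exists bp.
have hst : hsum (fun i => a i * t) u.
  by apply: (hsum_fubini hu) => i; exact: (hsumZ (a i) ht).
suff <- : u = s * t by [].
apply: hsum_unique hst _; rewrite mulrC.
by apply: hsum_ext (hsumZ t hs) => i; rewrite mulrC.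
Qed.

Lemma hsum_prod k (g : 'I_k -> int -> C) (s : 'I_k -> C) :
  (forall j, hsum (g j) (s j)) ->
  hsum (fun n : k.-tuple int => \prod_(j < k) g j (tnth n j)) (\prod_(j < k) s j).
Proof.
elim: k g s => [|k IH] g s h.
  pose S : {fset 0.-tuple int} := [fset [tuple]]%fset.
  have := @hsum_fin R _ S (fun n => \prod_(j < 0) g j (tnth n j)).
  rewrite big_seq_fset1 !big_ord0; apply=> n; rewrite inE.
  by rewrite (tuple0 n) eqxx.
apply/hsum_cons; rewrite big_ord_recl mulrC.
have h2 := hsum_mul (IH (fun j => g (lift ord0 j)) (fun j => s (lift ord0 j))
   (fun j => h (lift ord0 j))) (h ord0).
apply: hsum_ext h2 => -[n m] /=.
rewrite big_ord_recl tnth0 mulrC; congr (_ * _).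
by apply: eq_bigr => j _; rewrite tnthS.
Qed.

Lemma radial_cons k (x : C) (z : k.-tuple C) : x != 0 -> radially_ordered z ->
  (forall j, nm (tnth z j) < nm x) -> radially_ordered [tuple of x :: z].
Proof.
move=> x0 [z0 zo] zx; split=> [j|j l].
  by case: (unliftP ord0 j) => [i|] ->; rewrite ?tnthS ?tnth0 // normr_gt0.
case: (unliftP ord0 j) => [j'|] ->; case: (unliftP ord0 l) => [l'|] -> //.
  by rewrite !tnthS /= /bump !leq0n !add1n ltnS; exact: zo.
by rewrite tnth0 tnthS nm_lt => _; exact: zx.
Qed.

Lemma radial_exists k (r : R) : 0 < r -> exists z : k.-tuple C,
  radially_ordered z /\ forall j, nm (tnth z j) < r.
Proof.
elim: k r => [|k IH] r r0.
  by exists [tuple]; split; [split => [[]|[]]|case].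
have r2 : 0 < r / 2 by rewrite divr_gt0.
have [z [zo zr]] := IH _ r2; pose x : C := (r / 2)%:C%C.
have nx : nm x = r / 2 by rewrite nm_real // ltW.
exists [tuple of x :: z]; split.
  by apply: radial_cons => //; [rewrite -nm_eq0 nx gt_eqF | move=> j; rewrite nx].
move=> j; case: (unliftP ord0 j) => [i|] ->; rewrite ?tnthS ?tnth0 ?nx; last lra.
by have := zr i; lra.
Qed.

Lemma radial_neq0 k (z : k.-tuple C) : radially_ordered z -> forall j, tnth z j != 0.
Proof. by move=> [h _] j; rewrite -normr_gt0. Qed.

(** Summing the expansion first over the last k - 1 indices gives the Laurent
    expansion in xi_1 of the inner iterated residue, which is known by
    induction, with |xi_1| in place of r. *)
Lemma iterated_residueE k (r : R) (f : k.-tuple C -> C) (d : k.-tuple int -> C) :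
  0 < r ->
  (forall xi, radially_ordered xi -> (forall j, nm (tnth xi j) < r) ->
     hsum (fun n => d n * mono xi n) (f xi)) ->
  iterated_residue f = d [tuple 0 | _ < k].
Proof.
elim: k r f d => [|k IH] r f d r0 h.
  have z : 0.-tuple C := [tuple].
  have h1 : hsum (fun n => d n * mono [tuple] n) (f [tuple]).
    by apply: h; [split => -[] | case].
  have := hsum_single (i0 := [tuple]) _ h1.
  rewrite /mono big_ord0 mulr1 /= (tuple0 [tuple 0 | _ < 0]); apply=> i /eqP[].
  by apply: eq_from_tnth => -[].
(* The series in the first index alone converges: divide a convergent subseries
   by its monomial in the other variables. *)
have fib (x : C) (n' : k.-tuple int) : 0 < nm x < r ->
    exists s, hsum (fun n => d [tuple of n :: n'] * x ^ (- n - 1)) s.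
  move=> /andP[x0 xr]; have [z [zo zx]] := radial_exists k x0.
  have xn0 : x != 0 by rewrite -nm_gt0.
  have zn := radial_neq0 zo.
  have /h : radially_ordered [tuple of x :: z] by exact: radial_cons.
  case=> [j|+ _].
    case: (unliftP ord0 j) => [i|] ->; rewrite ?tnthS ?tnth0 //.
    exact: lt_trans (zx i) xr.
  have inj : injective (fun n : int => [tuple of n :: n']).
    by move=> m n /(congr1 val) [].
  move=> /(bsum_inj inj)/hsum_exists[s hs].
  exists ((mono z n')^-1 * s); apply: hsum_ext (hsumZ _ hs) => n.
  rewrite mono_cons; have := mono_neq0 n' zn.
  by move: (mono z n') (x ^ _) => u w u0; rewrite mulrC -!mulrA mulfV // mulr1.
have /choice [D HD] : forall x, exists s : k.-tuple int -> C, 0 < nm x < r ->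
    forall n' : k.-tuple int,
      hsum (fun n => d [tuple of n :: n'] * x ^ (- n - 1)) (s n').
  move=> x; have [hx|hx] := pselect (is_true (0 < nm x < r)); last by exists (fun=> 0).
  have /choice [s hs] := fun n' => fib x n' hx.
  by exists s.
have inner x : 0 < nm x < r ->
    iterated_residue (fun xs : k.-tuple C => f [tuple of x :: xs]) =
    D x [tuple 0 | _ < k].
  move=> hx; have /andP[x0 xr] := hx; apply: (IH _ _ _ x0) => xi xo xix.
  have xn0 : x != 0 by rewrite -nm_gt0.
  have /h : radially_ordered [tuple of x :: xi] by exact: radial_cons.
  have hr j : nm (tnth [tuple of x :: xi] j) < r.
    case: (unliftP ord0 j) => [i|] ->; rewrite ?tnthS ?tnth0 //.
    exact: lt_trans (xix i) xr.
  move=> /(_ hr)/hsum_cons/hsum_fubini; apply=> n' /=.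
  rewrite mulrC; apply: hsum_ext (hsumZ (mono xi n') (HD x hx n')) => n.
  by rewrite /= mono_cons mulrC -mulrA.
rewrite /= /residue0.
pose a (p : int) := d [tuple of (- p - 1) :: [tuple 0 | _ < k]].
have -> : d [tuple 0 | _ < k.+1] = a (-1).
  congr d; apply: eq_from_tnth => i; rewrite tnth_mktuple.
  by case: (unliftP ord0 i) => [j|] ->; rewrite ?tnthS ?tnth0 ?tnth_mktuple // opprK subrr.
apply: (laurent_coefE (a := a)); exists r => // x hx; rewrite (inner _ hx).
have opp_inj : injective (fun p : int => - p - 1) by move=> p q /addIr/oppr_inj.
have hsurj (j : int) : (forall i : int, - i - 1 != j) ->
   d [tuple of j :: [tuple 0 | _ < k]] * x ^ (- j - 1) = 0.
  by move=> /(_ (- j - 1))/eqP[]; lia.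
have := (hsum_inj opp_inj _ hsurj).1 (HD x hx [tuple 0 | _ < k]).
by apply: hsum_ext => n; congr (_ * _ ^ _); lia.
Qed.

End Iterated.

(** * Finitely supported sums *)
Section FiniteSupport.
Context {I : choiceType}.

Definition fsupp (W : nmodType) (F : I -> W) : Prop :=
  exists A : {fset I}, forall i, i \notin A -> F i = 0.

Definition zs (W : nmodType) (F : I -> W) : W := \sum_(i \in [set: I]) F i.

Lemma zsE (W : nmodType) (F : I -> W) (A : {fset I}) :
  (forall i, i \notin A -> F i = 0) -> zs F = \sum_(i <- A) F i.
Proof. exact: fsbigTE. Qed.

Lemma eq_zs (W : nmodType) (F F' : I -> W) : F =1 F' -> zs F = zs F'.
Proof. by move=> /funext ->. Qed.

Lemma eq_fsupp (W : nmodType) (F F' : I -> W) : F =1 F' -> fsupp F -> fsupp F'.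
Proof. by move=> /funext ->. Qed.

Lemma fsupp2 (W W' : nmodType) (F : I -> W) (F' : I -> W') :
  fsupp F -> fsupp F' -> exists A : {fset I},
    (forall i, i \notin A -> F i = 0) /\ (forall i, i \notin A -> F' i = 0).
Proof.
move=> [A hA] [B hB]; exists (A `|` B)%fset.
by split=> i; rewrite in_fsetU negb_or => /andP[/hA ? /hB ?].
Qed.

Lemma fsuppD (W : nmodType) (F F' : I -> W) :
  fsupp F -> fsupp F' -> fsupp (fun i => F i + F' i).
Proof.
move=> /fsupp2 h /h[A [h1 h2]]; exists A => i iA.
by rewrite h1 ?h2 ?addr0.
Qed.

Lemma fsupp_map (W W' : nmodType) (f : I -> W -> W') (F : I -> W) :
  (forall i, f i 0 = 0) -> fsupp F -> fsupp (fun i => f i (F i)).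
Proof. by move=> f0 [A h]; exists A => i /h ->. Qed.

Lemma zsD (W : nmodType) (F F' : I -> W) : fsupp F -> fsupp F' ->
  zs (fun i => F i + F' i) = zs F + zs F'.
Proof.
move=> /fsupp2 h /h[A [h1 h2]].
rewrite (zsE h1) (zsE h2) (zsE (A := A)) ?big_split // => i iA.
by rewrite h1 ?h2 ?addr0.
Qed.

Lemma zs_map (W W' : nmodType) (f : W -> W') (F : I -> W) :
  f 0 = 0 -> {morph f : x y / x + y} -> fsupp F ->
  f (zs F) = zs (fun i => f (F i)).
Proof.
move=> f0 fD [A h]; rewrite (zsE h) (zsE (A := A)) => [|i /h -> //].
exact: (big_morph f fD f0).
Qed.

Lemma zs0 (W : nmodType) (F : I -> W) : (forall i, F i = 0) -> zs F = 0.
Proof. by move=> h; rewrite (zsE (A := fset0)) ?big_seq_fset0. Qed.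

Lemma zs_single (W : nmodType) (i0 : I) (F : I -> W) :
  (forall i, i != i0 -> F i = 0) -> zs F = F i0.
Proof.
move=> h; rewrite (zsE (A := [fset i0]%fset)) ?big_seq_fset1 // => i.
by rewrite inE => /h.
Qed.

Lemma fsupp_single (W : nmodType) (i0 : I) (F : I -> W) :
  (forall i, i != i0 -> F i = 0) -> fsupp F.
Proof. by move=> h; exists [fset i0]%fset => i; rewrite inE => /h. Qed.

Lemma zs_bij (W : nmodType) (f g : I -> I) (F : I -> W) :
  cancel f g -> cancel g f -> zs (fun i => F (f i)) = zs F.
Proof.
by move=> fK gK; apply/esym/reindex_fsbigT; exists g.
Qed.

Lemma zsN (W : zmodType) (F : I -> W) : fsupp F -> zs (fun i => - F i) = - zs F.
Proof. by move=> h; rewrite (zs_map (f := -%R)) ?oppr0 //; exact: opprD. Qed.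

Lemma zsZ (K : pzRingType) (W : lmodType K) (c : K) (F : I -> W) :
  fsupp F -> zs (fun i => c *: F i) = c *: zs F.
Proof.
by move=> h; rewrite (zs_map (f := *:%R c)) ?scaler0 //; exact: scalerDr.
Qed.

Lemma zs_exch (W : nmodType) (T : Type) (r : seq T) (F : T -> I -> W) :
  (forall t, fsupp (F t)) ->
  zs (fun i => \sum_(t <- r) F t i) = \sum_(t <- r) zs (F t) /\
  fsupp (fun i => \sum_(t <- r) F t i).
Proof.
move=> h; elim: r => [|t r [IH1 IH2]].
  split; first by rewrite big_nil zs0 // => i; rewrite big_nil.
  by exists fset0 => i; rewrite big_nil.
have E i : \sum_(j <- t :: r) F j i = F t i + \sum_(j <- r) F j i.
  by rewrite big_cons.
split; last by apply: eq_fsupp (fsuppD (h t) IH2) => i; rewrite E.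
by rewrite (eq_zs E) zsD // IH1 big_cons.
Qed.

End FiniteSupport.

Lemma fsupp_inj (I J : choiceType) (W : nmodType) (f : I -> J) (F : J -> W) :
  injective f -> fsupp F -> fsupp (fun i => F (f i)).
Proof.
move=> fI [A h]; have [L HL] := fpreim_ex fI A.
by exists L => i; rewrite HL => /h.
Qed.

(** * Generalized binomial coefficients *)
Section Binomials.
Context {K : numFieldType}.
Implicit Types (x : K) (j : nat).

(** The binomial coefficient x (x - 1) ... (x - j + 1) / j!. *)
Fixpoint gbin x j : K :=
  if j is j'.+1 then gbin x j' * (x - j'%:R) / j'.+1%:R else 1.

Lemma gbinS x j : j.+1%:R * gbin x j.+1 = (x - j%:R) * gbin x j.
Proof.
have j0 : j.+1%:R != 0 :> K by rewrite pnatr_eq0.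
by rewrite /= mulrC divfK // mulrC.
Qed.

Lemma gbin_absorb x j : x * gbin (x - 1) j = j.+1%:R * gbin x j.+1.
Proof.
elim: j => [|j IH]; first by rewrite /= mulr1 subr0 divr1 mul1r mul1r.
have j0 : j.+1%:R != 0 :> K by rewrite pnatr_eq0.
have j1 : j.+2%:R != 0 :> K by rewrite pnatr_eq0.
apply: (mulfI j0); rewrite (gbinS x) mulrCA (gbinS (x - 1)) mulrCA IH.
by rewrite -[j.+1%:R]natr1; ring.
Qed.

Lemma gbin_pascal x j : gbin (x + 1) j.+1 = gbin x j.+1 + gbin x j.
Proof.
have j0 : j.+1%:R != 0 :> K by rewrite pnatr_eq0.
apply: (mulfI j0); rewrite -gbin_absorb addrK mulrDr gbinS.
by rewrite -[j.+1%:R]natr1; ring.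
Qed.

Lemma gbin_small (y j : nat) : (y < j)%N -> gbin y%:R j = 0.
Proof.
elim: j => // j IH; rewrite ltnS leq_eqVlt => /orP[/eqP->|/IH h] /=.
  by rewrite subrr mulr0 mul0r.
by rewrite h !mul0r.
Qed.

Lemma gbinn (j : nat) : gbin j%:R j = 1.
Proof.
elim: j => // j IH.
by rewrite -natr1 gbin_pascal IH gbin_small ?add0r.
Qed.

Lemma gbin_nat (y j : nat) : gbin y%:R j = 'C(y, j)%:R.
Proof.
elim: y j => [|y IH] [|j]; rewrite ?bin0 //; first by rewrite gbin_small.
by rewrite -natr1 gbin_pascal !IH binS natrD addrC.
Qed.

End Binomials.

(** * Formal calculus of mode sequences *)
Section Calculus.
Context {K : numFieldType} {V : lmodType K}.
Implicit Types (h F : int -> V) (m s n : int) (j N : nat).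

Definition lin (f : V -> V) : Prop :=
  forall (a : K) u v, f (a *: u + v) = a *: f u + f v.

Lemma lin0 f : lin f -> f 0 = 0.
Proof.
move=> fl; have := fl 1 0 0; rewrite !scale1r addr0 => /eqP.
by rewrite -subr_eq0 opprD addNKr oppr_eq0 => /eqP.
Qed.

Lemma linD f u v : lin f -> f (u + v) = f u + f v.
Proof. by move=> fl; have := fl 1 u v; rewrite !scale1r. Qed.

Lemma linZ f a u : lin f -> f (a *: u) = a *: f u.
Proof. by move=> fl; have := fl a u 0; rewrite (lin0 fl) !addr0. Qed.

Lemma linN f u : lin f -> f (- u) = - f u.
Proof. by move=> fl; rewrite -scaleN1r linZ // scaleN1r. Qed.

Lemma linB f u v : lin f -> f (u - v) = f u - f v.
Proof. by move=> fl; rewrite linD // linN. Qed.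

Lemma lin_sum f (J : Type) (r : seq J) (F : J -> V) : lin f ->
  f (\sum_(i <- r) F i) = \sum_(i <- r) f (F i).
Proof.
by move=> fl; apply: (big_morph f) => [u v|]; [exact: linD | exact: lin0].
Qed.

Lemma lin_zs (I : choiceType) f (F : I -> V) : lin f -> fsupp F ->
  f (zs F) = zs (fun i => f (F i)).
Proof. by move=> fl; apply: zs_map => [|u v]; [exact: lin0 | exact: linD]. Qed.

Lemma lin_comp f g : lin f -> lin g -> lin (fun v => f (g v)).
Proof. by move=> fl gl a u v; rewrite gl fl. Qed.

(** dl is multiplication by x - 1 on the series with coefficients
    h m at x ^ (- m - 1). *)
Definition dl h : int -> V := fun m => h (m + 1) - h m.

Lemma dl_sub h h' : dl (fun m => h m - h' m) = fun m => dl h m - dl h' m.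
Proof.
apply/funext => m; rewrite /dl !opprB [LHS]addrACA [RHS]addrACA.
by congr (_ + _); exact: addrC.
Qed.

Lemma dlN_sub N h h' :
  iter N dl (fun m => h m - h' m) = fun m => iter N dl h m - iter N dl h' m.
Proof.
by elim: N h h' => // N IH h h'; rewrite !iterS IH dl_sub.
Qed.

Lemma dlN_lin N h f : lin f -> iter N dl (fun m => f (h m)) = fun m => f (iter N dl h m).
Proof.
move=> fl; elim: N => // N IH; rewrite !iterS IH; apply/funext => m.
by rewrite /dl linB.
Qed.

Lemma lin_scale (a : K) : lin (fun v => a *: v).
Proof. by move=> b u v; rewrite scalerDr !scalerA mulrC. Qed.

Lemma dlN_scale N h (a : K) :
  iter N dl (fun m => a *: h m) = fun m => a *: iter N dl h m.
Proof. exact: dlN_lin (lin_scale a). Qed.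

Lemma dlN_comb N (x : K) h h' : iter N dl (fun m => x *: h m + h' m) =
  fun m => x *: iter N dl h m + iter N dl h' m.
Proof.
have -> : (fun m => x *: h m + h' m) = fun m => x *: h m - -1 *: h' m.
  by apply/funext => m; rewrite scaleN1r opprK.
by rewrite dlN_sub !dlN_scale; apply/funext => m; rewrite scaleN1r opprK.
Qed.

Lemma dlN0 N : iter N dl (fun=> 0) = fun=> 0.
Proof. by elim: N => // N IH; rewrite iterS IH; apply/funext => m; rewrite /dl subrr. Qed.

Definition lowz h n := forall m, m < n -> h m = 0.
Definition highz h n := forall m, n < m -> h m = 0.

Lemma dlN_highz N h n : highz h n -> highz (iter N dl h) n.
Proof.
by elim: N => // N IH /IH H m nm; rewrite iterS /dl !H ?subrr //; lia.
Qed.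

Lemma dlN_lowz N h n : lowz h n -> lowz (iter N dl h) (n - N%:Z).
Proof.
move=> hn; elim: N => [|N IH] m mn; first by apply: hn; lia.
by rewrite iterS /dl !IH ?subrr //; lia.
Qed.

Lemma dlN_first N h n : lowz h n -> iter N dl h (n - N%:Z) = h n.
Proof.
move=> hn; elim: N => [|N IH]; first by rewrite /= subr0.
rewrite iterS /dl -[in RHS]IH; have -> : n - N.+1%:Z + 1 = n - N%:Z by lia.
have -> : iter N dl h (n - N.+1%:Z) = 0 by apply: (dlN_lowz hn); lia.
by rewrite subr0.
Qed.

(** A series killed by x - 1 has constant coefficients, hence is zero if it is
    bounded below. *)
Lemma dlN_inj N h n : lowz h n -> (forall m, iter N dl h m = 0) ->
  forall m, h m = 0.
Proof.
move=> hn; elim: N => // N IH H; apply: IH.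
have H1 m : iter N dl h (m + 1) = iter N dl h m.
  by apply/eqP; rewrite -subr_eq0; apply/eqP; exact: (H m).
have low := dlN_lowz (N := N) hn.
have up (k : nat) : iter N dl h (n - N%:Z - 1 + k%:Z) = 0.
  elim: k => [|k IHk]; first by apply: low; lia.
  have -> : n - N%:Z - 1 + k.+1%:Z = n - N%:Z - 1 + k%:Z + 1 by lia.
  by rewrite H1.
move=> m; case: (ltP m (n - N%:Z)) => [/low //|nm].
by have -> : m = n - N%:Z - 1 + (absz (m - (n - N%:Z - 1))%R)%:Z by lia.
Qed.

Lemma bounded_fsupp h n n' : lowz h n -> highz h n' -> fsupp h.
Proof.
move=> hl hh.
have [s hs] : exists s : seq int, forall m, n <= m -> m <= n' -> m \in s.
  exists [seq (n + i%:Z)%R | i <- iota 0 (absz (n' - n)%R).+1] => m nm mn.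
  by apply/mapP; exists (absz (m - n)%R); [rewrite mem_iota; lia | lia].
exists [fset x in s]%fset => m; rewrite inE => /negP mN.
case: (ltP m n) => [/hl //|nm]; case: (ltP n' m) => [/hh //|mn].
by case: mN; exact: hs.
Qed.

Lemma fsupp_bounded h : fsupp h -> exists n n', lowz h n /\ highz h n'.
Proof.
move=> [A hA]; pose B := (\max_(i <- (A : seq int)) `|i|)%N.
have hB i : i \in A -> (`|i| <= B)%N by move=> iA; rewrite /B (big_rem i) //= leq_maxl.
exists (- B%:Z), B%:Z; split=> m mB; apply: hA; apply/negP => /hB; lia.
Qed.

Lemma fsupp_dl h : fsupp h -> fsupp (dl h).
Proof.
move=> /fsupp_bounded[n [n' [hl hh]]].
exact: bounded_fsupp (@dlN_lowz 1 h n hl) (@dlN_highz 1 h n' hh).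
Qed.

(** Taylor coefficients at x = 1 : if F m is the coefficient of x ^ (- m - 1)
    in a Laurent polynomial, taylor j F is that of (x - 1) ^ j. *)
Definition taylor (j : int) F : V :=
  if j is Posz j' then zs (fun m => gbin (- m - 1)%:~R j' *: F m) else 0.

Lemma fsupp_gbin (c : int -> K) F : fsupp F -> fsupp (fun m => c m *: F m).
Proof. by apply: (fsupp_map (f := fun m v => c m *: v)) => m; rewrite scaler0. Qed.

Lemma taylor_sub (j : int) F F' : fsupp F -> fsupp F' ->
  taylor j (fun m => F m - F' m) = taylor j F - taylor j F'.
Proof.
case: j => j hF hF' /=; last by rewrite subr0.
have hN : fsupp (fun m => - (gbin (- m - 1)%:~R j *: F' m) : V).
  by apply: (fsupp_map (f := fun=> -%R)); [rewrite oppr0 | exact: fsupp_gbin].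
rewrite -zsN; last exact: fsupp_gbin.
rewrite -zsD //; last exact: fsupp_gbin.
by apply: eq_zs => m; rewrite scalerBr.
Qed.

Lemma taylor_lin (j : int) F f : lin f -> fsupp F -> taylor j (fun m => f (F m)) = f (taylor j F).
Proof.
move=> fl; case: j => j hF /=; last by rewrite lin0.
by rewrite lin_zs //; [apply: eq_zs => m; rewrite linZ | exact: fsupp_gbin].
Qed.

Lemma taylor_comb (j : int) (x : K) F F' : fsupp F -> fsupp F' ->
  taylor j (fun m => x *: F m + F' m) = x *: taylor j F + taylor j F'.
Proof.
move=> hF hF'.
have -> : (fun m => x *: F m + F' m) = fun m => x *: F m - -1 *: F' m.
  by apply/funext => m; rewrite scaleN1r opprK.
have hx (y : K) F0 : fsupp F0 -> fsupp (fun m => y *: F0 m) by exact: fsupp_gbin.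
rewrite taylor_sub; [|exact: hx..].
by rewrite !(taylor_lin _ (lin_scale _)) // scaleN1r opprK.
Qed.

Lemma taylor0 (j : int) F : (forall m, F m = 0) -> taylor j F = 0.
Proof. by case: j => //= j h; apply: zs0 => m; rewrite h scaler0. Qed.

Lemma zs_shift (c : int -> V) (d : int) : zs (fun m => c (m + d)) = zs c.
Proof. by apply: (zs_bij (f := +%R^~ d) (g := +%R^~ (- d))) => m; rewrite ?addrK ?subrK. Qed.

Lemma fsupp_shift h (d : int) : fsupp h -> fsupp (fun m => h (m + d)).
Proof. by apply: fsupp_inj => x y /addIr. Qed.

Lemma taylor_dl (j : int) F : fsupp F -> taylor j (dl F) = taylor (j - 1) F.
Proof.
case: j => [j|j] hF //; rewrite {1}/taylor.
have -> : zs (fun m => gbin (- m - 1)%:~R j *: dl F m) =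
   zs (fun m => gbin (- m - 1)%:~R j *: F (m + 1)) - zs (fun m => gbin (- m - 1)%:~R j *: F m).
  rewrite -zsN; last exact: fsupp_gbin.
  rewrite -zsD; first by apply: eq_zs => m; rewrite scalerBr.
    exact: (fsupp_gbin (fun m => gbin (- m - 1)%:~R j) (fsupp_shift 1 hF)).
  by apply: (fsupp_map (f := fun=> -%R)); [rewrite oppr0 | exact: fsupp_gbin].
have -> : zs (fun m => gbin (- m - 1)%:~R j *: F (m + 1)) =
   zs (fun m => gbin (- m - 1 + 1)%:~R j *: F m).
  rewrite -(zs_shift (fun m => gbin (- m - 1 + 1)%:~R j *: F m) 1).
  by apply: eq_zs => m; congr (gbin _ _ *: _); congr (_%:~R); lia.
rewrite -zsN -?zsD; try exact: fsupp_gbin; last first.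
  by apply: (fsupp_map (f := fun=> -%R)); [rewrite oppr0 | exact: fsupp_gbin].
case: j => [|j].
  by apply: zs0 => m; rewrite /= !scale1r subrr.
have -> : Posz j.+1 - 1 = j by lia.
rewrite /taylor; apply: eq_zs => m; rewrite -scalerBl intrD; congr (_ *: _).
by have := gbin_pascal ((- m - 1)%:~R : K) j; rewrite /= => ->; ring.
Qed.

Lemma taylor_dlN (j : int) N F : fsupp F -> taylor j (iter N dl F) = taylor (j - N%:Z) F.
Proof.
move=> hF; elim: N j => [|N IH] j; first by rewrite subr0.
rewrite iterS taylor_dl ?IH; last by elim: N {IH} => //= N; exact: fsupp_dl.
by congr (taylor _ F); lia.
Qed.

End Calculus.

(** * Locality, products of fields and Dong's lemma *)
Section Locality.
Context {K : numFieldType} {V : lmodType K}.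
Implicit Types (a b c : int -> V -> V) (m n s : int) (N : nat) (u v w : V).
Local Notation dl := (@dl K V).

Definition modes_lin a := forall n, lin (a n).
Definition trunc a := forall v, exists M : int, forall n, M < n -> a n v = 0.

(** The identity (x - y)^N a(x) b(y) = eps (x - y)^N b(y) a(x) applied to v,
    split according to the total index s of the two modes; within a slice only m
    varies, so that x - y acts as x - 1. *)
Definition local (eps : K) N a b : Prop := forall s v,
  iter N dl (fun m => a m (b (s - m) v)) = iter N dl (fun m => eps *: b (s - m) (a m v)).

Lemma local_le eps N N' a b : (N <= N')%N -> local eps N a b -> local eps N' a b.
Proof. by move=> NN h s v; rewrite -(subnK NN) !iterD h. Qed.

Lemma prod_lowz a b s v : modes_lin a -> trunc b ->
  exists n, lowz (fun m => a m (b (s - m) v)) n.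
Proof.
by move=> al /(_ v)[M hM]; exists (s - M) => m h; rewrite hM ?lin0 //; lia.
Qed.

Lemma prod_highz a b s v : modes_lin b -> trunc a ->
  exists n, highz (fun m => b (s - m) (a m v)) n.
Proof. by move=> bl /(_ v)[M hM]; exists M => m h; rewrite hM ?lin0. Qed.

(** The two sides of the locality relation are bounded on opposite sides, so
    that (x - 1)^N a(x) b(1) v is a Laurent polynomial. *)
Lemma local_fsupp eps N a b s v : modes_lin a -> modes_lin b ->
  trunc a -> trunc b -> local eps N a b ->
  fsupp (iter N dl (fun m => a m (b (s - m) v))).
Proof.
move=> al bl ta tb ab.
have [n /(dlN_lowz (N := N)) h1] := prod_lowz s v al tb.
have [n' h2] := prod_highz s v bl ta.
apply: (bounded_fsupp h1 (n' := n')); rewrite ab; apply: dlN_highz => m hm.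
by rewrite h2 ?scaler0.
Qed.

Lemma dlN_refl N (h : int -> V) s : iter N dl (fun m => h (s - m)) =
  fun m => (-1) ^+ N *: iter N dl h (s - m - N%:Z).
Proof.
elim: N => [|N IH]; apply/funext => m; first by rewrite /= expr0 scale1r subr0.
rewrite iterS IH /dl -scalerBr -/dl iterS exprS mulN1r scaleNr -scalerN.
congr (_ *: _); rewrite /dl opprB.
have -> : s - (m + 1) - N%:Z = s - m - N.+1%:Z by lia.
by have -> : s - m - N.+1%:Z + 1 = s - m - N%:Z by lia.
Qed.

Lemma local_sym eps N a b : eps * eps = 1 -> modes_lin a -> modes_lin b ->
  local eps N a b -> local eps N b a.
Proof.
move=> ee al bl ab s v.
pose f m := b (s - m) (a m v); pose g m := eps *: a m (b (s - m) v).
have -> : (fun m => b m (a (s - m) v)) = fun m => f (s - m).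
  by apply/funext => m; rewrite /f subKr.
have -> : (fun m => eps *: a (s - m) (b m v)) = fun m => g (s - m).
  by apply/funext => m; rewrite /g subKr.
rewrite !dlN_refl; apply/funext => m; congr (_ *: _).
have -> : f = fun m => eps *: (eps *: b (s - m) (a m v)).
  by apply/funext => k; rewrite scalerA ee scale1r.
by rewrite /g !dlN_scale ab dlN_scale.
Qed.

Lemma local_lin eps N a b b' (x : K) : modes_lin a -> local eps N a b ->
  local eps N a b' -> local eps N a (fun n v => x *: b n v + b' n v).
Proof.
move=> al hb hb' s v.
have -> : (fun m => a m (x *: b (s - m) v + b' (s - m) v)) =
  fun m => x *: a m (b (s - m) v) + a m (b' (s - m) v).
  by apply/funext => m; rewrite al.
have -> : (fun m => eps *: (x *: b (s - m) (a m v) + b' (s - m) (a m v))) =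
  fun m => x *: (eps *: b (s - m) (a m v)) + eps *: b' (s - m) (a m v).
  by apply/funext => m; rewrite scalerDr !scalerA mulrC.
by rewrite !dlN_comb hb hb'.
Qed.

(** Goddard's argument: by locality (x - y)^N kills a(x) b(y) w, and on series
    bounded below the factor x - y can be cancelled. *)
Lemma local_kill eps N a b w : modes_lin a -> modes_lin b -> trunc b ->
  local eps N a b -> (forall n, a n w = 0) -> forall m n, a m (b n w) = 0.
Proof.
move=> al bl tb ab aw m n.
have [l hl] := prod_lowz (m + n) w al tb.
have := dlN_inj (N := N) hl _ m; have -> : m + n - m = n by lia.
apply=> k; rewrite ab.
have -> : (fun m0 => eps *: b (m + n - m0) (a m0 w)) = fun=> 0.
  by apply/funext => m0; rewrite aw lin0 // scaler0.
by rewrite dlN0.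
Qed.

(** The modes of the n-th product of two fields that are local of order N:
    a(x) b(1), as a rational function of x with poles at 0, 1 and infinity, is
    (x - 1) ^ (- N) times the Laurent polynomial with coefficients
    (x - 1) ^ N a(x) b(1), and the n-th product is its coefficient at
    (x - 1) ^ (- n - 1). Total degrees are kept apart by the slice
    s = n + r of total index. *)
Definition nprod N a b n : int -> V -> V := fun r v =>
  taylor (N%:Z - 1 - n) (iter N dl (fun m => a m (b (n + r - m) v))).

Lemma nprod_lin eps N a b n : modes_lin a -> modes_lin b -> trunc a -> trunc b ->
  local eps N a b -> modes_lin (nprod N a b n).
Proof.
move=> al bl ta tb ab r x u v; rewrite /nprod.
have hs w := local_fsupp (n + r) w al bl ta tb ab.
have -> : (fun m => a m (b (n + r - m) (x *: u + v))) =
    fun m => x *: a m (b (n + r - m) u) + a m (b (n + r - m) v).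
  by apply/funext => m; rewrite bl al.
by rewrite dlN_comb taylor_comb.
Qed.

Section TwoVariables.
Implicit Types (H : int -> int -> V).

(** Multiplication by y - 1, x - 1 and y - x on series in two variables, H k m
    being the coefficient of y ^ (- k - 1) x ^ (- m - 1). *)
Definition dk H k m := H (k + 1) m - H k m.
Definition dm H k m := H k (m + 1) - H k m.
Definition dkm H k m := H (k + 1) m - H k (m + 1).

Lemma dk_dm H : dk (dm H) = dm (dk H).
Proof.
apply/funext => k; apply/funext => m; rewrite /dk /dm !opprB addrACA [RHS]addrACA.
by congr (_ + _); rewrite addrC.
Qed.

Lemma dkm_dk H : dkm (dk H) = dk (dkm H).
Proof.
apply/funext => k; apply/funext => m; rewrite /dk /dkm !opprB addrACA [RHS]addrACA.
by congr (_ + _); rewrite addrC.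
Qed.

Lemma dkm_dm H : dkm (dm H) = dm (dkm H).
Proof.
apply/funext => k; apply/funext => m; rewrite /dm /dkm !opprB addrACA [RHS]addrACA.
by congr (_ + _); rewrite addrC.
Qed.

Lemma iter_comm (X : Type) (f g : X -> X) p q x : (forall x, f (g x) = g (f x)) ->
  iter p f (iter q g x) = iter q g (iter p f x).
Proof.
move=> fg; elim: q => //= q IH; rewrite -IH.
by elim: p {IH} => //= p ->; rewrite fg.
Qed.

Definition op_sub (f : (int -> int -> V) -> (int -> int -> V)) := forall H H',
  f (fun k m => H k m - H' k m) = fun k m => f H k m - f H' k m.

Lemma sub4 (x y z t : V) : x - y - (z - t) = x - z - (y - t).
Proof. by rewrite !opprB addrACA [RHS]addrACA; congr (_ + _); rewrite addrC. Qed.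

Lemma op_sub_dk : op_sub dk.
Proof. by move=> H H'; apply/funext => k; apply/funext => m; exact: sub4. Qed.
Lemma op_sub_dm : op_sub dm.
Proof. by move=> H H'; apply/funext => k; apply/funext => m; exact: sub4. Qed.
Lemma op_sub_dkm : op_sub dkm.
Proof. by move=> H H'; apply/funext => k; apply/funext => m; exact: sub4. Qed.

Lemma op_sub_iter f p : op_sub f -> op_sub (iter p f).
Proof. by move=> fs; elim: p => // p IH H H'; rewrite !iterS IH fs. Qed.

Lemma op_sub0 f : op_sub f -> f (fun _ _ => 0) = fun _ _ => 0.
Proof.
move=> fs; have := fs (fun _ _ => 0) (fun _ _ => 0); rewrite /= subrr => ->.
by apply/funext => k; apply/funext => m; rewrite subrr.
Qed.

Lemma iter_dm p H k : iter p dm H k = iter p dl (H k).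
Proof. by elim: p => //= p IH; rewrite -IH. Qed.

Lemma iter_dk p H k m : iter p dk H k m = iter p dl (fun k' => H k' m) k.
Proof. by elim: p k => //= p IH k; rewrite /dk !IH. Qed.

Lemma iter_dkm p H k m :
  iter p dkm H k m = iter p dl (fun k' => H k' (k + m + p%:Z - k')) k.
Proof.
elim: p k m => [|p IH] k m /=; first by congr (H _ _); lia.
rewrite /dkm !IH /dl.
have -> : k + 1 + m + p%:Z = k + m + p.+1%:Z by lia.
by have -> : k + (m + 1) + p%:Z = k + m + p.+1%:Z by lia.
Qed.

Definition rowfs H := forall k, fsupp (H k).
Definition taylor2 (j : int) H : int -> V := fun k => taylor j (H k).

Lemma rowfs_dk H : rowfs H -> rowfs (dk H).
Proof.
move=> h k; apply: (fsuppD (F' := fun m => - H k m)); first exact: h.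
by apply: (fsupp_map (f := fun=> -%R)); [rewrite oppr0 | exact: h].
Qed.

Lemma rowfs_dm H : rowfs H -> rowfs (dm H).
Proof. by move=> h k; exact: fsupp_dl. Qed.

Lemma dkmE H : dkm H = fun k m => dk H k m - dm H k m.
Proof. by apply/funext => k; apply/funext => m; rewrite /dk /dm /dkm opprB addrA subrK. Qed.

Lemma rowfs_dkm H : rowfs H -> rowfs (dkm H).
Proof.
move=> h; rewrite dkmE => k; apply: (fsuppD (F' := fun m => - dm H k m)).
  exact: rowfs_dk.
by apply: (fsupp_map (f := fun=> -%R)); [rewrite oppr0 | exact: rowfs_dm].
Qed.

Lemma taylor2_dk j H : rowfs H -> taylor2 j (dk H) = dl (taylor2 j H).
Proof. by move=> h; apply/funext => k; rewrite /taylor2 /dk taylor_sub. Qed.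

Lemma taylor2_dkm j H : rowfs H -> taylor2 j (dkm H) = fun k => dl (taylor2 j H) k - taylor2 (j - 1) H k.
Proof.
move=> h; rewrite dkmE; apply/funext => k; rewrite -taylor2_dk // /taylor2 taylor_sub.
- by rewrite taylor_dl.
- exact: rowfs_dk.
- exact: rowfs_dm.
Qed.

(** Torsion with respect to y - 1 whose order is allowed to grow by one with
    each Taylor coefficient at x = 1. *)
Definition tors (e : nat) H := forall j : nat, iter (e + j) dl (taylor2 j H) = fun=> 0.

(** As y - x = (y - 1) - (x - 1), the j-th Taylor coefficient of (y - x) H is y
    - 1 times that of H minus the (j-1)-st one of H; hence an induction on j. *)
Lemma tors_dkm e H : rowfs H -> tors e (dkm H) -> tors e.+1 H.
Proof.
move=> h t; elim=> [|j IH].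
  have := t 0%N; rewrite !addn0 taylor2_dkm // iterSr.
  have -> : taylor2 (0%:Z - 1) H = fun=> 0 by [].
  by have -> : (fun k => dl (taylor2 0 H) k - 0) = dl (taylor2 0 H)
    by apply/funext => k; rewrite subr0.
have := t j.+1; rewrite taylor2_dkm // dlN_sub.
have -> : Posz j.+1 - 1 = j by lia.
have -> : iter (e + j.+1) dl (taylor2 j H) = fun=> 0 by rewrite -addSnnS.
rewrite addSn -iterSr => Ht; apply/funext => k.
by have := congr1 (fun f => f k) Ht; rewrite subr0.
Qed.

Lemma rowfs_iter f p H : (forall H, rowfs H -> rowfs (f H)) -> rowfs H ->
  rowfs (iter p f H).
Proof. by move=> h hH; elim: p => //= p; exact: h. Qed.

Lemma tors_iter p e H : rowfs H -> tors e (iter p dkm H) -> tors (e + p) H.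
Proof.
elim: p e H => [|p IH] e H h; first by rewrite addn0.
rewrite iterSr => /IH/(tors_dkm h); rewrite addnS; apply; exact: rowfs_dkm.
Qed.

(** Each of the p factors y - x costs one power of y - 1, and passing to the
    j-th Taylor coefficient costs j more. *)
Lemma tors_of_dkm p q H j : rowfs H ->
  iter p dkm (iter q dk H) = (fun _ _ => 0) ->
  iter (p + j + q) dl (taylor2 j%:Z H) = fun=> 0.
Proof.
move=> h hpq.
have hq : rowfs (iter q dk H) by apply: rowfs_iter => //; exact: rowfs_dk.
have t0 : tors 0 (iter p dkm (iter q dk H)).
  move=> i; rewrite hpq; have -> : taylor2 i (fun _ _ => 0) = fun=> 0.
    by apply/funext => k; apply: taylor0.
  exact: dlN0.
have := tors_iter hq t0 j; rewrite add0n.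
have -> : taylor2 j%:Z (iter q dk H) = iter q dl (taylor2 j%:Z H).
  elim: q {hpq hq t0} => //= q IH; rewrite -IH taylor2_dk //.
  by apply: rowfs_iter => //; exact: rowfs_dk.
by rewrite -iterD.
Qed.

End TwoVariables.

(** Dong's lemma. After multiplication by (x - 1)^N, both c(y) a(x) b(1) and
    a(x) b(1) c(y) are Laurent polynomials in x, whose Taylor coefficients at x
    = 1 are the modes of the n-th product, composed with c(y) on either side.
    Their difference, with the sign, is killed by (y - x)^Na (y - 1)^Nb, because
    c can be moved past a and then past b. By [tors_of_dkm] a power of y - 1
    then kills each Taylor coefficient. *)
Lemma dong (ea eb : K) N Na Nb c a b n eab :
  modes_lin a -> modes_lin b -> modes_lin c -> trunc a -> trunc b -> trunc c ->
  local eab N a b -> local ea Na c a -> local eb Nb c b ->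
  exists M, local (ea * eb) M c (nprod N a b n).
Proof.
move=> al bl cl ta tb tc ab ca cb.
case: (ltP (N%:Z - 1 - n) 0) => hn.
  exists 0%N => s v; apply/funext => m /=; rewrite /nprod.
  case: (N%:Z - 1 - n) hn => // j _ /=.
  by rewrite lin0 // scaler0.
have [j hj] : exists j : nat, N%:Z - 1 - n = j%:Z by exists (absz (N%:Z - 1 - n)%R); lia.
exists (Na + j + Nb)%N => s0 v; pose s := s0 + n.
pose X k m := c k (a m (b (s - k - m) v)).
pose Y k m := (ea * eb) *: a m (b (s - k - m) (c k v)).
(* c has been moved past a, but not yet past b. *)
pose Z k m := ea *: a m (c k (b (s - k - m) v)).
pose H := iter N dm (fun k m => X k m - Y k m).
have fa k w := local_fsupp (s - k) w al bl ta tb ab.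
have HE k : H k = fun m => c k (iter N dl (fun m => a m (b (s - k - m) v)) m) -
    (ea * eb) *: iter N dl (fun m => a m (b (s - k - m) (c k v))) m.
  by rewrite /H iter_dm dlN_sub (dlN_lin _ _ (cl k)) dlN_scale.
have fc k : fsupp (fun m => c k (iter N dl (fun m => a m (b (s - k - m) v)) m)).
  by apply: (fsupp_map (f := fun=> c k)); [move=> _; rewrite lin0 | exact: fa].
have rH : rowfs H.
  move=> k; rewrite HE; apply: fsuppD; first exact: fc.
  apply: (fsupp_map (f := fun=> -%R)); first by rewrite oppr0.
  exact: (fsupp_gbin (fun=> ea * eb) (fa k (c k v))).
have TE : taylor2 j%:Z H = fun k => c k (nprod N a b n (s0 - k) v) -
    (ea * eb) *: nprod N a b n (s0 - k) (c k v).
  apply/funext => k; rewrite /taylor2 HE taylor_sub; first last.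
  - exact: (fsupp_gbin (fun=> ea * eb) (fa k (c k v))).
  - exact: fc.
  rewrite (taylor_lin _ (cl k)) ?(taylor_lin _ (lin_scale _)) //.
  by rewrite /nprod hj; have -> : n + (s0 - k) = s - k by rewrite /s; lia.
(* X - Z is killed by (y - x)^Na and Y - Z by (y - 1)^Nb. *)
have key : iter Na dkm (iter Nb dk H) = (fun _ _ => 0).
  rewrite /H.
  have -> : (fun k m => X k m - Y k m) =
      fun k m => (X k m - Z k m) - (Y k m - Z k m).
    by apply/funext => k; apply/funext => m; rewrite opprB addrA subrK.
  rewrite (op_sub_iter _ op_sub_dm) (op_sub_iter _ op_sub_dk) (op_sub_iter _ op_sub_dkm).
  rewrite (iter_comm _ _ _ dkm_dk) (iter_comm _ _ _ dkm_dm).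
  rewrite (iter_comm Nb N (fun k m => Y k m - Z k m) dk_dm).
  have -> : iter Na dkm (fun k m => X k m - Z k m) = fun _ _ => 0.
    apply/funext => k; apply/funext => m; rewrite iter_dkm dlN_sub.
    set t := k + m + Na%:Z; set w := b (s - t) v.
    have -> : (fun k' => X k' (t - k')) = fun k' => c k' (a (t - k') w).
      by apply/funext => k'; rewrite /X /w; have -> : s - k' - (t - k') = s - t by lia.
    have -> : (fun k' => Z k' (t - k')) = fun k' => ea *: a (t - k') (c k' w).
      by apply/funext => k'; rewrite /Z /w; have -> : s - k' - (t - k') = s - t by lia.
    by rewrite ca subrr.
  have -> : iter Nb dk (fun k m => Y k m - Z k m) = fun _ _ => 0.
    apply/funext => k; apply/funext => m; rewrite iter_dk dlN_sub.
    have -> : (fun k' => Y k' m) = fun k' => ea *: a m (eb *: b (s - m - k') (c k' v)).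
      apply/funext => k'; rewrite /Y linZ // scalerA.
      by have -> : s - k' - m = s - m - k' by lia.
    have -> : (fun k' => Z k' m) = fun k' => ea *: a m (c k' (b (s - m - k') v)).
      by apply/funext => k'; rewrite /Z; have -> : s - k' - m = s - m - k' by lia.
    have lf : lin (fun w => ea *: a m w) by apply: lin_comp (lin_scale ea) (al m).
    by rewrite !(dlN_lin _ _ lf) cb subrr.
  rewrite (op_sub0 (op_sub_iter _ op_sub_dm)) (op_sub0 (op_sub_iter _ op_sub_dk)).
  rewrite (op_sub0 (op_sub_iter _ op_sub_dkm)).
  by apply/funext => k; apply/funext => m; rewrite subrr.
have := tors_of_dkm j rH key; rewrite TE dlN_sub => h0.
apply/funext => k; apply/eqP; rewrite -subr_eq0; apply/eqP.
exact: (congr1 (fun f => f k) h0).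
Qed.

(** * Translation covariance and creation *)
Section Translation.
Context (L : V -> V) (L_lin : lin L).

Definition transl a := forall n v, L (a n v) - a n (L v) = - n%:~R *: a (n - 1) v.

(** Reduces linear identities between three vectors to their coordinates. *)
Lemma coords (p q r : V) : exists e : K -> K -> K -> V,
  [/\ forall x y z x' y' z',
        e x y z + e x' y' z' = e (x + x') (y + y') (z + z'),
      forall t x y z, t *: e x y z = e (t * x) (t * y) (t * z),
      forall x y z, - e x y z = e (- x) (- y) (- z) &
      [/\ p = e 1 0 0, q = e 0 1 0 & r = e 0 0 1]].
Proof.
exists (fun x y z => x *: p + y *: q + z *: r); split=> [x y z x' y' z'|t x y z|x y z|].
- by rewrite !scalerDl addrACA; congr (_ + _); rewrite addrACA.
- by rewrite !scalerDr !scalerA.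
- by rewrite !opprD -!scaleNr.
- by rewrite !scale1r !scale0r !addr0 !add0r.
Qed.

(** The operator (1 - x) d/dx - (s + 1). *)
Definition euler s (h : int -> V) m := - m%:~R *: h (m - 1) - (s - m)%:~R *: h m.

Lemma dl_euler s h : dl (euler s h) = euler (s - 1) (dl h).
Proof.
apply/funext => m; rewrite /dl /euler addrK subrK.
set p := h (m - 1); set q := h m; set r := h (m + 1).
have [e [eD eZ eN [-> -> ->]]] := coords p q r.
rewrite !(eD, eN, eZ); congr (e _ _ _); rewrite !(intrD, intrN); ring.
Qed.

Lemma dlN_euler N s h : iter N dl (euler s h) = euler (s - N%:Z) (iter N dl h).
Proof.
elim: N => [|N IH]; first by rewrite subr0.
by rewrite iterS IH dl_euler; congr (euler _ _); lia.
Qed.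

(** (1 - x) d/dx multiplies (x - 1)^j by - j. *)
Lemma taylor_euler (j s : int) F : fsupp F ->
  taylor j (euler s F) = - (s + j + 1)%:~R *: taylor j F.
Proof.
case: j => j hF; last by rewrite /taylor scaler0.
rewrite /taylor; pose g m : K := gbin (- m - 1)%:~R j.
have hF1 : fsupp (fun m => F (m - 1)) by exact: fsupp_shift.
have -> : zs (fun m => g m *: euler s F m) =
    zs (fun m => (g m * - m%:~R) *: F (m - 1)) + zs (fun m => - (g m * (s - m)%:~R) *: F m).
  rewrite -zsD; last exact: (fsupp_gbin _ hF).
    by apply: eq_zs => m; rewrite scalerBr !scalerA scaleNr.
  exact: (fsupp_gbin (fun m => g m * - m%:~R) hF1).
have -> : zs (fun m => (g m * - m%:~R) *: F (m - 1)) =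
    zs (fun m => (g (m + 1) * - (m + 1)%:~R) *: F m).
  rewrite -(zs_shift (fun m => (g m * - m%:~R) *: F (m - 1)) 1).
  by apply: eq_zs => m; rewrite addrK.
rewrite -zsD ?(fsupp_gbin _ hF) //; try exact: (fsupp_gbin _ hF).
rewrite -zsZ; last exact: (fsupp_gbin _ hF).
apply: eq_zs => m; rewrite -scalerDl scalerA; congr (_ *: _); rewrite /g.
pose y : K := (- m - 1)%:~R.
have -> : (- (m + 1) - 1)%:~R = y - 1 :> K by rewrite /y -(intrB _ _ 1); congr (_%:~R); lia.
have -> : - (m + 1)%:~R = y :> K by rewrite -intrN; congr (_%:~R); lia.
have e1 := gbin_absorb y j; have e2 := gbinS y j; rewrite e2 in e1.
rewrite mulrC e1.
have -> : (s - m)%:~R = s%:~R + y + 1 :> K by rewrite /y !(intrD, intrN); ring.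
by rewrite /y !(intrD, intrN) /=; ring.
Qed.

(** The commutator of L with the slice of total index s of a(x) b(1) is the
    operator [euler] applied to the slice of total index s - 1; it commutes with
    multiplication by (x - 1)^N up to a shift of s, and acts on Taylor
    coefficients by scalars. *)
Lemma nprod_transl eps N a b n : modes_lin a -> modes_lin b -> trunc a -> trunc b ->
  local eps N a b -> transl a -> transl b -> transl (nprod N a b n).
Proof.
move=> al bl ta tb ab at_ bt r v; rewrite /nprod.
set s := n + r; pose h s v m := a m (b (s - m) v).
have fs s' w : fsupp (iter N dl (h s' w)) := local_fsupp s' w al bl ta tb ab.
rewrite -/(h s v) -/(h s (L v)).
have -> : n + (r - 1) = s - 1 by rewrite /s; lia.
rewrite -/(h (s - 1) v) -(taylor_lin _ L_lin (fs s v)) -taylor_sub ?fs //; last first.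
  by apply: (fsupp_map (f := fun=> L)) => [_|]; [rewrite lin0 | exact: fs].
have -> : (fun m => L (iter N dl (h s v) m) - iter N dl (h s (L v)) m) =
    iter N dl (fun m => L (h s v m) - h s (L v) m).
  by rewrite dlN_sub (dlN_lin _ _ L_lin).
have -> : (fun m => L (h s v m) - h s (L v) m) = euler s (h (s - 1) v).
  apply/funext => m; rewrite /h /euler.
  have e1 := at_ m (b (s - m) v); have e2 := congr1 (a m) (bt (s - m) v).
  rewrite linB // linZ // in e2.
  have -> : s - 1 - (m - 1) = s - m by lia.
  have -> : s - 1 - m = s - m - 1 by lia.
  by rewrite -e1 -scaleNr -e2 addrA subrK.
rewrite dlN_euler taylor_euler; last exact: fs.
by congr (- _%:~R *: _); rewrite /s; lia.
Qed.

(** On the vacuum, (x - 1)^N a(x) b(1) only involves the indices m from n + r +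
    1 - N to -1. If r >= 0, the binomial coefficients entering the Taylor
    coefficient of order N - 1 - n vanish there; if r = -1, only the lowest
    index contributes. *)
Lemma nprod_creation eps N a b n (vac : V) : modes_lin a -> modes_lin b ->
  trunc a -> trunc b -> local eps N a b ->
  (forall m, 0 <= m -> a m vac = 0) -> (forall m, 0 <= m -> b m vac = 0) ->
  (forall r, 0 <= r -> nprod N a b n r vac = 0) /\
  nprod N a b n (-1) vac = a n (b (-1) vac).
Proof.
move=> al bl ta tb ab av bv.
have low s : lowz (fun m => a m (b (s - m) vac)) (s + 1).
  by move=> m hm; rewrite bv ?lin0 //; lia.
have high s : highz (iter N dl (fun m => a m (b (s - m) vac))) (-1).
  rewrite ab; apply: dlN_highz => m hm; rewrite av; last lia.
  by rewrite lin0 // scaler0.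
have gb (m : int) (j : nat) : m < 0 -> (- m - 1 < j%:Z) -> gbin (- m - 1)%:~R j = 0 :> K.
  move=> m0 mj; have -> : - m - 1 = (absz (- m - 1)%R)%:Z by lia.
  by rewrite -pmulrn; apply: gbin_small; lia.
split=> [r r0|].
  rewrite /nprod; case E : (N%:Z - 1 - n) => [j|j] //; apply: zs0 => m.
  case: (ltP m (n + r + 1 - N%:Z)) => h1.
    by rewrite (dlN_lowz (low _)) // scaler0.
  case: (ltP (-1) m) => h2; first by rewrite high // scaler0.
  by rewrite gb ?scale0r //; lia.
rewrite /nprod; set s := n - 1; have e : s + 1 = n by rewrite /s; lia.
have first := @dlN_first _ _ N _ _ (low s); rewrite e in first.
have -> : a n (b (-1) vac) = iter N dl (fun m => a m (b (s - m) vac)) (n - N%:Z).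
  by rewrite first; congr (a _ (b _ _)); rewrite /s; lia.
case E : (N%:Z - 1 - n) => [j|j].
  have zE m : m != n - N%:Z ->
      gbin (- m - 1)%:~R j *: iter N dl (fun m => a m (b (s - m) vac)) m = 0 :> V.
    move=> /eqP mn; case: (ltP m (n - N%:Z)) => h1.
      by rewrite (dlN_lowz (low _)) ?scaler0 // e.
    case: (ltP (-1) m) => h2; first by rewrite high // scaler0.
    by rewrite gb ?scale0r //; lia.
  rewrite /taylor (zs_single zE).
  have -> : - (n - N%:Z) - 1 = j by lia.
  by rewrite -pmulrn gbinn scale1r.
by rewrite high //; lia.
Qed.

End Translation.

(** * Derivatives and the identity field *)
Definition dfield a : int -> V -> V := fun n v => - n%:~R *: a (n - 1) v.

(** Multiplying the m-th coefficient by m is the operator - x d/dx - 1, and a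
    derivation costs one power of x - 1. *)
Lemma dlN_mulm N (f : int -> V) : iter N dl f = (fun=> 0) ->
  iter N.+1 dl (fun m => m%:~R *: f m) = fun=> 0.
Proof.
elim: N f => [|N IH] f hf.
  by rewrite /= in hf *; apply/funext => m; rewrite hf /dl !scaler0 subrr.
rewrite iterSr.
have -> : dl (fun m => m%:~R *: f m) = fun m => 1 *: (m%:~R *: dl f m) + f (m + 1).
  apply/funext => m; rewrite /dl scale1r intrD scalerDl scale1r scalerBr.
  by rewrite addrAC.
rewrite dlN_comb IH; last by rewrite -iterSr.
have -> : iter N.+1 dl (fun m => f (m + 1)) = fun m => iter N.+1 dl f (m + 1).
  by elim: N.+1 => //= k ->.
by rewrite hf; apply/funext => m; rewrite scaler0 addr0.
Qed.

Lemma local_dfield eps N c a : modes_lin c -> local eps N c a ->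
  local eps N.+1 c (dfield a).
Proof.
move=> cl ca s v.
pose f m := c m (a (s - 1 - m) v) - eps *: a (s - 1 - m) (c m v).
have f0 : iter N dl f = fun=> 0 by rewrite /f dlN_sub ca; apply/funext => m; rewrite subrr.
have := dlN_mulm f0; have f1 : iter N.+1 dl f = fun=> 0.
  by rewrite iterS f0; apply/funext => m; rewrite /dl subrr.
move=> f2.
have : iter N.+1 dl (fun m => c m (dfield a (s - m) v) -
    eps *: dfield a (s - m) (c m v)) = fun=> 0.
  have -> : (fun m => c m (dfield a (s - m) v) - eps *: dfield a (s - m) (c m v)) =
      fun m => (- s%:~R) *: f m + m%:~R *: f m.
    apply/funext => m; rewrite /dfield /f (linZ _ _ (cl m)) [in LHS]scalerA mulrC -scalerA -scalerBr.
    have -> : s - m - 1 = s - 1 - m by lia.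
    by rewrite -scalerDl; congr (_ *: _); rewrite intrD intrN; ring.
  by rewrite dlN_comb f1 f2; apply/funext => k; rewrite scaler0 addr0.
rewrite dlN_sub => h0; apply/funext => k; apply/eqP; rewrite -subr_eq0; apply/eqP.
exact: (congr1 (fun g => g k) h0).
Qed.

Definition idfield : int -> V -> V := fun n v => if n == -1 then v else 0.

Lemma local_id c : modes_lin c -> local 1 0 c idfield.
Proof.
move=> cl s v; apply/funext => m /=; rewrite /idfield scale1r.
by case: ifP => // _; rewrite lin0.
Qed.

End Locality.

(** * Graded spaces *)
Section GradedSpaces.
Context {R : realType} {V : lmodType (Cplx R)} (G : grading V).
Local Notation C := (Cplx R).
Local Notation pi := (graded_proj G).
Implicit Types (u v w : V) (n m d e : int).

Lemma pi_lin n : lin (pi n).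
Proof. by move=> a u v; rewrite linearP. Qed.

Lemma pi_fsupp v : fsupp (fun n => pi n v).
Proof.
have fin := graded_proj_finite G v.
exists (fset_set [set n | pi n v != 0]) => n; rewrite in_fset_set // => h.
by apply/eqP; apply: contraNT h => h; rewrite inE.
Qed.

Lemma pi_sum v : v = zs (fun n => pi n v).
Proof. exact: graded_proj_sum. Qed.

Lemma homog_pi n v : homog G n (pi n v).
Proof. by rewrite /homog /= graded_projK eqxx. Qed.

Lemma homog_piN n m v : homog G n v -> m != n -> pi m v = 0.
Proof. by move=> <- /negbTE mn; rewrite graded_projK mn. Qed.

Lemma homog0 n : homog G n 0.
Proof. exact: (lin0 (pi_lin n)). Qed.

Lemma homog_comb n (x : C) u v : homog G n u -> homog G n v -> homog G n (x *: u + v).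
Proof. by rewrite /homog /= pi_lin => -> ->. Qed.

Lemma homogD n u v : homog G n u -> homog G n v -> homog G n (u + v).
Proof. by move=> hu; rewrite -[u]scale1r; exact: homog_comb. Qed.

Lemma homogZ n (x : C) u : homog G n u -> homog G n (x *: u).
Proof. by move=> hu; rewrite -[_ *: _]addr0; apply: homog_comb => //; exact: homog0. Qed.

Lemma homog_eq n m v : homog G n v -> n = m -> homog G m v.
Proof. by move=> h <-. Qed.

Lemma homog_ind (P : V -> Prop) : (forall n v, homog G n v -> P v) ->
  (forall u v, P u -> P v -> P (u + v)) -> forall v, P v.
Proof.
move=> Ph PD v; rewrite (pi_sum v); have [A hA] := pi_fsupp v.
rewrite (zsE hA); elim: (A : seq int) => [|n r IH].
  by rewrite big_nil; apply: (Ph 0); exact: homog0.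
by rewrite big_cons; apply: PD => //; apply: Ph (homog_pi _ _).
Qed.

Lemma lin_eq (f g : V -> V) : lin f -> lin g ->
  (forall n v, homog G n v -> f v = g v) -> forall v, f v = g v.
Proof.
move=> fl gl h; apply: homog_ind => // u v; rewrite !linD //.
by move=> -> ->.
Qed.

(** Fields of conformal weight d / 2. *)
Definition field_deg d (A : int -> V -> V) : Prop :=
  forall n e v, homog G e v -> homog G (e + d - 2 * n - 2) (A n v).

Definition bounded_below := exists N : int, forall n v, n < N -> homog G n v -> v = 0.

Lemma deg_trunc d A : bounded_below -> modes_lin A -> field_deg d A -> trunc A.
Proof.
move=> [N hN] al ad; apply: homog_ind => [e v hv|u v [M hM] [M' hM']].
  exists (absz (e + d - N)%R)%:Z => n hn; apply: (hN _ _ _ (ad n e v hv)); lia.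
exists (Num.max M M') => n; rewrite gt_max => /andP[h h'].
by rewrite linD // hM ?hM' ?addr0.
Qed.

Lemma nprod_deg eps N a b n d d' : modes_lin a -> modes_lin b -> trunc a -> trunc b ->
  local eps N a b -> field_deg d a -> field_deg d' b ->
  field_deg (d + d' - 2 * n - 2) (nprod N a b n).
Proof.
move=> al bl ta tb ab ad bd r e v hv; rewrite /homog /= /nprod.
have hs := local_fsupp (n + r) v al bl ta tb ab.
rewrite -(taylor_lin _ (pi_lin _) hs) -(dlN_lin _ _ (pi_lin _)).
congr (taylor _ (iter _ _ _)); apply/funext => m.
by apply: homog_eq (ad _ _ _ (bd _ _ _ hv)) _; lia.
Qed.

(** The sign of the exchange of two states of weights d / 2 and e / 2. *)
Definition super_sign d e : C := (-1) ^+ (odd (absz d) && odd (absz e)).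

Lemma super_sign_sq d e : super_sign d e * super_sign d e = 1.
Proof. by rewrite /super_sign; case: (_ && _); rewrite ?expr1 ?expr0 ?mulrNN mulr1. Qed.

Lemma super_signC d e : super_sign d e = super_sign e d.
Proof. by rewrite /super_sign andbC. Qed.

Lemma super_signM c d e n : super_sign c d * super_sign c e = super_sign c (d + e - 2 * n - 2).
Proof.
rewrite /super_sign -exprD.
have -> : odd (absz (d + e - 2 * n - 2)%R) = odd (absz d) (+) odd (absz e) by lia.
by case: (odd (absz c)) (odd (absz d)) (odd (absz e)) => [] [] [] //=;
  rewrite ?expr0 ?expr1 // sqrrN expr1n.
Qed.

End GradedSpaces.

(** * The state-field correspondence *)
Section StateField.
Context {R : realType} {V : lmodType (Cplx R)} (G : grading V).
Local Notation C := (Cplx R).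
Context (bb : bounded_below G) (I : Type) (a : I -> int -> V -> V) (wt : I -> int).
Context (L : V -> V) (vac : V).
Hypothesis (L_lin : lin L) (L_vac : L vac = 0) (vac0 : homog G 0 vac).
Hypothesis a_lin : forall i, modes_lin (a i).
Hypothesis a_deg : forall i, field_deg G (wt i) (a i).
Hypothesis a_transl : forall i, transl L (a i).
Hypothesis a_creat : forall i m, 0 <= m -> a i m vac = 0.
Hypothesis a_local : forall i j, exists N, local (super_sign (wt i) (wt j) : C) N (a i) (a j).

Definition modes_prod (s : seq (I * int)) : V := foldr (fun p w => a p.1 p.2 w) vac s.
Hypothesis a_span : forall v, exists s : seq (C * seq (I * int)),
  v = \sum_(p <- s) p.1 *: modes_prod p.2.

Local Notation pi := (graded_proj G).

Lemma modes_prod_ind (f g : V -> V) : lin f -> lin g ->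
  (forall s, f (modes_prod s) = g (modes_prod s)) -> forall v, f v = g v.
Proof.
move=> fl gl h v; have [s ->] := a_span v.
by rewrite !lin_sum //; apply: eq_bigr => p _; rewrite !linZ // h.
Qed.

(** The candidates for the vertex operator of a state of weight d / 2. *)
Record vfield (d : int) (A : int -> V -> V) : Prop := {
  vf_lin : modes_lin A;
  vf_deg : field_deg G d A;
  vf_transl : transl L A;
  vf_creat : forall m, 0 <= m -> A m vac = 0;
  vf_local : forall i, exists N, local (super_sign (wt i) d : C) N (a i) A
}.

Lemma vf_trunc d A : vfield d A -> trunc A.
Proof. by move=> h; exact: deg_trunc bb (vf_lin h) (vf_deg h). Qed.

Lemma a_trunc i : trunc (a i).
Proof. exact: deg_trunc bb (a_lin i) (a_deg i). Qed.

Lemma vf_gen i : vfield (wt i) (a i).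
Proof. by split; [exact: a_lin | exact: a_deg | exact: a_transl | exact: a_creat | move=> j; exact: a_local]. Qed.

Lemma vf_comb d (x : C) A B : vfield d A -> vfield d B ->
  vfield d (fun n v => x *: A n v + B n v).
Proof.
move=> hA hB; split.
- move=> n y u v; rewrite (vf_lin hA) (vf_lin hB) !scalerDr !scalerA addrACA.
  by rewrite mulrC.
- move=> n e v hv; apply: homog_comb; [exact: vf_deg hA _ _ _ hv | exact: vf_deg hB _ _ _ hv].
- move=> n v; rewrite linD // linZ // opprD addrACA -scalerBr.
  by rewrite (vf_transl hA) (vf_transl hB) scalerDr !scalerA mulrC.
- by move=> m hm; rewrite (vf_creat hA) // (vf_creat hB) // scaler0 addr0.
- move=> i; have [N hN] := vf_local hA i; have [M hM] := vf_local hB i.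
  exists (maxn N M); apply: local_lin => //.
    exact: local_le (leq_maxl _ _) hN.
  exact: local_le (leq_maxr _ _) hM.
Qed.

Lemma vf0 d : vfield d (fun _ _ => 0).
Proof.
split.
- by move=> n x u v; rewrite scaler0 addr0.
- by move=> n e v _; exact: homog0.
- by move=> n v; rewrite lin0 // subrr scaler0.
- by [].
- move=> i; exists 0%N => s v; apply/funext => m /=.
  by rewrite scaler0 (lin0 (a_lin i m)).
Qed.

Lemma transl_kill A : modes_lin A -> transl L A ->
  (forall m, -1 <= m -> A m vac = 0) -> forall n, A n vac = 0.
Proof.
move=> al at_ h n.
have H (k : nat) : A (- 1 - k%:Z) vac = 0.
  elim: k => [|k IH]; first by apply: h; lia.
  have := at_ (- 1 - k%:Z) vac; rewrite L_vac (lin0 (al _)) IH lin0 // subrr.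
  have -> : - 1 - k%:Z - 1 = - 1 - k.+1%:Z by lia.
  move/esym/eqP; rewrite scaler_eq0 oppr_eq0 intr_eq0 => /orP[/eqP|/eqP//]; lia.
case: (ltP n (-1)) => [hn|/h //].
by have -> : n = - 1 - (absz (n + 1)%R)%:Z by lia.
Qed.

(** Goddard's uniqueness. Translation covariance extends the vanishing of A_m on
    the vacuum to all m; locality propagates it to the products of modes applied
    to the vacuum, which span. The sign eps is left free so that the lemma can
    serve before the parity of a field is known. *)
Lemma goddard A : modes_lin A -> transl L A ->
  (forall m, -1 <= m -> A m vac = 0) ->
  (forall i, exists eps N, local (eps : C) N A (a i)) -> forall n v, A n v = 0.
Proof.
move=> al at_ h loc n; apply: modes_prod_ind => //; first by move=> x u v; rewrite scaler0 addr0.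
move=> s; elim: s n => [|[i m] s IH] n /=; first exact: transl_kill.
have [eps [N hN]] := loc i.
exact: (local_kill al (a_lin i) (@a_trunc i) hN).
Qed.

Lemma vf_unique d A B : vfield d A -> vfield d B ->
  A (-1) vac = B (-1) vac -> A = B.
Proof.
move=> hA hB AB; have hD := vf_comb (-1) hB hA.
have D0 n v : -1 *: B n v + A n v = 0.
  move: n v; apply: goddard; [exact: vf_lin hD | exact: vf_transl hD | |].
    move=> m hm; case: (eqVneq m (-1)) => [->|m1].
      by rewrite AB scaleN1r addNr.
    by apply: (vf_creat hD); lia.
  move=> i; have [N hN] := vf_local hD i; exists (super_sign (wt i) d), N.
  exact: (local_sym (super_sign_sq _ _) (a_lin i) (vf_lin hD) hN).
apply/funext => n; apply/funext => v; apply/eqP; rewrite -subr_eq0 addrC.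
by rewrite -scaleN1r D0.
Qed.

(** Locality with respect to all candidate fields. To be local to two candidates
    is what Dong's lemma requires in order to be local to their product, so this
    is the property that is carried along products. *)
Definition full_local d A := forall d' B, vfield d' B ->
  exists N, local (super_sign d' d : C) N B A.

Lemma vf_id : vfield 0 (@idfield _ V).
Proof.
split.
- by move=> n x u v; rewrite /idfield; case: ifP => // _; rewrite scaler0 addr0.
- move=> n e v hv; rewrite /idfield; case: eqP => [->|_]; last exact: homog0.
  by apply: homog_eq hv _; lia.
- move=> n v; rewrite /idfield; case: (eqVneq n (-1)) => n1.
    by rewrite subrr ifN ?scaler0 //; lia.
  rewrite lin0 // subrr; case: (eqVneq n 0) => [->|n0]; first by rewrite oppr0 scale0r.
  by rewrite ifN ?scaler0 //; lia.
- by move=> m m0; rewrite /idfield ifN //; lia.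
- move=> i; exists 0%N; have -> : super_sign (wt i) 0 = 1 :> C by rewrite /super_sign andbF.
  exact: local_id.
Qed.

Lemma vf_nprod d e A B n N : vfield d A -> vfield e B -> local (super_sign d e : C) N A B ->
  full_local d A -> full_local e B ->
  [/\ vfield (d + e - 2 * n - 2) (nprod N A B n),
      full_local (d + e - 2 * n - 2) (nprod N A B n) &
      nprod N A B n (-1) vac = A n (B (-1) vac)].
Proof.
move=> hA hB loc fA fB.
have Al := vf_lin hA; have Bl := vf_lin hB.
have At := vf_trunc hA; have Bt := vf_trunc hB.
have [cr1 cr2] := nprod_creation n Al Bl At Bt loc (vf_creat hA) (vf_creat hB).
have fl : full_local (d + e - 2 * n - 2) (nprod N A B n).
  move=> c X hX; have [Na hNa] := fA _ _ hX; have [Nb hNb] := fB _ _ hX.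
  have [M hM] := dong n Al Bl (vf_lin hX) At Bt (vf_trunc hX) loc hNa hNb.
  by exists M; rewrite -super_signM.
split=> //; split.
- exact: nprod_lin loc.
- exact: nprod_deg loc (vf_deg hA) (vf_deg hB).
- exact: nprod_transl loc (vf_transl hA) (vf_transl hB).
- exact: cr1.
- by move=> i; apply: fl; exact: vf_gen.
Qed.

Lemma vf_gen_full i : full_local (wt i) (a i).
Proof.
move=> d B hB; have [N hN] := vf_local hB i; exists N; rewrite super_signC.
exact: (local_sym (super_sign_sq _ _) (a_lin i) (vf_lin hB) hN).
Qed.

Fixpoint word_weight (s : seq (I * int)) : int :=
  if s is p :: s' then wt p.1 + word_weight s' - 2 * p.2 - 2 else 0.

(** The vector phi_{n_1} ... phi_{n_k} 1 is created by the iterated n-th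
    products of the generating fields, starting from the identity field. *)
Lemma vf_mp s : exists A,
  [/\ vfield (word_weight s) A, full_local (word_weight s) A & A (-1) vac = modes_prod s].
Proof.
elim: s => [|[i n] s [A [hA fA cA]]] /=.
  exists (@idfield _ V); split=> //; first exact: vf_id.
  move=> d B hB; exists 0%N; have -> : super_sign d 0 = 1 :> C by rewrite /super_sign andbF.
  by apply: local_id; exact: vf_lin hB.
have [N hN] := fA _ _ (vf_gen i).
have [h1 h2 h3] := vf_nprod n (vf_gen i) hA hN (@vf_gen_full i) fA.
by exists (nprod N (a i) A n); rewrite h3 cA.
Qed.

Lemma homog_mp s : homog G (word_weight s) (modes_prod s).
Proof.
have [A [hA _ <-]] := vf_mp s.
by apply: homog_eq (vf_deg hA (-1) vac0) _; lia.
Qed.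

Lemma homog_span d u : homog G d u -> exists s : seq (C * seq (I * int)),
  u = \sum_(p <- s | word_weight p.2 == d) p.1 *: modes_prod p.2.
Proof.
move=> hu; have [s us] := a_span u; exists s.
rewrite -hu us lin_sum; last exact: pi_lin.
rewrite [RHS]big_mkcond; apply: eq_bigr => p _.
rewrite linZ; last exact: pi_lin.
case: eqP => [<-|/eqP ne]; first by rewrite (homog_mp p.2).
by rewrite (homog_piN (homog_mp p.2)) ?scaler0 // eq_sym.
Qed.

Lemma full_local_comb d (x : C) A B : vfield d A -> vfield d B ->
  full_local d A -> full_local d B -> full_local d (fun n v => x *: A n v + B n v).
Proof.
move=> hA hB fA fB c X hX; have [N hN] := fA _ _ hX; have [M hM] := fB _ _ hX.
exists (maxn N M); apply: local_lin; first exact: vf_lin hX.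
  exact: local_le (leq_maxl _ _) hN.
exact: local_le (leq_maxr _ _) hM.
Qed.

Lemma vf_exists d u : homog G d u ->
  exists A, [/\ vfield d A, full_local d A & A (-1) vac = u].
Proof.
move=> /homog_span[s ->]; elim: s => [|p s [A [hA fA cA]]].
  exists (fun _ _ => 0); rewrite big_nil; split=> //; first exact: vf0.
  move=> c X hX; exists 0%N => t v; apply/funext => m /=.
  by rewrite scaler0 (lin0 (vf_lin hX m)).
rewrite big_cons; case: eqP => [ps|_]; last by exists A.
have [B [hB fB cB]] := vf_mp p.2; rewrite ps in hB fB.
exists (fun n v => p.1 *: B n v + A n v); split.
- exact: vf_comb.
- exact: full_local_comb.
- by rewrite cA cB.
Qed.

Lemma L_deg d u : homog G d u -> homog G (d + 2) (L u).
Proof.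
have Lmp s : homog G (word_weight s + 2) (L (modes_prod s)).
  elim: s => [|[i n] s IH] /=; first by rewrite L_vac; exact: homog0.
  have := a_transl i n (modes_prod s) => /eqP; rewrite subr_eq => /eqP ->.
  apply: homogD; last by apply: homog_eq (a_deg i n IH) _; lia.
  by apply: homogZ; apply: homog_eq (a_deg i _ (homog_mp s)) _; lia.
move=> /homog_span[s ->]; elim: s => [|p s IH].
  by rewrite big_nil lin0 //; exact: homog0.
rewrite big_cons; case: eqP => [ps|//]; rewrite L_lin.
by apply: homog_comb => //; rewrite -ps.
Qed.

Lemma vf_dfield d A : vfield d A -> vfield (d + 2) (dfield A).
Proof.
move=> hA; have sgE c : super_sign c (d + 2) = super_sign c d :> C.
  rewrite /super_sign; have -> // : odd (absz (d + 2)%R) = odd (absz d) by lia.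
split.
- move=> n x u v; rewrite /dfield (vf_lin hA) scalerDr !scalerA; congr (_ *: _ + _).
  by rewrite mulrC.
- move=> n e v hv; apply: homogZ; apply: homog_eq (vf_deg hA _ hv) _; lia.
- by move=> n v; rewrite /dfield linZ // -scalerBr (vf_transl hA).
- move=> m m0; rewrite /dfield; case: (eqVneq m 0) => [->|m1]; first by rewrite oppr0 scale0r.
  by rewrite (vf_creat hA) ?scaler0 //; lia.
- move=> i; have [N hN] := vf_local hA i; exists N.+1; rewrite sgE.
  exact: local_dfield.
Qed.

(** A vertex superalgebra in terms of modes: locality and the formula for the
    field of a product stand for duality. *)
Record state_field_map (Y : V -> int -> V -> V) : Prop := {
  sf_lin_state : forall x u v n w, Y (x *: u + v) n w = x *: Y u n w + Y v n w;
  sf_lin : forall u, modes_lin (Y u);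
  sf_deg : forall d u, homog G d u -> field_deg G d (Y u);
  sf_vac : Y vac = @idfield _ V;
  sf_creat : forall u m, 0 <= m -> Y u m vac = 0;
  sf_create : forall u, Y u (-1) vac = u;
  sf_transl : forall u, transl L (Y u);
  sf_deriv : forall u, Y (L u) = dfield (Y u);
  sf_local : forall d e u v, homog G d u -> homog G e v ->
    exists N, local (super_sign d e : C) N (Y u) (Y v);
  sf_prod : forall d e u v n N, homog G d u -> homog G e v ->
    local (super_sign d e : C) N (Y u) (Y v) -> Y (Y u n v) = nprod N (Y u) (Y v) n
}.

(** A homogeneous vector is a combination of products of modes applied to the
    vacuum, hence is created by a candidate field, and by a single one.
    Uniqueness then yields all identities between fields: it is enough that both
    sides create the same vector. *)
Theorem state_field_exists : exists2 Y, state_field_map Y &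
  forall i, Y (a i (-1) vac) = a i.
Proof.
pose Yd d u := if pselect (homog G d u) is left h then sval (cid (vf_exists h))
               else fun _ _ => 0.
have YdP d u : homog G d u ->
    [/\ vfield d (Yd d u), full_local d (Yd d u) & Yd d u (-1) vac = u].
  by move=> hu; rewrite /Yd; case: pselect => // h; exact: (svalP (cid (vf_exists h))).
have Yd_unique d u A : vfield d A -> A (-1) vac = u -> Yd d u = A.
  move=> hA uA; have hu : homog G d u.
    by rewrite -uA; apply: homog_eq (vf_deg hA (-1) vac0) _; lia.
  by have [h _ c] := YdP _ _ hu; apply: vf_unique h hA _; rewrite c uA.
have Yd0 d : Yd d 0 = fun _ _ => 0 by apply: Yd_unique; [exact: vf0 |].
have Yd_comb d x u v : homog G d u -> homog G d v ->
    Yd d (x *: u + v) = fun n w => x *: Yd d u n w + Yd d v n w.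
  move=> hu hv; have [h1 _ c1] := YdP _ _ hu; have [h2 _ c2] := YdP _ _ hv.
  by apply: Yd_unique; [exact: vf_comb | rewrite c1 c2].
pose Y u : int -> V -> V := fun n w => zs (fun d => Yd d (pi d u) n w).
have fs u n w : fsupp (fun d => Yd d (pi d u) n w).
  have [A hA] := pi_fsupp G u; exists A => d /hA ->.
  by rewrite Yd0.
have YE d u : homog G d u -> Y u = Yd d u.
  move=> hu; apply/funext => n; apply/funext => w; rewrite /Y (zs_single (i0 := d)).
    by rewrite hu.
  by move=> e ed; rewrite (homog_piN hu) // Yd0.
have Ylin x u v n w : Y (x *: u + v) n w = x *: Y u n w + Y v n w.
  rewrite /Y -zsZ // -zsD //; last first.
    by apply: (fsupp_map (f := fun=> *:%R x)) => // _; rewrite scaler0.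
  by apply: eq_zs => d; rewrite pi_lin Yd_comb //; exact: homog_pi.
have YD u v n w : Y (u + v) n w = Y u n w + Y v n w.
  by rewrite -[u]scale1r Ylin !scale1r.
have Yh u (P : (int -> V -> V) -> Prop) : (forall d A, vfield d A -> P A) ->
    (forall A B, P A -> P B -> P (fun n v => A n v + B n v)) -> P (Y u).
  move=> h hD; elim/(homog_ind (G := G)): u => [d u hu|u v hu hv].
    by rewrite (YE _ _ hu); have [h1 _ _] := YdP _ _ hu; exact: h h1.
  have -> : Y (u + v) = fun n w => Y u n w + Y v n w.
    by apply/funext => n; apply/funext => w; rewrite YD.
  exact: hD.
exists Y; last first.
  move=> i; have hi : homog G (wt i) (a i (-1) vac).
    by apply: homog_eq (a_deg i (-1) vac0) _; lia.
  by rewrite (YE _ _ hi); apply: Yd_unique => //; exact: vf_gen.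
split=> //.
- move=> u; apply: Yh => [d A /vf_lin //|A B hA hB n x v w].
  by rewrite hA hB scalerDr addrACA.
- by move=> d u hu; rewrite (YE _ _ hu); have [h _ _] := YdP _ _ hu; exact: vf_deg h.
- rewrite (YE 0 _ vac0); apply: Yd_unique; first exact: vf_id.
  by rewrite /idfield eqxx.
- move=> u; apply: (Yh u (fun A => forall m, 0 <= m -> A m vac = 0)) => [d A /vf_creat //|].
  by move=> A B hA hB m m0; rewrite hA ?hB ?addr0.
- apply: (homog_ind (G := G)) => [d u hu|u v hu hv]; last by rewrite YD hu hv.
  by rewrite (YE _ _ hu); have [] := YdP _ _ hu.
- move=> u; apply: (Yh u (transl L)) => [d A /vf_transl //|A B hA hB n v].
  by rewrite linD // opprD addrACA hA hB scalerDr.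
- move=> u; apply/funext => n; apply/funext => w.
  elim/(homog_ind (G := G)): u => [d u hu|u v hu hv].
    rewrite (YE _ _ hu) (YE _ _ (L_deg hu)); have [h _ c] := YdP _ _ hu.
    rewrite (Yd_unique _ _ _ (vf_dfield h)) // /dfield.
    have := vf_transl h (-1) vac; rewrite c L_vac (lin0 (vf_lin h _)) subr0 => ->.
    by rewrite opprK.
  by rewrite linD // YD hu hv /dfield YD scalerDr.
- move=> d e u v hu hv; rewrite (YE _ _ hu) (YE _ _ hv).
  have [h1 _ _] := YdP _ _ hu; have [h2 f2 _] := YdP _ _ hv.
  exact: f2.
- move=> d e u v n N hu hv; rewrite (YE _ _ hu) (YE _ _ hv) => loc.
  have [h1 f1 c1] := YdP _ _ hu; have [h2 f2 c2] := YdP _ _ hv.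
  have [h3 _ c3] := vf_nprod n h1 h2 loc f1 f2; rewrite c2 in c3.
  have huv : homog G (d + e - 2 * n - 2) (Yd d u n v).
    by apply: homog_eq (vf_deg h1 n hv) _; lia.
  by rewrite (YE _ _ huv); apply: Yd_unique.
Qed.

End StateField.

(** * The graded dual separates points *)
Section Dual.
Context {R : realType} {V : lmodType (Cplx R)} (G : grading V).
Local Notation C := (Cplx R).
Local Notation pi := (graded_proj G).
Implicit Types (u v w : V) (n m d e : int).

Definition scalar_lin (f : V -> C) := forall (x : C) u v, f (x *: u + v) = x * f u + f v.

Lemma mk_dual (f : V -> C) : scalar_lin f ->
  (exists N : nat, forall n v, (N < `|n|)%N -> homog G n v -> f v = 0) ->
  exists v' : graded_dual G, forall v, v' v = f v.
Proof.
move=> fl ff; pose F := GRing.isLinear.Build C V C *%R f fl.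
pose f' : {scalar V} := HB.pack f F.
by exists (@GradedDual _ _ G f' ff).
Qed.

Lemma mk_dual1 (f : V -> C) n : scalar_lin f ->
  exists v' : graded_dual G, forall v, v' v = f (pi n v).
Proof.
move=> fl; apply: mk_dual => [x u v|]; first by rewrite pi_lin fl.
have f0 : f 0 = 0 by have := fl (-1) 0 0; rewrite scaler0 addr0 mulN1r addNr.
exists (absz n) => m v nm hv; rewrite (homog_piN hv) //.
by apply: contraTneq nm => ->; rewrite ltnn.
Qed.

Lemma dual_lin (v' : graded_dual G) : scalar_lin v'.
Proof. by move=> x u v; rewrite linearP. Qed.

Lemma dual0 (v' : graded_dual G) : v' 0 = 0. Proof. exact: linear0. Qed.
Lemma dualD (v' : graded_dual G) u v : v' (u + v) = v' u + v' v.
Proof. exact: linearD. Qed.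
Lemma dualZ (v' : graded_dual G) (x : C) u : v' (x *: u) = x * v' u.
Proof. exact: linearZ. Qed.

Lemma dual_comp (v' : graded_dual G) (f : V -> V) d : lin f ->
  (forall n v, homog G n v -> homog G (n + d) (f v)) ->
  exists w' : graded_dual G, forall v, w' v = v' (f v).
Proof.
move=> fl fd; apply: mk_dual => [x u v|]; first by rewrite fl dual_lin.
have [N hN] := gd_finite v'; exists (N + absz d)%N => n v hn hv.
by apply: hN (fd _ _ hv); lia.
Qed.

Lemma dual_pi (v' : graded_dual G) n :
  exists w' : graded_dual G, forall v, w' v = v' (pi n v).
Proof. exact: mk_dual1 (dual_lin v'). Qed.

Lemma dual_zs (I : choiceType) (v' : graded_dual G) (F : I -> V) : fsupp F ->
  v' (zs F) = zs (fun i => v' (F i)).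
Proof. by move=> h; apply: zs_map => //; [exact: dual0 | exact: dualD]. Qed.

Definition span (s : seq V) : set V :=
  [set v | exists c : nat -> C, v = \sum_(j < size s) c j *: s`_j].

Lemma span_comb s (x : C) u v : span s u -> span s v -> span s (x *: u + v).
Proof.
move=> [c ->] [d ->]; exists (fun j => x * c j + d j).
rewrite scaler_sumr -big_split; apply: eq_bigr => j _.
by rewrite scalerA scalerDl.
Qed.

Lemma span0 s : span s 0.
Proof. by exists (fun=> 0); rewrite big1 // => j _; rewrite scale0r. Qed.

Lemma spanZ s (x : C) u : span s u -> span s (x *: u).
Proof. by move=> h; rewrite -[_ *: _]addr0; exact: span_comb (span0 s). Qed.

Lemma spanB s u v : span s u -> span s v -> span s (u - v).
Proof. by move=> hu hv; rewrite addrC -scaleN1r; exact: span_comb. Qed.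

Lemma span_cons x s v : span (x :: s) v -> exists (c : C) w, span s w /\ v = c *: x + w.
Proof.
move=> [c ->]; exists (c 0%N), (\sum_(j < size s) c j.+1 *: s`_j).
split; first by exists (fun j => c j.+1).
by rewrite big_ord_recl.
Qed.

(** Split off one spanning vector at a time. If some u0 in U is not in the span
    of the others, the coordinate along u0 is a linear form on U; when it
    vanishes at v, the induction hypothesis is applied to the kernel of this
    form and composed with the projection along u0. *)
Lemma functional_exists (s : seq V) (U : set V) v :
  (forall (x : C) u w, U u -> U w -> U (x *: u + w)) -> U `<=` span s ->
  U v -> v != 0 -> exists f : V -> C,
    (forall (x : C) u w, U u -> U w -> f (x *: u + w) = x * f u + f w) /\ f v != 0.
Proof.
elim: s U v => [|x s IH] U v Ul Us Uv v0.
  by have [c] := Us v Uv; rewrite big_ord0 => e; rewrite e eqxx in v0.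
pose U' : set V := U `&` span s.
have U'l (y : C) u w : U' u -> U' w -> U' (y *: u + w).
  by move=> [hu1 hu2] [hw1 hw2]; split; [exact: Ul | exact: span_comb].
have [[u0 [Uu0 su0]]|no] := pselect (exists u0, U u0 /\ ~ span s u0); last first.
  apply: IH => // u Uu; apply: contrapT => h; apply: no; by exists u.
have dec u : U u -> exists t : C, span s (u - t *: u0).
  move=> Uu; have [c [w [sw e]]] := span_cons (Us _ Uu).
  have [c0 [w0 [sw0 e0]]] := span_cons (Us _ Uu0).
  have c00 : c0 != 0 by apply: contra_notN su0 => /eqP z; rewrite e0 z scale0r add0r.
  exists (c / c0); rewrite e e0 scalerDr scalerA divfK // opprD addrACA subrr add0r.
  by apply: spanB => //; exact: spanZ.
have uniq_t u t t' : span s (u - t *: u0) -> span s (u - t' *: u0) -> t = t'.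
  move=> h h'; apply/eqP; rewrite -subr_eq0; apply/eqP; apply: contrapT => /eqP ne.
  apply: su0; have := spanZ (t - t')^-1 (spanB h' h).
  have -> : u - t' *: u0 - (u - t *: u0) = (t - t') *: u0.
    by rewrite opprB addrC addrA subrK scalerBl.
  by rewrite scalerA mulVf // scale1r.
have /choice [t ht] : forall u, exists t : C, U u -> span s (u - t *: u0).
  by move=> u; have [/dec[t h]|h] := pselect (U u); [exists t | exists 0].
have tl (y : C) u w : U u -> U w -> t (y *: u + w) = y * t u + t w.
  move=> Uu Uw; apply: (uniq_t (y *: u + w)); first by apply: ht; exact: Ul.
  have -> : y *: u + w - (y * t u + t w) *: u0 = y *: (u - t u *: u0) + (w - t w *: u0).
    by rewrite scalerDl opprD addrACA scalerBr scalerA.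
  by apply: span_comb; exact: ht.
have [tv|tv] := eqVneq (t v) 0; last by exists t.
have U'v : U' v.
  split=> //; have := ht _ Uv; rewrite tv scale0r subr0; exact.
have Usub u : U u -> U' (u - t u *: u0).
  move=> Uu; split; last exact: ht.
  by rewrite addrC -scaleNr; exact: Ul.
have U's : U' `<=` span s by move=> ? [].
have [f [fl fv]] := IH U' v U'l U's U'v v0.
exists (fun u => f (u - t u *: u0)); split; last by rewrite tv scale0r subr0.
move=> y u w Uu Uw; rewrite tl //.
have -> : y *: u + w - (y * t u + t w) *: u0 = y *: (u - t u *: u0) + (w - t w *: u0).
  by rewrite scalerDl opprD addrACA scalerBr scalerA.
by rewrite fl //; exact: Usub.
Qed.

Context (hG : grading_restricted G).

Lemma restricted_bounded : bounded_below G.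
Proof. by have [[N hN] _] := hG; exists N => n v nN hv; exact: (hN n nN v hv). Qed.

Lemma dual_separates v : (forall v' : graded_dual G, v' v = 0) -> v = 0.
Proof.
move=> h; rewrite (pi_sum G v); apply: zs0 => n.
apply: contrapT => /eqP pn0.
have [s hs] := hG.2 n.
have hU (x : C) u w : homog G n u -> homog G n w -> homog G n (x *: u + w).
  exact: homog_comb.
have [f [fl fv]] := functional_exists hU (hs : homog G n `<=` span s) (homog_pi G n v) pn0.
pose g v := f (pi n v).
have gl : scalar_lin g by move=> x u w; rewrite /g pi_lin fl //; exact: homog_pi.
have [v' hv'] := mk_dual1 n gl.
case/eqP: fv; have := h v'; rewrite hv' /g.
by rewrite graded_projK eqxx.
Qed.

Lemma dual_eq u v : (forall v' : graded_dual G, v' u = v' v) -> u = v.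
Proof.
move=> h; apply/eqP; rewrite -subr_eq0; apply/eqP/dual_separates => v'.
by rewrite linearB h subrr.
Qed.

End Dual.

(** * Complex derivatives *)
Section Derivatives.
Context {R : realType}.
Local Notation C := (Cplx R).
Implicit Types (f g : C -> C) (z w d : C).

(** The complex derivative with errors in R. *)
Definition hasD f z d : Prop := forall e : R, 0 < e -> exists2 r : R, 0 < r &
  forall h : C, 0 < nm h < r -> nm (h^-1 * (f (h + z) - f z) - d) < e.

Lemma lim0P (q : C -> C) (l : C) : (q h @[h --> 0^'] --> l) <->
  forall e : R, 0 < e -> exists2 r : R, 0 < r &
  forall h : C, 0 < nm h < r -> nm (q h - l) < e.
Proof.
split=> [/cvgrPdist_lt Hq e e0|Hq].
  have e0' : (0 : C) < (e%:C)%C by rewrite ltcR.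
  have [r /= r0 hr] := Hq _ e0'.
  have rE : r = ((complex.Re r)%:C)%C by rewrite RRe_real // gtr0_real.
  exists (complex.Re r); first by rewrite -ltcR -rE.
  move=> h /andP[h0 hr']; rewrite nmB -ltcR -nmE; apply: hr => /=.
    by rewrite sub0r normrN nmE rE ltcR.
  by rewrite -nm_gt0.
apply/cvgrPdist_lt => e e0.
have e0' : 0 < complex.Re e by move: e0; rewrite ltcE => /andP[].
have eE : e = ((complex.Re e)%:C)%C by rewrite RRe_real // gtr0_real.
have [r r0 hr] := Hq _ e0'; exists (r%:C)%C; first by rewrite /= ltcR.
move=> h /= hh h0; rewrite distrC eE nmE ltcR; apply: hr.
by rewrite nm_gt0 h0 -ltcR -nmE -normrN -[- h]sub0r.
Qed.

Lemma hasDP f z d : hasD f z d -> holomorphic_at f z /\ derive1 f z = d.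
Proof.
move=> /lim0P h; split.
  rewrite /holomorphic_at /derivable; apply/cvg_ex; exists d.
  have -> : (fun h0 : C => h0^-1 *: ((f \o shift z) (h0 *: 1) - f z)) =
     fun h0 => h0^-1 * (f (h0 + z) - f z).
    by apply/funext => k /=; rewrite /GRing.scale /= mulr1.
  exact: h.
by rewrite /derive1; apply/cvg_lim.
Qed.

Lemma holo_hasD f z : holomorphic_at f z -> hasD f z (derive1 f z).
Proof.
move=> h; apply/lim0P; move: h; rewrite /holomorphic_at /derivable /derive1.
have -> : (fun h0 : C => h0^-1 *: ((f \o shift z) (h0 *: 1) - f z)) =
     fun h0 => h0^-1 *: (f (h0 + z) - f z).
  by apply/funext => k /=; rewrite /GRing.scale /= mulr1.
exact.
Qed.

Lemma hasD_near f g z d r : 0 < r -> (forall h, nm h < r -> f (h + z) = g (h + z)) ->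
  hasD f z d -> hasD g z d.
Proof.
move=> r0 fg hf e e0; have [s s0 hs] := hf _ e0.
exists (Num.min r s); first by rewrite lt_min r0.
move=> h /andP[h0]; rewrite lt_min => /andP[hr hs'].
rewrite -fg // -[z in g z]add0r -fg ?nm0 // add0r; apply: hs.
by rewrite h0.
Qed.

Lemma hasD_lim f z d : hasD f z d <-> (h^-1 * (f (h + z) - f z) @[h --> 0^'] --> d).
Proof. by split => /lim0P. Qed.

Lemma id_lim0 : (h : C) @[h --> 0^'] --> (0 : C).
Proof. by apply/lim0P => e e0; exists e => // h /andP[_]; rewrite subr0. Qed.

Let FC : Filter (0 : C)^' := dnbhs_filter (0 : C).

Lemma lim0D (q q' : C -> C) (l l' : C) : q h @[h --> 0^'] --> l ->
  q' h @[h --> 0^'] --> l' -> (q h + q' h) @[h --> 0^'] --> l + l'.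
Proof. by move=> h h'; exact: (@cvgD _ _ _ _ FC _ _ _ _ h h'). Qed.

Lemma lim0M (q q' : C -> C) (l l' : C) : q h @[h --> 0^'] --> l ->
  q' h @[h --> 0^'] --> l' -> (q h * q' h) @[h --> 0^'] --> l * l'.
Proof. by move=> h h'; exact: (@cvgM _ _ _ FC _ _ _ _ h h'). Qed.

Lemma lim0V (q : C -> C) (l : C) : l != 0 -> q h @[h --> 0^'] --> l ->
  (q h)^-1 @[h --> 0^'] --> l^-1.
Proof. by move=> l0 h; exact: (@cvgV _ _ _ FC _ _ l0 h). Qed.

Lemma lim0C (c : C) : (fun _ : C => c) h @[h --> 0^'] --> c.
Proof. by apply/lim0P => e e0; exists 1 => // h _; rewrite subrr nm0. Qed.

Lemma lim0B (q q' : C -> C) (l l' : C) : q h @[h --> 0^'] --> l ->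
  q' h @[h --> 0^'] --> l' -> (q h - q' h) @[h --> 0^'] --> l - l'.
Proof.
move=> h h'; apply: (@lim0D q (fun k => - q' k) _ _ h).
apply/lim0P => e e0; have [r r0 hr] := (lim0P q' l').1 h' e e0.
by exists r => // k /hr; rewrite -nmN opprB opprK addrC.
Qed.

Lemma lim0_eq (q q' : C -> C) (l : C) (r : R) : q h @[h --> 0^'] --> l ->
  0 < r -> (forall h, 0 < nm h < r -> q h = q' h) -> q' h @[h --> 0^'] --> l.
Proof.
move=> /lim0P hq r0 qq; apply/lim0P => e e0; have [s s0 hs] := hq _ e0.
exists (Num.min r s); first by rewrite lt_min r0.
move=> h /andP[h0]; rewrite lt_min => /andP[hr hs'].
by rewrite -qq ?h0 //; apply: hs; rewrite h0.
Qed.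

Lemma hasD_cont f z d : hasD f z d -> f (h + z) @[h --> 0^'] --> f z.
Proof.
move=> /hasD_lim hf; have H := lim0D (lim0M id_lim0 hf) (@lim0C (f z)).
rewrite mul0r add0r in H; apply: (lim0_eq H ltr01) => h /andP[].
by rewrite nm_gt0 => h0 _ /=; rewrite mulVKf // subrK.
Qed.

Lemma hasD_mulz f z d : hasD f z d -> hasD (fun w => w * f w) z (f z + z * d).
Proof.
move=> hf; apply/hasD_lim; have hc := hasD_cont hf; move/hasD_lim: hf => hf.
have H := lim0D hc (lim0M (@lim0C z) hf).
apply: (lim0_eq H ltr01) => h /andP[]; rewrite nm_gt0 => h0 _ /=.
by field.
Qed.

Lemma lt_near (z : C) : z != 0 -> forall h, nm h < nm z -> h + z != 0.
Proof.
move=> z0 h hz; apply: contraTneq hz => /eqP; rewrite addr_eq0 => /eqP ->.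
by rewrite nmN ltxx.
Qed.

Lemma addz_lim z : (h + z : C) @[h --> 0^'] --> z.
Proof. by apply/lim0P => e e0; exists e => // h /andP[_]; rewrite addrK. Qed.

Lemma hasD_divz f z d : z != 0 -> hasD f z d ->
  hasD (fun w => f w / w) z ((d - f z / z) / z).
Proof.
move=> z0 /hasD_lim hf; apply/hasD_lim.
have H := lim0M (lim0B hf (@lim0C (f z / z))) (lim0V z0 (@addz_lim z)).
have nz : 0 < nm z by rewrite nm_gt0.
apply: (lim0_eq H nz) => h /andP[]; rewrite nm_gt0 => h0 /(lt_near z0) hz /=.
by field; rewrite ?h0 ?z0 ?hz.
Qed.

Lemma hasD_cst (c z : C) : hasD (fun=> c) z 0.
Proof. by move=> e e0; exists 1 => // h _; rewrite subrr mulr0 subrr nm0. Qed.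

Lemma hasD_ext f g z d : f =1 g -> hasD f z d -> hasD g z d.
Proof. by move=> /funext ->. Qed.

Lemma hasD_expz (k : int) z : z != 0 -> hasD (fun w => w ^ k) z (k%:~R * z ^ (k - 1)).
Proof.
move=> z0; have zu : z \is a GRing.unit by rewrite unitfE.
have H (n : nat) : hasD (fun w => w ^ n%:Z) z (n%:~R * z ^ (n%:Z - 1)) /\
    hasD (fun w => w ^ (- n%:Z)) z ((- n%:Z)%:~R * z ^ (- n%:Z - 1)).
  elim: n => [|n [IH1 IH2]].
    by rewrite oppr0 mul0r; split; apply: hasD_ext (hasD_cst 1 z).
  split.
    have -> : n.+1%:~R * z ^ (n.+1%:Z - 1) = z ^ n%:Z + z * (n%:~R * z ^ (n%:Z - 1)).
      have -> : n.+1%:Z - 1 = n by lia.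
      have zE : z ^ n%:Z = z * z ^ (n%:Z - 1).
        by rewrite -[X in X * _]expr1z -expfzDr //; congr (_ ^ _); lia.
      have -> : n.+1%:~R = n%:~R + 1 :> C by rewrite -addn1 PoszD intrD.
      by rewrite zE; move: (z ^ (n%:Z - 1)) => u; ring.
    by apply: hasD_ext (hasD_mulz IH1) => w; rewrite -!exprnP exprS.
  have -> : (- n.+1%:Z)%:~R * z ^ (- n.+1%:Z - 1) =
      ((- n%:Z)%:~R * z ^ (- n%:Z - 1) - z ^ (- n%:Z) / z) / z.
    have -> : (- n.+1%:Z)%:~R = (- n%:Z)%:~R - 1 :> C.
      by rewrite -(intrB _ _ 1); congr (_%:~R); lia.
    have -> : - n.+1%:Z - 1 = - n%:Z - 1 - 1 by lia.
    rewrite !(expfzDr _ _ z0) exprN1; move: (z ^ _) => u.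
    by field.
  apply: hasD_ext (hasD_divz z0 IH2) => w.
  by rewrite -!exprnN exprS invfM mulrC.
case: k => n; first by case: (H n).
by rewrite NegzE; case: (H n.+1).
Qed.

Lemma hasDD f g z d d' : hasD f z d -> hasD g z d' -> hasD (fun w => f w + g w) z (d + d').
Proof.
move=> /hasD_lim hf /hasD_lim hg; apply/hasD_lim.
have -> : (fun h => h^-1 * (f (h + z) + g (h + z) - (f z + g z))) =
   fun h => h^-1 * (f (h + z) - f z) + h^-1 * (g (h + z) - g z).
  by apply/funext => h; ring.
exact: (lim0D hf hg).
Qed.

Lemma hasDZ (c : C) f z d : hasD f z d -> hasD (fun w => c * f w) z (c * d).
Proof.
move=> /hasD_lim hf; apply/hasD_lim.
have -> : (fun h => h^-1 * (c * f (h + z) - c * f z)) =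
   fun h => c * (h^-1 * (f (h + z) - f z)).
  by apply/funext => h; ring.
exact: (lim0M (@lim0C c) hf).
Qed.

Lemma hasD_mul f g z d d' : hasD f z d -> hasD g z d' ->
  hasD (fun w => f w * g w) z (d * g z + f z * d').
Proof.
move=> hf hg; have hc := hasD_cont hg; move: hf hg => /hasD_lim hf /hasD_lim hg.
apply/hasD_lim; have H := lim0D (lim0M hf hc) (lim0M (@lim0C (f z)) hg).
apply: (lim0_eq H ltr01) => h /andP[]; rewrite nm_gt0 => h0 _ /=.
by field.
Qed.

Lemma hasD_sq f z d : z != 0 -> hasD f (z ^+ 2) d -> hasD (fun w => f (w ^+ 2)) z (2 * z * d).
Proof.
move=> z0 hf.
have kE (h : C) : (h + z) ^+ 2 = h * (h + 2 * z) + z ^+ 2 by ring.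
have z20 : 2 * z != 0 by rewrite mulf_neq0 // pnatr_eq0.
have z2p : 0 < nm (2 * z) by rewrite nm_gt0.
have Hk : (h * (h + 2 * z) : C) @[h --> 0^'] --> (0 : C).
  by have := lim0M id_lim0 (@addz_lim (2 * z)); rewrite mul0r.
have H1 : ((h * (h + 2 * z))^-1 * (f (h * (h + 2 * z) + z ^+ 2) - f (z ^+ 2)))
    @[h --> 0^'] --> d.
  apply/lim0P => e e0; have [r r0 hr] := hf _ e0.
  have [s s0 hs] := (lim0P _ _).1 Hk _ r0.
  exists (Num.min s (nm (2 * z))); first by rewrite lt_min s0.
  move=> h /andP[h0]; rewrite lt_min => /andP[h1 h2]; apply: hr.
  have := hs h; rewrite h0 h1 subr0 => /(_ isT) ->; rewrite andbT nm_gt0 mulf_neq0 //.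
    by rewrite -nm_gt0.
  exact: lt_near.
apply/hasD_lim; have H := lim0M (@addz_lim (2 * z)) H1.
apply: (lim0_eq H z2p) => h /andP[]; rewrite nm_gt0 => h0 /(lt_near z20) hz /=.
by rewrite kE; field; rewrite h0.
Qed.

(** The mean value theorem is available for real functions of a real variable:
    hence the restriction to a line, and the real part of a multiple of f. *)
Lemma hasD_line f (w1 u : C) (d : C) (t : R) : hasD f (w1 + t%:C%C * u) d -> d = 0 ->
  forall c : C, is_derive t (1 : R) (fun s : R => complex.Re (c * f (w1 + s%:C%C * u))) 0.
Proof.
move=> hf d0 c.
pose r (s : R) := complex.Re (c * f (w1 + s%:C%C * u)).
have H : (s^-1 *: (r (s + t) - r t)) @[s --> 0^'] --> (0 : R).
  apply/cvgrPdist_lt => e e0.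
  have [u0|u0] := eqVneq u 0.
    near=> s; rewrite /r u0 !mulr0 subrr scaler0 subr0 normr0 //.
  have k0 : 0 < nm c * nm u + 1.
    by apply: ltr_wpDl => //; rewrite mulr_ge0 ?nm_ge0.
  have [s0 s00 hs] := hf _ (divr_gt0 e0 k0).
  have nu : 0 < nm u by rewrite nm_gt0.
  exists (s0 / nm u) => /=; first exact: divr_gt0.
  move=> s /=; rewrite sub0r normrN => hsu sn0.
  have sC0 : s%:C%C != 0 :> C by rewrite -(inj_eq (@complexI R)) in sn0 *.
  have nsE : nm (s%:C%C : C) = `|s|.
    have [h|h] := leP 0 s; first by rewrite nm_real // ger0_norm.
    by rewrite -nmN -rmorphN nm_real ?ltr0_norm // oppr_ge0 ltW.
  pose h := s%:C%C * u : C.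
  have hh : 0 < nm h < s0.
    rewrite nm_gt0 mulf_neq0 //= /h nmM nsE.
    by rewrite -ltr_pdivlMr.
  have := hs _ hh; rewrite d0 subr0 => h2.
  rewrite sub0r normrN.
  have -> : s^-1 *: (r (s + t) - r t) =
      complex.Re (c * u * (h^-1 * (f (h + (w1 + t%:C%C * u)) - f (w1 + t%:C%C * u)))).
    rewrite /r -raddfB /= /h.
    have -> : w1 + (s + t)%:C%C * u = s%:C%C * u + (w1 + t%:C%C * u) :> C.
      by rewrite rmorphD /=; ring.
    set A := f _; set B := f _.
    have -> : c * u * ((s%:C%C * u)^-1 * (A - B)) = (s^-1)%:C%C * (c * A - c * B).
      rewrite fmorphV /=; move: sC0; move: (real_complex R s) => sc sc0.
      by field; rewrite ?sc0 ?u0.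
    move: (c * A - c * B) => [x y] /=.
    by rewrite mul0r subr0.
  apply: le_lt_trans (absRe _) _; rewrite !nmM in h2 *.
  apply: (@le_lt_trans _ _ (nm c * nm u * (e / (nm c * nm u + 1)))).
    by rewrite ler_wpM2l ?mulr_ge0 ?nm_ge0 // ltW.
  rewrite mulrA ltr_pdivrMr // mulrC mulrDr mulr1 ltrDl //.
have E : (fun h : R => h^-1 *: ((r \o shift t) (h *: (1 : R)) - r t)) =
    fun s => s^-1 *: (r (s + t) - r t).
  by apply/funext => s /=; rewrite /GRing.scale /= mulr1.
apply: DeriveDef.
  by rewrite /derivable E; apply/cvg_ex; exists 0.
by rewrite /derive E; apply/cvg_lim.
Unshelve. all: by end_near. Qed.

(** If the segment from z1 to z2 avoids 0, then Re f and Re (- i f) are constant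
    on it. Points on a line through 0 are joined through i z1. *)
Lemma hasD0_cst f : (forall z, z != 0 -> hasD f z 0) ->
  forall z1 z2, z1 != 0 -> z2 != 0 -> f z1 = f z2.
Proof.
move=> hf.
have line z1 z2 : z1 != 0 -> complex.Im (z2 / z1) != 0 -> f z1 = f z2.
  move=> z10 im; pose u := z2 - z1.
  have nz (t : R) : z1 + t%:C%C * u != 0.
    apply: contraNneq im => e.
    have e1 : 1 + t%:C%C * (z2 / z1 - 1) = 0 :> C.
      by apply: (mulfI z10); rewrite mulr0 -[RHS]e /u; field.
    have := congr1 (@complex.Im R) e1; have := congr1 (@complex.Re R) e1.
    move: (z2 / z1) => [x y] /=.
    rewrite !mul0r !subr0 !addr0 add0r => e2 /eqP.
    rewrite mulf_eq0 => /orP[/eqP t0|//].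
    by move: e2; rewrite t0 mul0r addr0 => /eqP; rewrite oner_eq0.
  have key (c : C) : complex.Re (c * f z1) = complex.Re (c * f z2).
    have := @is_derive_0_is_cst R (fun s : R => complex.Re (c * f (z1 + s%:C%C * u))) 0 1.
    have uE : z1 + u = z2 by rewrite /u addrC subrK.
    rewrite /= rmorph0 rmorph1 mul0r addr0 mul1r uE; apply=> t.
    exact: (hasD_line (hf _ (nz t)) erefl c).
  have k1 := key 1; have k2 := key (- 'i%C).
  move: k1 k2; rewrite !mul1r; case: (f z1) (f z2) => [x y] [x' y'] /=.
  rewrite !oppr0 !mul0r !sub0r !mulN1r !opprK => -> ->.
  by [].
move=> z1 z2 z10 z20.
have [im0|im] := eqVneq (complex.Im (z2 / z1)) 0; last exact: line.
have i0 : 'i%C != 0 :> C by rewrite eq_complex /= oner_eq0 andbF.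
have iz0 : 'i%C * z1 != 0 by rewrite mulf_neq0.
rewrite (line z1 ('i%C * z1)) //.
  apply: line => //; have -> : z2 / ('i%C * z1) = - 'i%C * (z2 / z1).
    have ii : 'i%C^-1 = - 'i%C :> C.
      by apply: (mulfI i0); rewrite mulfV // mulrN -expr2 sqr_i opprK.
    by rewrite invfM ii mulrCA.
  have : z2 / z1 != 0 by rewrite mulf_neq0 // invr_eq0.
  move: im0; case: (z2 / z1) => [x y] /= ->; rewrite eq_complex /= eqxx andbT.
  by rewrite mulr0 add0r mulN1r oppr_eq0.
by rewrite mulfK //= oner_eq0.
Qed.

(** Under the substitution z = w ^ 2, the function f (w ^ 2) w ^ (- n) has zero
    derivative, so that f (w ^ 2) = f 1 * w ^ n. Comparing w and - w shows that
    f = 0 when n is odd. *)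
Lemma euler_ode f (n : int) :
  (forall z, z != 0 -> hasD f z (n%:~R / 2 * f z / z)) ->
  (exists p, n = 2 * p /\ forall z, z != 0 -> f z = f 1 * z ^ p) \/
  forall z, z != 0 -> f z = 0.
Proof.
move=> hf; pose g w := f (w ^+ 2) * w ^ (- n).
have hg w : w != 0 -> hasD g w 0.
  move=> w0; have w20 : w ^+ 2 != 0 by rewrite expf_neq0.
  have := hasD_mul (hasD_sq w0 (hf _ w20)) (hasD_expz (- n) w0).
  congr (hasD _ _ _).
  rewrite (expfzDr _ _ w0) exprN1 mulrNz.
  by move: (w ^ _) (f _) (n%:~R) => x y m; field.
have gc := hasD0_cst hg.
have n1 : (1 : C) != 0 by exact: oner_neq0.
have fE w : w != 0 -> f (w ^+ 2) = f 1 * w ^ n.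
  move=> w0; have := gc w 1 w0 n1; rewrite /g expr1n exp1rz mulr1 => <-.
  by rewrite -mulrA -expfzDr // addNr expr0z mulr1.
have sq z : exists w : C, w ^+ 2 = z by exists (sqrtC z); rewrite sqrtCK.
have [[p np]|odd_n] := pselect (exists p, n = 2 * p).
  left; exists p; split=> // z z0; have [w wz] := sq z.
  have w0 : w != 0 by apply: contraNneq z0 => w0; rewrite -wz w0 expr0n.
  by rewrite -wz fE // np -exprz_exp.
right=> z z0; have [w wz] := sq z.
have w0 : w != 0 by apply: contraNneq z0 => w0; rewrite -wz w0 expr0n.
have e1 := fE w w0; have e2 : f (w ^+ 2) = f 1 * (- w) ^ n.
  by rewrite -fE ?oppr_eq0 // sqrrN.
have nE : n = 2 * (n %/ 2)%Z + 1.
  move: (divz_eq n 2) (modz_ge0 n (isT : 2 != 0 :> int)).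
  move: (ltz_pmod n (isT : 0 < 2 :> int)) odd_n.
  move: (n %/ 2)%Z (n %% 2)%Z => x y h1 h2 h3 h4.
  have : y != 0 by apply: contra_not_neq h2 => y0; exists x; lia.
  by lia.
have e3 : (- w) ^ n = - w ^ n.
  have wn0 : - w != 0 by rewrite oppr_eq0.
  rewrite nE !expfzDr // !expr1z -!exprz_exp.
  have -> : (- w) ^ (2 : int) = w ^ (2 : int) by rewrite -!exprnP sqrrN.
  by rewrite mulrN.
move: e1; rewrite wz in e2 *; rewrite e2 e3 mulrN => /eqP.
rewrite eq_sym -addr_eq0 -mulr2n mulrn_eq0 /= => /eqP ->.
by rewrite oppr0.
Qed.

End Derivatives.

(** * Fields and their modes *)
Section FieldsAndModes.
Context {R : realType} {V : lmodType (Cplx R)} (G : grading V).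
Local Notation C := (Cplx R).
Local Notation pi := (graded_proj G).
Implicit Types (u v w : V) (n m d e k : int) (A : int -> V -> V) (z : C).

Lemma int_window (N : nat) : exists A : {fset int}, forall n, (n \in A) = (`|n| <= N)%N.
Proof.
have [s hs] : exists s : seq int, forall n, (n \in s) = (`|n| <= N)%N.
  exists [seq (i%:Z - N%:Z)%R | i <- iota 0 (N + N).+1] => n.
  apply/mapP/idP => [[j jN ->]|nN]; first by move: jN; rewrite mem_iota; lia.
  by exists (absz (n + N%:Z)%R); [rewrite mem_iota; lia | lia].
by exists [fset x in s]%fset => n; rewrite inE hs.
Qed.

Lemma dual_support (v' : graded_dual G) : exists A : {fset int},
  (forall n v, n \notin A -> v' (pi n v) = 0) /\
  forall v, v' v = \sum_(n <- A) v' (pi n v).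
Proof.
have [N hN] := gd_finite v'; have [A hA] := int_window N; exists A.
have h n v : n \notin A -> v' (pi n v) = 0.
  by rewrite hA -ltnNge => h; apply: hN h _; exact: homog_pi.
split=> // v; rewrite {1}(pi_sum G v) dual_zs; last exact: pi_fsupp.
by rewrite (zsE (A := A)) // => n; exact: h.
Qed.

(** The sum of A_m v z ^ (- m - 1) over m, component by component. *)
Definition fld A z v : int -> V := fun n => zs (fun m => z ^ (- m - 1) *: pi n (A m v)).

(** Each component of the field applied to a vector is a finite sum. Unlike
    homogeneity, this is stable under sums of fields of different weights. *)
Definition gfield A := modes_lin A /\ forall v n, fsupp (fun m => pi n (A m v)).

Lemma gfieldD A B : gfield A -> gfield B -> gfield (fun n v => A n v + B n v).
Proof.
move=> [al af] [bl bf]; split=> [n x u v|v n].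
  by rewrite al bl scalerDr addrACA.
by apply: eq_fsupp (fsuppD (af v n) (bf v n)) => m; rewrite (linD _ _ (pi_lin G n)).
Qed.

Lemma gfield_deg d A : modes_lin A -> field_deg G d A -> gfield A.
Proof.
move=> al ad; split=> // v n; elim/(homog_ind (G := G)): v => [e v hv|u v hu hv].
  have hm m : n != e + d - 2 * m - 2 -> pi n (A m v) = 0.
    by move=> h; exact: homog_piN (ad _ _ _ hv) h.
  have [[m0 hm0]|no] := pselect (exists m0, n = e + d - 2 * m0 - 2).
    by apply: (@fsupp_single _ _ m0) => m mm; apply: hm; apply: contra_neq mm; lia.
  by exists fset0 => m _; apply: hm; apply: contra_notN no => /eqP h; exists m.
apply: eq_fsupp (fsuppD hu hv) => m.
by rewrite (linD _ _ (al m)) (linD _ _ (pi_lin G n)).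
Qed.

Lemma gf_fsupp A (v' : graded_dual G) v : gfield A -> fsupp (fun m => v' (A m v)).
Proof.
move=> [_ af]; have [S [_ hS]] := dual_support v'.
have h0 n : fsupp (fun m => v' (pi n (A m v))).
  by apply: (fsupp_map (f := fun=> v') _ (af v n)) => _; exact: dual0.
have [_ h] := @zs_exch int C int S _ h0.
by apply: eq_fsupp h => m; rewrite [RHS]hS.
Qed.

Lemma pairing_fld A (v' : graded_dual G) z v : gfield A ->
  pairing v' (fld A z v) = zs (fun m => v' (A m v) * z ^ (- m - 1)).
Proof.
move=> gA; have [_ af] := gA; have [S [hS0 hS]] := dual_support v'.
have fz n : fsupp (fun m => z ^ (- m - 1) *: pi n (A m v)).
  by apply: (fsupp_map (f := fun m v => z ^ (- m - 1) *: v) _ (af v n)) => m; rewrite scaler0.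
rewrite /pairing -/(zs _) (zsE (A := S)); last first.
  move=> n nS; rewrite dual_zs; last exact: fz.
  by apply: zs0 => m; rewrite dualZ hS0 // mulr0.
have h n : fsupp (fun m => v' (pi n (A m v)) * z ^ (- m - 1)).
  by apply: (fsupp_map (f := fun m w => v' w * z ^ (- m - 1)) _ (af v n)) => m;
    rewrite dual0 mul0r.
have [e _] := @zs_exch int C int S _ h.
transitivity (\sum_(n <- S) zs (fun m => v' (pi n (A m v)) * z ^ (- m - 1))).
  apply: eq_bigr => n _; rewrite dual_zs; last exact: fz.
  by apply: eq_zs => m; rewrite dualZ mulrC.
by rewrite -e; apply: eq_zs => m; rewrite -mulr_suml -hS.
Qed.

Lemma fld_hom A z : gfield A -> is_hom G (fld A z).
Proof.
move=> [al af].
have fz v n : fsupp (fun m => z ^ (- m - 1) *: pi n (A m v)).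
  by apply: (fsupp_map (f := fun m v => z ^ (- m - 1) *: v) _ (af v n)) => m; rewrite scaler0.
split=> [v n|x u v n].
  rewrite /homog /= /fld (lin_zs (pi_lin G n)) //; apply: eq_zs => m.
  by rewrite (linZ _ _ (pi_lin G n)) graded_projK eqxx.
rewrite /fld -zsZ // -zsD //; last first.
  by apply: (fsupp_map (f := fun _ v => x *: v) _ (fz u n)) => _; rewrite scaler0.
by apply: eq_zs => m; rewrite al pi_lin scalerDr !scalerA mulrC.
Qed.

Lemma fld_dfield A : gfield A -> gfield (dfield A).
Proof.
move=> [al af]; split=> [n x u v|v n].
  by rewrite /dfield al scalerDr !scalerA mulrC.
apply: (eq_fsupp (F := fun m => - m%:~R *: pi n (A (m - 1) v))).
  by move=> m; rewrite /dfield (linZ _ _ (pi_lin G n)).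
apply: (fsupp_gbin (fun m => - m%:~R) (F := fun m => pi n (A (m - 1) v))).
exact: fsupp_shift (-1) (af v n).
Qed.

Lemma laurent_hasD (c : int -> C) (f : C -> C) : fsupp c ->
  (forall z, z != 0 -> f z = zs (fun m => c m * z ^ (- m - 1))) ->
  forall z, z != 0 -> hasD f z (zs (fun m => (- m%:~R * c (m - 1)) * z ^ (- m - 1))).
Proof.
move=> fc hf z z0.
have -> : zs (fun m => (- m%:~R * c (m - 1)) * z ^ (- m - 1)) =
    zs (fun m => c m * ((- m - 1)%:~R * z ^ (- m - 1 - 1))).
  rewrite -(zs_bij (f := fun m => m + 1) (g := fun m => m - 1)) => [|m|m];
    rewrite ?addrK ?subrK //.
  apply: eq_zs => m; rewrite addrK mulrA; congr (_ * _ ^ _); last by lia.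
  by rewrite mulrC -intrN; congr (_ * _%:~R); lia.
have [S hS] := fc.
have cS (g : int -> C) i : i \notin S -> c i * g i = 0 by move=> /hS ->; rewrite mul0r.
rewrite (zsE (cS _)).
have nz : 0 < nm z by rewrite nm_gt0.
refine (@hasD_near R (fun w : C => \sum_(m <- S) c m * w ^ (- m - 1)) f z _ _ nz _ _).
  by move=> h /(lt_near z0) hz; rewrite hf // (zsE (cS _)).
elim: (S : seq int) => [|m r IH].
  by rewrite big_nil; apply: hasD_ext (hasD_cst 0 z) => w; rewrite big_nil.
rewrite big_cons.
apply: hasD_ext (hasDD (hasDZ (c m) (hasD_expz (- m - 1) z0)) IH) => w.
by rewrite big_cons.
Qed.

Lemma fld_hasD A (v' : graded_dual G) v z : gfield A -> z != 0 ->
  hasD (matrix_coef v' (fld A) v) z (pairing v' (fld (dfield A) z v)).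
Proof.
move=> gA z0; rewrite pairing_fld; last exact: fld_dfield.
have := laurent_hasD (gf_fsupp v' v gA) _ z0.
have -> : (fun m => v' (dfield A m v) * z ^ (- m - 1)) =
    fun m => (- m%:~R * v' (A (m - 1) v)) * z ^ (- m - 1).
  by apply/funext => m; rewrite /dfield dualZ.
by apply=> w w0; rewrite /matrix_coef pairing_fld.
Qed.

Lemma fld_analytic A : gfield A -> analytic_field G (fld A).
Proof.
move=> gA; split=> [z _|v' v z z0]; first exact: fld_hom.
by have [] := hasDP (fld_hasD v' v gA z0).
Qed.

Lemma pairing_pi (v' w' : graded_dual G) n (x : int -> V) : in_completion G x ->
  (forall v, w' v = v' (pi n v)) -> pairing w' x = v' (x n).
Proof.
move=> hx hw; rewrite /pairing -/(zs _) (zs_single (i0 := n)) => [|m mn].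
  by rewrite hw hx.
by rewrite hw (homog_piN (hx m)) ?dual0 // eq_sym.
Qed.

Context (hG : grading_restricted G).

Lemma pairing_ext (x y : int -> V) : in_completion G x -> in_completion G y ->
  (forall v' : graded_dual G, pairing v' x = pairing v' y) -> x = y.
Proof.
move=> hx hy h; apply/funext => n; apply: (dual_eq hG) => v'.
have [w' hw] := dual_pi v' n.
by rewrite -(pairing_pi hx hw) -(pairing_pi hy hw).
Qed.

Lemma laurent_fin (c : int -> C) (f : C -> C) : fsupp c ->
  (forall z, z != 0 -> f z = zs (fun m => c m * z ^ (- m - 1))) ->
  laurent_exp f (fun p => c (- p - 1)).
Proof.
move=> fc hf; exists 1 => // z /andP[z0 _]; rewrite nm_gt0 in z0.
have refl m : - (- m - 1) - 1 = m :> int by lia.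
have -> : f z = zs (fun p => c (- p - 1) * z ^ p).
  rewrite hf // -(zs_bij (f := fun m => - m - 1) (g := fun m => - m - 1)) //.
  by apply: eq_zs => m; rewrite refl.
have [S hS] : fsupp (fun p => c (- p - 1)).
  by apply: fsupp_inj fc => p q; lia.
have cS i : i \notin S -> c (- i - 1) * z ^ i = 0 by move=> /hS ->; rewrite mul0r.
by rewrite (zsE cS); exact: hsum_fin.
Qed.

Lemma L0_homog e v : homog G e v -> L0 G v = (e%:~R / 2 : C) *: v.
Proof.
move=> hv; rewrite /L0 -/(zs _) (zs_single (i0 := e)) => [|n ne]; first by rewrite hv.
by rewrite (homog_piN hv) // scaler0.
Qed.

Lemma L0_lin : lin (L0 G).
Proof.
move=> x u v; rewrite /L0 -!/(zs _).
have f w : fsupp (fun n => (n%:~R / 2 : C) *: pi n w).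
  exact: (fsupp_gbin (fun n => n%:~R / 2) (pi_fsupp G w)).
rewrite -zsZ // -zsD //; last first.
  by apply: (fsupp_map (f := fun _ v => x *: v) _ (f u)) => _; rewrite scaler0.
by apply: eq_zs => n; rewrite pi_lin scalerDr !scalerA mulrC.
Qed.

Lemma extend_deg (f : V -> V) d (x : int -> V) : lin f ->
  (forall n v, homog G n v -> homog G (n + d) (f v)) -> in_completion G x ->
  forall n, extend G f x n = f (x (n - d)).
Proof.
move=> fl fd hx n; rewrite /extend -/(zs _) (zs_single (i0 := n - d)) => [|m mn].
  by apply: homog_eq (fd _ _ (hx _)) _; lia.
by rewrite (homog_piN (fd _ _ (hx m))) //; apply: contra_neq mn => ->; lia.
Qed.

Lemma L0_homog_stable n v : homog G n v -> homog G (n + 0) (L0 G v).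
Proof. by move=> hv; rewrite addr0 (L0_homog hv); exact: homogZ. Qed.

Section ModesOf.
Context (phi : C -> V -> int -> V) (wt : int).
Hypothesis phi_an : analytic_field G phi.
Hypothesis phi_wt : forall v (v' : graded_dual G) z, z != 0 ->
  pairing v' (bracket G (L0 G) (phi z) v) =
    z * derive1 (matrix_coef v' phi v) z +
      (wt%:~R / 2) * matrix_coef (G := G) v' phi v z.

Let comp z v n : z != 0 -> homog G n (phi z v n).
Proof. by move=> /phi_an.1[h _]; exact: h. Qed.

Let phi_lin z x u v n : z != 0 -> phi z (x *: u + v) n = x *: phi z u n + phi z v n.
Proof. by move=> /phi_an.1[_ h]; exact: h. Qed.

Let phi0 z n : z != 0 -> phi z 0 n = 0.
Proof. by move=> z0; exact: (lin0 (f := fun v => phi z v n) (fun x u v => phi_lin x u v n z0)). Qed.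

(** For homogeneous v the condition on the weight is an Euler equation for each
    component of phi(z) v, so that the component is a monomial in z, or zero
    when the exponent would be a proper half-integer. *)
Lemma phi_component e v k : homog G e v ->
  (exists p, k - e - wt = 2 * p /\ forall z, z != 0 -> phi z v k = z ^ p *: phi 1 v k) \/
  ((~ exists p, k - e - wt = 2 * p) /\ forall z, z != 0 -> phi z v k = 0).
Proof.
move=> hv.
have one : (1 : C) != 0 by exact: oner_neq0.
have ode (v' : graded_dual G) : forall z, z != 0 ->
    hasD (fun z => v' (phi z v k)) z ((k - e - wt)%:~R / 2 * v' (phi z v k) / z).
  move=> z z0; have [w' hw] := dual_pi v' k.
  have mE y : y != 0 -> matrix_coef w' phi v y = v' (phi y v k).
    by move=> y0; apply: pairing_pi => // n; exact: comp.
  have nz : 0 < nm z by rewrite nm_gt0.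
  have := holo_hasD (phi_an.2 w' v z z0).
  have := phi_wt v w' z0; rewrite mE //.
  have -> : pairing w' (bracket G (L0 G) (phi z) v) =
      (k - e)%:~R / 2 * v' (phi z v k).
    have hc : in_completion G (phi z v) by move=> n; exact: comp.
    have bE n : bracket G (L0 G) (phi z) v n = ((n - e)%:~R / 2 : C) *: phi z v n.
      rewrite /bracket (extend_deg L0_lin L0_homog_stable hc) subr0.
      rewrite (L0_homog (comp v n z0)) (L0_homog hv).
      rewrite -[_ *: v]addr0 phi_lin // phi0 // addr0 -scalerBl.
      by rewrite -mulrBl intrB.
    rewrite (pairing_pi (v' := v') (n := k)) // => [|n]; first by rewrite bE dualZ.
    by rewrite bE; apply: homogZ; exact: comp.
  move=> hd hD; refine (@hasD_near R (matrix_coef w' phi v) _ z _ _ nz _ _).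
    by move=> h /(lt_near z0) hz; exact: mE.
  have -> // : (k - e - wt)%:~R / 2 * v' (phi z v k) / z = derive1 (matrix_coef w' phi v) z.
  apply: (mulfI z0); rewrite mulrC divfK //.
  by apply: (addIr (wt%:~R / 2 * v' (phi z v k))); rewrite -hd !intrB; field.
have [[p hp]|no] := pselect (exists p, k - e - wt = 2 * p).
  left; exists p; split=> // z z0; apply: (dual_eq hG) => v'; rewrite dualZ.
  have [[q [hq ->]]|h] := euler_ode (ode v') => //; last by rewrite !h // mulr0.
  by rewrite mulrC; congr (_ ^ _ * _); lia.
right; split=> // z z0; apply: (dual_eq hG) => v'; rewrite dual0.
by have [[q [hq _]]|h] := euler_ode (ode v'); [case: no; exists q | exact: h].
Qed.

(** Each component being a monomial in z, its coefficient is its value at z =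
    1. *)
Definition modes_of m v : V := zs (fun e => phi 1 (pi e v) (e + wt - 2 * m - 2)).

Let mof_fsupp m v : fsupp (fun e => phi 1 (pi e v) (e + wt - 2 * m - 2)).
Proof.
by apply: (fsupp_map (f := fun e v => phi 1 v (e + wt - 2 * m - 2)) _ (pi_fsupp G v)) => e;
  rewrite phi0 ?oner_neq0.
Qed.

Let mof_homog e m v : homog G e v -> modes_of m v = phi 1 v (e + wt - 2 * m - 2).
Proof.
move=> hv; rewrite /modes_of (zs_single (i0 := e)) ?hv // => e' ee.
by rewrite (homog_piN hv) // phi0 ?oner_neq0.
Qed.

Lemma modes_of_lin : modes_lin modes_of.
Proof.
move=> m x u v; rewrite /modes_of -zsZ // -zsD //; last first.
  by apply: (fsupp_map (f := fun _ v => x *: v) _ (mof_fsupp m u)) => _; rewrite scaler0.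
by apply: eq_zs => e; rewrite pi_lin phi_lin ?oner_neq0.
Qed.

Lemma modes_of_deg : field_deg G wt modes_of.
Proof. by move=> m e v hv; rewrite (mof_homog _ hv); apply: comp; exact: oner_neq0. Qed.

Lemma modes_of_gf : gfield modes_of.
Proof. exact: gfield_deg modes_of_lin modes_of_deg. Qed.

Lemma modes_of_fld z v k : z != 0 -> phi z v k = fld modes_of z v k.
Proof.
move=> z0; have h2 := (fld_hom z modes_of_gf).2.
elim/(homog_ind (G := G)): v => [e v hv|u v hu hv]; last first.
  by rewrite -[u]scale1r phi_lin // h2 hu hv.
have piE m : k != e + wt - 2 * m - 2 -> pi k (modes_of m v) = 0.
  by move=> h; exact: homog_piN (modes_of_deg _ hv) h.
case: (phi_component k hv) => [[p [hp ->]]|[no ->]] //.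
  rewrite /fld (zs_single (i0 := - p - 1)); last first.
    by move=> m modes_prod; rewrite piE ?scaler0 //; apply: contra_neq modes_prod; lia.
  have -> : - (- p - 1) - 1 = p by lia.
  rewrite (mof_homog _ hv); have -> : e + wt - 2 * (- p - 1) - 2 = k by lia.
  by rewrite comp ?oner_neq0.
rewrite /fld zs0 // => m; rewrite piE ?scaler0 //.
by apply: contra_notN no => /eqP ->; exists (- m - 1); lia.
Qed.

Lemma modes_of_coef (v' : graded_dual G) v z : z != 0 ->
  matrix_coef v' phi v z = zs (fun m => v' (modes_of m v) * z ^ (- m - 1)).
Proof.
move=> z0; rewrite -(pairing_fld v' z v modes_of_gf) /matrix_coef.
by congr (pairing _ _); apply/funext => n; exact: modes_of_fld.
Qed.

Lemma modeE m v : mode G phi m v = modes_of m v.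
Proof.
have lc (v' : graded_dual G) : laurent_coef (matrix_coef v' phi v) (- m - 1) =
    v' (modes_of m v).
  rewrite (laurent_coefE _ (laurent_fin (gf_fsupp v' v modes_of_gf) (modes_of_coef v' v))).
  by congr (v' (modes_of _ _)); lia.
rewrite /mode; case: xgetP => [w _ hw|no].
  by apply: (dual_eq hG) => v'; rewrite hw lc.
by case: (no (modes_of m v)) => v'; rewrite lc.
Qed.

End ModesOf.
End FieldsAndModes.

(** * The axioms other than duality *)
Section VertexAxioms.
Context {R : realType} {V : lmodType (Cplx R)} (G : grading V).
Local Notation C := (Cplx R).
Local Notation pi := (graded_proj G).
Implicit Types (u v w : V) (n m d e k : int) (A : int -> V -> V) (z : C).
Context (hG : grading_restricted G) (L : V -> V) (vac : V) (Y : V -> int -> V -> V).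
Hypothesis (L_lin : lin L) (L_vac : L vac = 0).
Hypothesis vac0 : homog G 0 vac.
Hypothesis sfY : state_field_map G L vac Y.

Definition vertex_op : V -> C -> V -> int -> V := fun u => fld G (Y u).

Lemma Y_stateD u v n w : Y (u + v) n w = Y u n w + Y v n w.
Proof. by rewrite -[u]scale1r (sf_lin_state sfY) !scale1r. Qed.

Lemma Y_stateZ (x : C) u n w : Y (x *: u) n w = x *: Y u n w.
Proof.
apply: (linZ (f := fun u => Y u n w)) => y a b; exact: (sf_lin_state sfY).
Qed.

Lemma Y_gfield u : gfield G (Y u).
Proof.
elim/(homog_ind (G := G)): u => [d u hu|u v hu hv].
  exact: gfield_deg (sf_lin sfY u) (sf_deg sfY hu).
have -> : Y (u + v) = fun n w => Y u n w + Y v n w.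
  by apply/funext => n; apply/funext => w; rewrite Y_stateD.
exact: gfieldD.
Qed.

Lemma vertex_op_map : is_vertex_map G vertex_op.
Proof.
split=> [u z _|x u1 u2 z v n _]; first exact: fld_hom (Y_gfield u).
rewrite /vertex_op /fld.
have fz u : fsupp (fun m => z ^ (- m - 1) *: pi n (Y u m v)).
  by apply: (fsupp_map (f := fun m v => z ^ (- m - 1) *: v) _ ((Y_gfield u).2 v n)) => m;
    rewrite scaler0.
rewrite -zsZ // -zsD //; last first.
  by apply: (fsupp_map (f := fun _ v => x *: v) _ (fz u1)) => _; rewrite scaler0.
by apply: eq_zs => m; rewrite (sf_lin_state sfY) pi_lin scalerDr !scalerA mulrC.
Qed.

Lemma vertex_op_analytic u : analytic_field G (vertex_op u).
Proof. exact: fld_analytic (Y_gfield u). Qed.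

Lemma L_degree d u : homog G d u -> homog G (d + 2) (L u).
Proof.
move=> hu; have := sf_transl sfY u (-1) vac.
rewrite (sf_create sfY) L_vac (lin0 (sf_lin sfY u _)) subr0 opprK scale1r => ->.
by apply: homog_eq (sf_deg sfY hu _ vac0) _; lia.
Qed.

Definition comm (f : V -> V) A m v := f (A m v) - A m (f v).

Lemma pi_deg (f : V -> V) d n v : lin f ->
  (forall n v, homog G n v -> homog G (n + d) (f v)) -> pi n (f v) = f (pi (n - d) v).
Proof.
move=> fl fd; move: v; apply: (lin_eq (G := G)).
- exact: lin_comp (pi_lin G n) fl.
- exact: lin_comp fl (pi_lin G (n - d)).
- move=> e v hv; have [en|en] := eqVneq e (n - d).
    by rewrite -en hv; apply: homog_eq (fd _ _ hv) _; rewrite en subrK.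
  rewrite (homog_piN (fd _ _ hv)); first by rewrite (homog_piN hv) ?(lin0 fl) // eq_sym.
  by apply: contra_neq en => ->; rewrite addrK.
Qed.

Lemma comm_gfield (f : V -> V) d A : lin f ->
  (forall n v, homog G n v -> homog G (n + d) (f v)) -> gfield G A -> gfield G (comm f A).
Proof.
move=> fl fd [al af]; split=> [n x u v|v n].
  rewrite /comm (al n x) fl fl (al n x) opprD addrACA.
  by rewrite -scalerBr.
apply: (eq_fsupp (F := fun m => f (pi (n - d) (A m v)) + - pi n (A m (f v)))).
  by move=> m; rewrite /comm (linB _ _ (pi_lin G n)) (pi_deg _ _ fl fd).
apply: fsuppD.
  by apply: (fsupp_map (f := fun=> f) _ (af v (n - d))) => _; rewrite lin0.
by apply: (fsupp_map (f := fun=> -%R) _ (af (f v) n)) => _; rewrite oppr0.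
Qed.

Lemma bracket_fld (f : V -> V) d A z v : lin f ->
  (forall n v, homog G n v -> homog G (n + d) (f v)) -> gfield G A ->
  bracket G f (fld G A z) v = fld G (comm f A) z v.
Proof.
move=> fl fd gA; have [al af] := gA; apply/funext => n.
have fz w k : fsupp (fun m => z ^ (- m - 1) *: pi k (A m w)).
  by apply: (fsupp_map (f := fun m v => z ^ (- m - 1) *: v) _ (af w k)) => m; rewrite scaler0.
have hc : in_completion G (fld G A z v) by case: (fld_hom z gA) => h _; exact: h.
rewrite /bracket (extend_deg fl fd hc) /fld (lin_zs fl (fz _ _)) -zsN // -zsD.
- apply: eq_zs => m; rewrite /comm (linB _ _ (pi_lin G n)) (pi_deg _ _ fl fd).
  by rewrite scalerBr (linZ _ _ fl).
- by apply: (fsupp_map (f := fun=> f) _ (fz v (n - d))) => _; rewrite lin0.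
- by apply: (fsupp_map (f := fun=> -%R) _ (fz (f v) n)) => _; rewrite oppr0.
Qed.

Lemma Y_L0 u m v : comm (L0 G) (Y u) m v = (- m - 1)%:~R *: Y u m v + Y (L0 G u) m v.
Proof.
move: v; apply: (lin_eq (G := G)).
- move=> x v w; have [h _] := comm_gfield (L0_lin G) (@L0_homog_stable _ _ G) (Y_gfield u).
  exact: h.
- move=> x v w; rewrite !(sf_lin sfY) !scalerDr !scalerA addrACA.
  by rewrite [x * _]mulrC.
move=> e v hv; elim/(homog_ind (G := G)): u => [d u hu|u w h1 h2]; last first.
  rewrite /comm (linD _ _ (L0_lin G)) !Y_stateD (linD _ _ (L0_lin G)) scalerDr.
  rewrite opprD addrACA; move: h1 h2; rewrite /comm => -> ->.
  by rewrite [RHS]addrACA.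
rewrite /comm (L0_homog hu) (L0_homog hv) (L0_homog (sf_deg sfY hu m hv)).
rewrite Y_stateZ (linZ _ _ (sf_lin sfY u m)) -scalerBl -scalerDl; congr (_ *: _).
by rewrite !(intrD, intrB, intrM, intrN); field.
Qed.

Lemma vertex_op_L0 : L0_bracket_formula G vertex_op.
Proof.
move=> u v v' z z0; have gY := Y_gfield u.
rewrite /vertex_op (bracket_fld _ _ (L0_lin G) (@L0_homog_stable _ _ G) gY).
have gc := comm_gfield (L0_lin G) (@L0_homog_stable _ _ G) gY.
rewrite (hasDP (fld_hasD v' v gY z0)).2 (pairing_fld _ _ _ gc).
rewrite (pairing_fld _ _ _ (fld_dfield gY)) (pairing_fld _ _ _ (Y_gfield _)).
have fY w : fsupp (fun m => v' (Y w m v) * z ^ (- m - 1)).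
  by apply: (fsupp_map (f := fun m x => x * z ^ (- m - 1)) _ (gf_fsupp v' v (Y_gfield w))) => m;
    rewrite mul0r.
have -> : z * zs (fun m => v' (dfield (Y u) m v) * z ^ (- m - 1)) =
    zs (fun m => (- m - 1)%:~R * (v' (Y u m v) * z ^ (- m - 1))).
  have fd : fsupp (fun m => v' (dfield (Y u) m v) * z ^ (- m - 1)).
    by apply: (fsupp_map (f := fun m x => x * z ^ (- m - 1)) _
      (gf_fsupp v' v (fld_dfield gY))) => m; rewrite mul0r.
  rewrite (zs_map (f := *%R z)) ?mulr0 //; last exact: mulrDr.
  rewrite -(zs_bij (f := fun m => m + 1) (g := fun m => m - 1)) => [|m|m];
    rewrite ?addrK ?subrK //.
  apply: eq_zs => m; rewrite /dfield dualZ addrK.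
  have -> : (- m - 1)%:~R = - (m + 1)%:~R :> C by rewrite -intrN; congr (_%:~R); lia.
  have -> : z ^ (- m - 1) = z * z ^ (- (m + 1) - 1).
    by rewrite -[X in X * _]expr1z -expfzDr //; congr (_ ^ _); lia.
  by move: (z ^ (- (m + 1) - 1)) => y; ring.
rewrite -zsD //; last first.
  by apply: (fsupp_map (f := fun m x => (- m - 1)%:~R * x) _ (fY u)) => m; rewrite mulr0.
by apply: eq_zs => m; rewrite Y_L0 dualD dualZ mulrDl mulrA.
Qed.

Lemma vertex_op_identity : identity_property G vac vertex_op.
Proof.
move=> z v n _; rewrite /vertex_op /fld (sf_vac sfY) (zs_single (i0 := -1)).
  by rewrite /idfield eqxx opprK subrr expr0z scale1r.
by move=> m /negbTE m1; rewrite /idfield m1 (lin0 (pi_lin G n)) scaler0.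
Qed.

Lemma expz_lim0 (j : nat) : ((h : C) ^ j%:Z) @[h --> 0^'] --> ((j == 0)%N%:R : C).
Proof.
elim: j => [|j IH].
  by apply/lim0P => e e0; exists 1 => // h _; rewrite expr0z subrr nm0.
have H := lim0M (@id_lim0 R) IH; rewrite mul0r in H.
by apply: (lim0_eq H (@ltr01 R)) => h _; rewrite -!exprnP exprS.
Qed.

Lemma laurent_lim0 (c : int -> C) : fsupp c -> (forall m, 0 <= m -> c m = 0) ->
  zs (fun m => c m * h ^ (- m - 1)) @[h --> 0^'] --> c (-1).
Proof.
move=> [S hS] c0.
have -> : c (-1) = \sum_(m <- S) c m * (m == -1)%:R.
  rewrite -(zsE (F := fun m => c m * (m == -1)%:R)) => [|m /hS ->]; last by rewrite mul0r.
  rewrite (zs_single (i0 := -1)) ?eqxx ?mulr1 // => m /negbTE ->.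
  by rewrite mulr0.
have E : (fun h : C => zs (fun m => c m * h ^ (- m - 1))) =
    fun h => \sum_(m <- S) c m * h ^ (- m - 1).
  by apply/funext => h; apply: zsE => m /hS ->; rewrite mul0r.
rewrite E; elim: (S : seq int) => [|m r IH].
  rewrite big_nil; have -> : (fun h : C => \sum_(m <- [::]) c m * h ^ (- m - 1)) = fun=> 0.
    by apply/funext => h; rewrite big_nil.
  exact: (@lim0C R 0).
rewrite big_cons.
have -> : (fun h : C => \sum_(j <- m :: r) c j * h ^ (- j - 1)) =
   fun h => c m * h ^ (- m - 1) + \sum_(j <- r) c j * h ^ (- j - 1).
  by apply/funext => h; rewrite big_cons.
apply: (lim0D _ IH); case: (leP 0 m) => [m0|m0].
  have -> : (fun h : C => c m * h ^ (- m - 1)) = fun=> 0.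
    by apply/funext => h; rewrite c0 // mul0r.
  rewrite (c0 _ m0) mul0r; exact: (@lim0C R 0).
have [j mj] : exists j : nat, - m - 1 = j%:Z by exists (absz (- m - 1)%R); lia.
have -> : (m == -1) = (j == 0)%N by lia.
rewrite mj; exact: (lim0M (@lim0C R (c m)) (@expz_lim0 j)).
Qed.

Lemma vertex_op_creation : creation_property G vac vertex_op.
Proof.
move=> u v'; have gY := Y_gfield u; rewrite -{2}[u](sf_create sfY).
have -> : matrix_coef v' (vertex_op u) vac =
    fun z => zs (fun m => v' (Y u m vac) * z ^ (- m - 1)).
  by apply/funext => z; rewrite /matrix_coef pairing_fld.
apply: (@laurent_lim0 (fun m => v' (Y u m vac))); first exact: gf_fsupp.
by move=> m m0; rewrite (sf_creat sfY) // dual0.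
Qed.

Lemma vertex_op_translation : translation_property G vac vertex_op.
Proof.
have dE u v (v' : graded_dual G) z : z != 0 ->
    derive1 (matrix_coef v' (vertex_op u) v) z = pairing v' (vertex_op (L u) z v).
  move=> z0; rewrite (hasDP (fld_hasD v' v (Y_gfield u) z0)).2.
  by rewrite /vertex_op (sf_deriv sfY).
exists L; split; last split.
- move=> u v'; have H := @vertex_op_creation (L u) v'.
  apply: (lim0_eq H (@ltr01 R)) => h /andP[]; rewrite nm_gt0 => h0 _.
  by rewrite dE.
- by move=> n _ [u hu <-]; exact: L_degree.
- move=> u v v' z z0; split; first exact: dE.
  have cE : comm L (Y u) = dfield (Y u).
    by apply/funext => m; apply/funext => w; rewrite /comm (sf_transl sfY).
  rewrite (bracket_fld _ _ L_lin L_degree (Y_gfield u)) cE -(sf_deriv sfY).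
  exact: dE.
Qed.

(** A subspace stable under a vertex operator is stable under its modes, which
    are recovered as graded components. *)
Lemma generated_gen (I : Type) (a : I -> int -> V -> V) (wt : I -> int) :
  (forall i, field_deg G (wt i) (a i)) -> (forall i, Y (a i (-1) vac) = a i) ->
  (forall v, exists s : seq (C * seq (I * int)),
     v = \sum_(p <- s) p.1 *: modes_prod a vac p.2) ->
  generated_by G vac vertex_op [set a i (-1) vac | i in [set: I]].
Proof.
move=> ad aY span W [Wvac Wlin Wpi WY] SW; apply/seteqP; split=> // v _.
have W0 : W 0 by have := Wlin (-1) vac vac Wvac Wvac; rewrite scaleN1r addNr.
have WD x y : W x -> W y -> W (x + y) by move=> hx; rewrite -[x]scale1r; exact: Wlin.
have Wmode i m w : W w -> W (a i m w).
  move=> Ww; have ai : lin (a i m) by rewrite -(aY i); exact: (sf_lin sfY).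
  rewrite (pi_sum G w) lin_zs //; last exact: pi_fsupp.
  have [S hS] := pi_fsupp G w; rewrite (zsE (A := S)) => [|e /hS ->]; last by rewrite lin0.
  elim: (S : seq int) => [|e r IH]; first by rewrite big_nil.
  rewrite big_cons; apply: WD => //.
  have one : (1 : C) != 0 by exact: oner_neq0.
  have := WY (a i (-1) vac) (pi e w) 1 (e + wt i - 2 * m - 2) (SW _ _) (Wpi _ _ Ww) one.
  rewrite /vertex_op aY /fld (zs_single (i0 := m)).
    rewrite exp1rz scale1r (ad i m _ _ (homog_pi G e w)); apply.
    by exists i.
  move=> k km; rewrite (homog_piN (ad i k _ _ (homog_pi G e w))) ?scaler0 //.
  by apply: contra_neq km; lia.
have Wmp s : W (modes_prod a vac s) by elim: s => //= p s IH; exact: Wmode.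
have [s ->] := span v; elim: s => [|p s IH]; first by rewrite big_nil.
by rewrite big_cons; apply: Wlin.
Qed.

End VertexAxioms.

(** * Expansions of rational functions of one variable *)
Section Expansions.
Context {R : realType}.
Local Notation C := (Cplx R).
Implicit Types (h f : int -> C) (m n : int) (s x z : C).

(** Multiplication by x - 1, for scalar coefficients. *)
Definition sdl h m : C := h (m + 1) - h m.

Lemma expz_succ (x : C) m : x != 0 -> x ^ (m + 1) = x * x ^ m.
Proof. by move=> x0; rewrite expfzDr // expr1z mulrC. Qed.

(** Here h is a Laurent series in 1 / x, and 1 / (x - 1) is expanded in powers
    of 1 / x. *)
Lemma hsum_out h N n x s : 1 < nm x -> (forall m, m < n -> h m = 0) ->
  hsum (fun m => iter N sdl h m * x ^ (- m - 1)) s ->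
  hsum (fun m => h m * x ^ (- m - 1)) (s / (x - 1) ^+ N).
Proof.
move=> x1 hn; have x0 : x != 0 by rewrite -nm_gt0; apply: lt_trans x1.
have x10 : x - 1 != 0.
  by rewrite subr_eq0; apply: contraTneq x1 => ->; rewrite nm1 ltxx.
elim: N s => [|N IH] s; first by rewrite expr0 divr1.
have low k : (forall m, m < k -> iter N sdl h m = 0) -> hsum (fun m => iter N.+1 sdl h m * x ^ (- m - 1)) s ->
    hsum (fun m => iter N sdl h m * x ^ (- m - 1)) (s / (x - 1)).
  move=> hk hs; pose F m := iter N sdl h m * x ^ (- m - 1).
  have -> : s / (x - 1) = (s / x) / (1 - x^-1).
    by field; rewrite x10 x0.
  apply: (@hsum_div _ _ (fun m => m - 1) (fun m => m + 1)).
  - by move=> m; rewrite subrK.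
  - by move=> m; rewrite addrK.
  - by rewrite nmV invf_lt1 // nm_gt0.
  - move=> m; exists (absz (m - k)%R).+1 => t ht.
    have -> : iter t (fun m => m - 1) m = m - t%:Z.
      by elim: t {ht} => /= [|t ->]; lia.
    by rewrite hk ?mul0r //; lia.
  have sinj : injective (fun m : int => m - 1) by move=> a b /addIr.
  have surj j : (forall i : int, i - 1 != j) ->
      iter N.+1 sdl h j * x ^ (- j - 1) = 0.
    by move=> /(_ (j + 1)); rewrite addrK eqxx.
  have /(hsumZ x^-1) := (hsum_inj sinj s surj).1 hs.
  rewrite mulrC; apply: hsum_ext => m; rewrite /= /sdl subrK.
  have -> : - (m - 1) - 1 = (- m - 1) + 1 by lia.
  by rewrite expz_succ //; move: (x ^ _) => y; field.
have lowN : forall m, m < n - N%:Z -> iter N sdl h m = 0.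
  elim: N {IH low} => [|N IHN] m mn; first by apply: hn; lia.
  by rewrite /= /sdl !IHN ?subrr //; lia.
move=> /(low _ lowN)/IH; rewrite exprS invfM.
by congr hsum; rewrite mulrA.
Qed.

(** Here h is a Laurent series in x, and 1 / (x - 1) is expanded in powers of
    x. *)
Lemma hsum_in h N n x s : 0 < nm x < 1 -> (forall m, n < m -> h m = 0) ->
  hsum (fun m => iter N sdl h m * x ^ (- m - 1)) s ->
  hsum (fun m => h m * x ^ (- m - 1)) (s / (x - 1) ^+ N).
Proof.
move=> /andP[xp x1] hn; have x0 : x != 0 by rewrite -nm_gt0.
have x10 : x - 1 != 0.
  by rewrite subr_eq0; apply: contraTneq x1 => ->; rewrite nm1 ltxx.
have x11 : 1 - x != 0 by rewrite -opprB oppr_eq0.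
elim: N s => [|N IH] s; first by rewrite expr0 divr1.
have low : (forall m, n < m -> iter N sdl h m = 0) -> hsum (fun m => iter N.+1 sdl h m * x ^ (- m - 1)) s ->
    hsum (fun m => iter N sdl h m * x ^ (- m - 1)) (s / (x - 1)).
  move=> hk hs.
  have -> : s / (x - 1) = (- s) / (1 - x) by field; rewrite x10 x11.
  apply: (@hsum_div _ _ (fun m => m + 1) (fun m => m - 1)).
  - by move=> m; rewrite addrK.
  - by move=> m; rewrite subrK.
  - by [].
  - move=> m; exists (absz (n - m)%R).+1 => t ht.
    have -> : iter t (fun m => m + 1) m = m + t%:Z.
      by elim: t {ht} => /= [|t ->]; lia.
    by rewrite hk ?mul0r //; lia.
  have := hsumN hs; apply: hsum_ext => m; rewrite /= /sdl.
  have -> : - m - 1 = (- (m + 1) - 1) + 1 by lia.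
  by rewrite expz_succ //; move: (x ^ _) => y; ring.
have highN : forall m, n < m -> iter N sdl h m = 0.
  elim: N {IH low} => [|N IHN] m mn; first exact: hn.
  by rewrite /= /sdl !IHN ?subrr //; lia.
move=> /(low highN)/IH; rewrite exprS invfM.
by congr hsum; rewrite mulrA.
Qed.

(** Coefficients of (1 + xi) ^ p, indexed by the integers. *)
Definition bin (p i : int) : C := if i is Posz j then gbin p%:~R j else 0.

Lemma bin_pascal p i : bin (p + 1) i = bin p i + bin p (i - 1).
Proof.
case: i => [[|j]|j]; first by rewrite /bin /= addr0.
  have -> : Posz j.+1 - 1 = j by lia.
  by rewrite /bin intrD; exact: gbin_pascal.
by rewrite /bin /= addr0.
Qed.

(** From p = 0 by induction in both directions: Pascal's rule is multiplication
    by 1 + x, which the geometric series inverts. *)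
Lemma hsum_bin (p : int) x : nm x < 1 -> hsum (fun i => bin p i * x ^ i) ((1 + x) ^ p).
Proof.
move=> x1; have [->|x0] := eqVneq x 0.
  rewrite addr0 exp1rz; have -> : 1 = \sum_(i <- [fset (0 : int)]%fset) (bin p i * 0 ^ i).
    by rewrite big_seq_fset1 expr0z mulr1.
  by apply: hsum_fin => i; rewrite inE => i0; rewrite exp0rz (negbTE i0) mulr0.
have y0 : 1 + x != 0.
  by rewrite addr_eq0; apply: contraTneq x1 => /(congr1 nm); rewrite nmN nm1 => <-; rewrite ltxx.
have shift s q : hsum (fun i => bin q i * x ^ i) s ->
    hsum (fun i => x * (bin q (i - 1) * x ^ (i - 1))) (x * s).
  move=> hs; apply: hsumZ.
  have sinj : injective (fun m : int => m - 1) by move=> a b /addIr.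
  apply: (hsum_inj sinj s _).1 hs => j /(_ (j + 1)).
  by rewrite addrK eqxx.
have xE i : x ^ i = x * x ^ (i - 1) by rewrite -expz_succ // subrK.
have up q s : hsum (fun i => bin q i * x ^ i) s ->
    hsum (fun i => bin (q + 1) i * x ^ i) ((1 + x) * s).
  move=> hs; rewrite mulrDl mul1r; apply: hsum_ext (hsumD hs (shift _ _ hs)) => i.
  by rewrite bin_pascal mulrDl [in RHS]xE [in LHS]xE; ring.
have down q s : hsum (fun i => bin (q + 1) i * x ^ i) s ->
    hsum (fun i => bin q i * x ^ i) (s / (1 + x)).
  move=> hs; rewrite -[x in 1 + x]opprK.
  apply: (@hsum_div _ _ (fun m => m - 1) (fun m => m + 1)).
  - by move=> m; rewrite subrK.
  - by move=> m; rewrite addrK.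
  - by rewrite nmN.
  - move=> m; exists (absz m).+1 => t ht.
    have -> : iter t (fun m => m - 1) m = m - t%:Z.
      by elim: t {ht} => /= [|t ->]; lia.
    case E : (m - t%:Z) => [j|j]; first lia.
    by rewrite /bin mul0r.
  apply: hsum_ext hs => i; rewrite bin_pascal mulrDl mulNr opprK; congr (_ + _).
  by rewrite [in LHS]xE; ring.
have zero : hsum (fun i => bin 0 i * x ^ i) 1.
  have -> : 1 = \sum_(i <- [fset (0 : int)]%fset) (bin 0 i * x ^ i).
    by rewrite big_seq_fset1 expr0z mulr1.
  apply: hsum_fin => i; rewrite inE; case: i => [[|j]|j] // _; last by rewrite mul0r.
  by rewrite /bin -[0%:~R]/(0%:R) gbin_small // mul0r.
have pos (n : nat) : hsum (fun i => bin n i * x ^ i) ((1 + x) ^ n%:Z).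
  elim: n => [|n /up]; first by rewrite expr0z.
  have -> : n%:Z + 1 = n.+1 by lia.
  by rewrite -!exprnP exprS.
have neg (n : nat) : hsum (fun i => bin (- n%:Z) i * x ^ i) ((1 + x) ^ (- n%:Z)).
  elim: n => [|n IH]; first by rewrite oppr0 expr0z.
  have := IH; have -> : - n%:Z = - n.+1%:Z + 1 by lia.
  move=> /down; congr hsum; rewrite expz_succ //.
  by rewrite mulrC mulKf.
by case: p => n; [exact: pos | rewrite NegzE; exact: neg].
Qed.

Lemma hsum_taylor f x : fsupp f -> nm x < 1 ->
  hsum (fun i => zs (fun m => bin (- m - 1) i * f m) * x ^ i)
       (zs (fun m => f m * (1 + x) ^ (- m - 1))).
Proof.
move=> [S hS] x1.
rewrite (zsE (A := S)) => [|m /hS ->]; last by rewrite mul0r.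
apply: (hsum_ext (a := fun i => \sum_(m <- S) f m * (bin (- m - 1) i * x ^ i))).
  move=> i; rewrite (zsE (A := S)) => [|m /hS ->]; last by rewrite mulr0.
  by rewrite mulr_suml; apply: eq_bigr => m _; rewrite mulrCA mulrA.
by apply: hsum_sum => m _; apply: hsumZ; exact: hsum_bin.
Qed.

End Expansions.

(** * Rational functions of two variables *)
Section RationalTwo.
Context {R : realType}.
Local Notation C := (Cplx R).

(** A single exponent M for the three possible poles makes sums easy. *)
Definition lrat (Phi : C -> C -> C) : Prop := exists (M : nat) (P : mpoly.mpoly 2 C),
  forall z1 z2, z1 != 0 -> z2 != 0 -> z1 != z2 ->
    Phi z1 z2 = mpoly.meval (tnth [tuple z1; z2]) P / (z1 * z2 * (z1 - z2)) ^+ M.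

Lemma lrat_ext Phi Psi : (forall z1 z2, z1 != 0 -> z2 != 0 -> z1 != z2 ->
  Phi z1 z2 = Psi z1 z2) -> lrat Phi -> lrat Psi.
Proof. by move=> h [M [P hP]]; exists M, P => z1 z2 h1 h2 h3; rewrite -h // hP. Qed.

Let X1 : mpoly.mpoly 2 C := mpoly.mpolyX C (mpoly.mnm1 (ord0 : 'I_2)).
Let X2 : mpoly.mpoly 2 C := mpoly.mpolyX C (mpoly.mnm1 (lift ord0 ord0 : 'I_2)).
Let ev (z1 z2 : C) := mpoly.meval (tnth [tuple z1; z2]).
Let evX1 z1 z2 : ev z1 z2 X1 = z1. Proof. by rewrite /ev mpoly.mevalXU. Qed.
Let evX2 z1 z2 : ev z1 z2 X2 = z2. Proof. by rewrite /ev mpoly.mevalXU. Qed.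
Let evD z1 z2 P Q : ev z1 z2 (P + Q) = ev z1 z2 P + ev z1 z2 Q. Proof. exact: rmorphD. Qed.
Let evM z1 z2 P Q : ev z1 z2 (P * Q) = ev z1 z2 P * ev z1 z2 Q. Proof. exact: rmorphM. Qed.
Let evXn z1 z2 P n : ev z1 z2 (P ^+ n) = ev z1 z2 P ^+ n. Proof. exact: rmorphXn. Qed.
Let evN z1 z2 P : ev z1 z2 (- P) = - ev z1 z2 P. Proof. exact: rmorphN. Qed.
Let evE := (evD, evN, evM, evXn, evX1, evX2).

Lemma lrat0 : lrat (fun _ _ => 0).
Proof. by exists 0%N, 0 => z1 z2 _ _ _; rewrite rmorph0 mul0r. Qed.

Lemma lratD Phi Psi : lrat Phi -> lrat Psi -> lrat (fun z1 z2 => Phi z1 z2 + Psi z1 z2).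
Proof.
move=> [M [P hP]] [N [Q hQ]]; pose D : mpoly.mpoly 2 C := X1 * X2 * (X1 - X2).
exists (M + N)%N, (P * D ^+ N + Q * D ^+ M) => z1 z2 h1 h2 h3.
rewrite hP // hQ // -!/(ev z1 z2 _) /D !evE.
have h0 : z1 * z2 * (z1 - z2) != 0 by rewrite !mulf_neq0 // subr_eq0.
move: (z1 * z2 * (z1 - z2)) h0 => y y0; rewrite exprD.
have := expf_neq0 M y0; have := expf_neq0 N y0.
move: (y ^+ M) (y ^+ N) (ev _ _ _) (ev _ _ _) => a b c d b0 a0.
by field; rewrite a0 b0.
Qed.

Lemma lratZ (c : C) Phi : lrat Phi -> lrat (fun z1 z2 => c * Phi z1 z2).
Proof.
move=> [M [P hP]]; exists M, (c *: P) => z1 z2 h1 h2 h3.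
by rewrite hP // mpoly.mevalZ mulrA.
Qed.

Lemma lrat_mono (a b c : int) : lrat (fun z1 z2 => z1 ^ a * z2 ^ b * (z1 - z2) ^ c).
Proof.
pose M := (absz a + absz b + absz c)%N.
exists M, (X1 ^+ absz (a + M%:Z)%R * X2 ^+ absz (b + M%:Z)%R * (X1 - X2) ^+ absz (c + M%:Z)%R).
move=> z1 z2 h1 h2 h3; have h4 : z1 - z2 != 0 by rewrite subr_eq0.
rewrite -/(ev z1 z2 _) !evE.
have E (y : C) (i : int) : y != 0 -> (absz i <= M)%N ->
    y ^+ absz (i + M%:Z)%R = y ^ i * y ^+ M.
  move=> y0 iM; rewrite [LHS]exprnP [y ^+ M]exprnP -expfzDr //.
  by congr (_ ^ _); lia.
rewrite !E // /M; try lia.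
rewrite !exprMn; have := expf_neq0 M h1; have := expf_neq0 M h2; have := expf_neq0 M h4.
rewrite -/M; move: (z1 ^+ M) (z2 ^+ M) ((z1 - z2) ^+ M) => x y w w0 y0 x0.
by field; rewrite x0 y0 w0.
Qed.

Lemma lrat_sum (T : Type) (r : seq T) (Phi : T -> C -> C -> C) :
  (forall t, lrat (Phi t)) -> lrat (fun z1 z2 => \sum_(t <- r) Phi t z1 z2).
Proof.
move=> h; elim: r => [|t r IH].
  by apply: lrat_ext lrat0 => z1 z2 _ _ _; rewrite big_nil.
by apply: lrat_ext (lratD (h t) IH) => z1 z2 _ _ _; rewrite big_cons.
Qed.

Lemma lrat_rational Phi : lrat Phi -> exists F : 2.-tuple C -> C, is_rational F /\
  forall z1 z2, z1 != 0 -> z2 != 0 -> z1 != z2 -> F [tuple z1; z2] = Phi z1 z2.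
Proof.
move=> [M [P hP]]; pose F := @rat_eval R 2 (fun=> M) (fun _ _ => M) P.
exists F; split; first by exists (fun=> M), (fun _ _ => M), P.
move=> z1 z2 h1 h2 h3; rewrite hP // /F /rat_eval; congr (_ / _).
rewrite 2!big_ord_recl big_ord0 mulr1 !exprMn; congr (_ * _).
rewrite 2!big_ord_recl big_ord0 mulr1.
rewrite big_mkcond 2!big_ord_recl big_ord0 /= mul1r mulr1.
rewrite big_mkcond 2!big_ord_recl big_ord0 /= !mulr1.
by [].
Qed.

End RationalTwo.

(** * Duality *)
Section Duality.
Context {R : realType} {V : lmodType (Cplx R)} (G : grading V).
Local Notation C := (Cplx R).
Local Notation pi := (graded_proj G).
Implicit Types (u v w : V) (m n d e k : int) (A : int -> V -> V) (z : C).
Context (hG : grading_restricted G) (L : V -> V) (vac : V) (Y : V -> int -> V -> V).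
Hypothesis sfY : state_field_map G L vac Y.
Local Notation vop := (vertex_op G Y).

(** The conclusion of the duality axiom for three arbitrary families of terms:
    it is additive in them, which reduces duality to homogeneous vectors and
    functionals. *)
Definition dual_fam (b : bool) (t1 t2 t3 : C -> C -> int -> C) : Prop :=
  exists Phi : C -> C -> C, lrat Phi /\ forall z1 z2 : C,
    (0 < nm z2 < nm z1 -> hsum (t1 z1 z2) (Phi z1 z2)) /\
    (0 < nm z1 < nm z2 -> hsum (fun n => (-1) ^+ b * t2 z1 z2 n) (Phi z1 z2)) /\
    (0 < nm (z1 - z2) < nm z2 -> hsum (t3 z1 z2) (Phi z1 z2)).

Let regions (z1 z2 : C) :
  [\/ 0 < nm z2 < nm z1, 0 < nm z1 < nm z2 | 0 < nm (z1 - z2) < nm z2] ->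
  [/\ z1 != 0, z2 != 0 & z1 != z2].
Proof.
move=> [/andP[h1 h2]|/andP[h1 h2]|/andP[h1 h2]]; split.
- by rewrite -nm_gt0; apply: lt_trans h2.
- by rewrite -nm_gt0.
- by apply: contraTneq h2 => ->; rewrite ltxx.
- by rewrite -nm_gt0.
- by rewrite -nm_gt0; apply: lt_trans h2.
- by apply: contraTneq h2 => ->; rewrite ltxx.
- by apply: contraTneq h2 => ->; rewrite sub0r nmN ltxx.
- by rewrite -nm_gt0; apply: lt_trans h2.
- by rewrite -subr_eq0 -nm_gt0.
Qed.

Lemma dual_famD b t1 t2 t3 s1 s2 s3 r1 r2 r3 :
  (forall z1 z2 n, z1 != 0 -> z2 != 0 -> z1 != z2 ->
    [/\ r1 z1 z2 n = t1 z1 z2 n + s1 z1 z2 n,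
        r2 z1 z2 n = t2 z1 z2 n + s2 z1 z2 n &
        r3 z1 z2 n = t3 z1 z2 n + s3 z1 z2 n]) ->
  dual_fam b t1 t2 t3 -> dual_fam b s1 s2 s3 -> dual_fam b r1 r2 r3.
Proof.
move=> E [P [rP hP]] [Q [rQ hQ]]; exists (fun z1 z2 => P z1 z2 + Q z1 z2).
split; first exact: lratD.
move=> z1 z2; have [p1 [p2 p3]] := hP z1 z2; have [q1 [q2 q3]] := hQ z1 z2.
split; [|split] => hz.
- have [h1 h2 h3] := regions (Or31 _ _ hz).
  apply: hsum_ext (hsumD (p1 hz) (q1 hz)) => n.
  by have [-> _ _] := E z1 z2 n h1 h2 h3.
- have [h1 h2 h3] := regions (Or32 _ _ hz).
  apply: hsum_ext (hsumD (p2 hz) (q2 hz)) => n.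
  by have [_ -> _] := E z1 z2 n h1 h2 h3; rewrite mulrDr.
- have [h1 h2 h3] := regions (Or33 _ _ hz).
  apply: hsum_ext (hsumD (p3 hz) (q3 hz)) => n.
  by have [_ _ ->] := E z1 z2 n h1 h2 h3.
Qed.

Lemma dual_fam0 b t1 t2 t3 :
  (forall z1 z2 n, z1 != 0 -> z2 != 0 -> z1 != z2 ->
    [/\ t1 z1 z2 n = 0, t2 z1 z2 n = 0 & t3 z1 z2 n = 0]) -> dual_fam b t1 t2 t3.
Proof.
move=> E; exists (fun _ _ => 0); split; first exact: lrat0.
move=> z1 z2; split; [|split] => hz.
- have [h1 h2 h3] := regions (Or31 _ _ hz).
  by apply: hsum_ext hsum0 => n; have [-> _ _] := E z1 z2 n h1 h2 h3.
- have [h1 h2 h3] := regions (Or32 _ _ hz).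
  by apply: hsum_ext hsum0 => n; have [_ -> _] := E z1 z2 n h1 h2 h3; rewrite mulr0.
- have [h1 h2 h3] := regions (Or33 _ _ hz).
  by apply: hsum_ext hsum0 => n; have [_ _ ->] := E z1 z2 n h1 h2 h3.
Qed.

Definition t1 u1 u2 v (v' : graded_dual G) z1 z2 n := pairing v' (vop u1 z1 (vop u2 z2 v n)).
Definition t2 u1 u2 v (v' : graded_dual G) z1 z2 n := pairing v' (vop u2 z2 (vop u1 z1 v n)).
Definition t3 u1 u2 v (v' : graded_dual G) z1 z2 n :=
  pairing v' (vop (vop u1 (z1 - z2) u2 n) z2 v).

Let gY := Y_gfield sfY.
Let pv_fsupp (v' : graded_dual G) u z v : fsupp (fun m => v' (Y u m v) * z ^ (- m - 1)).
Proof.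
by apply: (fsupp_map (f := fun m x => x * z ^ (- m - 1)) _ (gf_fsupp v' v (gY u))) => m;
  rewrite mul0r.
Qed.

Lemma pvE (v' : graded_dual G) u z v :
  pairing v' (vop u z v) = zs (fun m => v' (Y u m v) * z ^ (- m - 1)).
Proof. exact: pairing_fld. Qed.

Lemma pvDv (v' : graded_dual G) u z v w :
  pairing v' (vop u z (v + w)) = pairing v' (vop u z v) + pairing v' (vop u z w).
Proof.
rewrite !pvE -zsD //; apply: eq_zs => m.
by rewrite (linD _ _ (sf_lin sfY u m)) dualD mulrDl.
Qed.

Lemma pvDu (v' : graded_dual G) u1 u2 z v :
  pairing v' (vop (u1 + u2) z v) = pairing v' (vop u1 z v) + pairing v' (vop u2 z v).
Proof.
rewrite !pvE -zsD //; apply: eq_zs => m.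
by rewrite (Y_stateD sfY) dualD mulrDl.
Qed.

Lemma pvDd (v' w1 w2 : graded_dual G) u z v : (forall x, v' x = w1 x + w2 x) ->
  pairing v' (vop u z v) = pairing w1 (vop u z v) + pairing w2 (vop u z v).
Proof. by move=> h; rewrite !pvE -zsD //; apply: eq_zs => m; rewrite h mulrDl. Qed.

Lemma vopDv u z v w n : vop u z (v + w) n = vop u z v n + vop u z w n.
Proof. by have [_ h] := fld_hom z (gY u); rewrite /vertex_op -{1}[v]scale1r h scale1r. Qed.

Lemma vopDu u1 u2 z v n : z != 0 -> vop (u1 + u2) z v n = vop u1 z v n + vop u2 z v n.
Proof.
by move=> z0; have [_ h] := vertex_op_map sfY; rewrite -{1}[u1]scale1r h // scale1r.
Qed.

Section Homogeneous.
Context (d1 d2 e k : int) (u1 u2 v : V) (v' : graded_dual G).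
Hypothesis (h1 : homog G d1 u1) (h2 : homog G d2 u2) (hv : homog G e v).
Hypothesis hv' : forall x, v' x = v' (pi k x).

Let fld_at A d x c z m n : modes_lin A -> field_deg G d A -> homog G c x ->
  n = c + d - 2 * m - 2 -> fld G A z x n = z ^ (- m - 1) *: A m x.
Proof.
move=> Al Ad hx ->; rewrite /fld (zs_single (i0 := m)).
  by rewrite (Ad m _ _ hx).
by move=> m' mm; rewrite (homog_piN (Ad m' _ _ hx)) ?scaler0 //; apply: contra_neq mm; lia.
Qed.

Let fld_no A d x c z n : modes_lin A -> field_deg G d A -> homog G c x ->
  (forall m, n != c + d - 2 * m - 2) -> fld G A z x n = 0.
Proof.
by move=> Al Ad hx no; rewrite /fld zs0 // => m; rewrite (homog_piN (Ad m _ _ hx)) ?scaler0.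
Qed.

Let v'_homog n x : homog G n x -> n != k -> v' x = 0.
Proof. by move=> hx nk; rewrite hv' (homog_piN hx) ?dual0 // eq_sym. Qed.

Let pair_at u d x c z m : homog G d u -> homog G c x -> k = c + d - 2 * m - 2 ->
  pairing v' (vop u z x) = v' (Y u m x) * z ^ (- m - 1).
Proof.
move=> hu hx kE; rewrite pvE (zs_single (i0 := m)) // => m' mm.
rewrite (v'_homog (sf_deg sfY hu m' hx)) ?mul0r //.
by apply: contra_neq mm; lia.
Qed.

Let pair_no u d x c z : homog G d u -> homog G c x ->
  (forall m, k != c + d - 2 * m - 2) -> pairing v' (vop u z x) = 0.
Proof.
move=> hu hx no; rewrite pvE zs0 // => m.
by rewrite (v'_homog (sf_deg sfY hu m hx)) ?mul0r // eq_sym.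
Qed.

Let pair0 u z : pairing v' (vop u z 0) = 0.
Proof. by rewrite pvE zs0 // => m; rewrite (lin0 (sf_lin sfY u m)) dual0 mul0r. Qed.

Let pair00 z x : pairing v' (vop 0 z x) = 0.
Proof.
rewrite pvE zs0 // => m; have -> : Y 0 m x = 0.
  by have := Y_stateZ sfY 0 0 m x; rewrite !scale0r.
by rewrite dual0 mul0r.
Qed.

Let Yl1 := sf_lin sfY u1. Let Yl2 := sf_lin sfY u2.
Let Yd1 := sf_deg sfY h1. Let Yd2 := sf_deg sfY h2.

Let index (c d n : int) : (exists m, n = c + d - 2 * m - 2) \/ forall m, n != c + d - 2 * m - 2.
Proof.
have [h|h] := pselect (exists m, n = c + d - 2 * m - 2); first by left.
by right=> m; apply: contra_notN h => /eqP h; exists m.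
Qed.

Let pairZ (c : C) u z x : pairing v' (vop u z (c *: x)) = c * pairing v' (vop u z x).
Proof.
rewrite !pvE (zs_map (f := *%R c)) ?mulr0 //; last exact: mulrDr.
by apply: eq_zs => m; rewrite (linZ _ _ (sf_lin sfY u m)) dualZ mulrA.
Qed.

Let pairZu (c : C) u z x : pairing v' (vop (c *: u) z x) = c * pairing v' (vop u z x).
Proof.
rewrite !pvE (zs_map (f := *%R c)) ?mulr0 //; last exact: mulrDr.
by apply: eq_zs => m; rewrite (Y_stateZ sfY) dualZ mulrA.
Qed.

Let divz_exp (x y : C) p : x != 0 -> y != 0 -> (x / y) ^ p = x ^ p * y ^ (- p).
Proof. by move=> x0 y0; rewrite exprzMl ?unitfE ?invr_eq0 // exprz_inv. Qed.

Let divX_inv (x y : C) (N : nat) : ((x / y) ^+ N)^-1 = x ^ (- N%:Z) * y ^ N%:Z.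
Proof. by rewrite exprMn exprVn invfM invrK exprnN exprnP. Qed.

Let t1_at s m z1 z2 : k = e + d1 + d2 - 2 * s - 4 -> z1 != 0 -> z2 != 0 ->
  t1 u1 u2 v v' z1 z2 (e + d2 - 2 * (s - m) - 2) =
  z2 ^ (- s - 2) * (v' (Y u1 m (Y u2 (s - m) v)) * (z1 / z2) ^ (- m - 1)).
Proof.
move=> kE z10 z20; rewrite /t1 /vertex_op (fld_at z2 (m := s - m) Yl2 Yd2 hv) //.
rewrite -!/(vertex_op G Y _) pairZ (pair_at z1 (m := m) h1 (Yd2 _ hv)); last by lia.
rewrite divz_exp //.
have -> : z2 ^ (- (s - m) - 1) = z2 ^ (- s - 2) * z2 ^ (- (- m - 1)).
  by rewrite -expfzDr //; congr (_ ^ _); lia.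
move: (z2 ^ _) (z2 ^ _) (z1 ^ _) (v' _) => a b c d; ring.
Qed.

Let t2_at s m z1 z2 : k = e + d1 + d2 - 2 * s - 4 -> z1 != 0 -> z2 != 0 ->
  t2 u1 u2 v v' z1 z2 (e + d1 - 2 * m - 2) =
  z2 ^ (- s - 2) * (v' (Y u2 (s - m) (Y u1 m v)) * (z1 / z2) ^ (- m - 1)).
Proof.
move=> kE z10 z20; rewrite /t2 /vertex_op (fld_at z1 (m := m) Yl1 Yd1 hv) //.
rewrite -!/(vertex_op G Y _) pairZ (pair_at z2 (m := s - m) h2 (Yd1 _ hv)); last by lia.
rewrite divz_exp //.
have -> : z2 ^ (- (s - m) - 1) = z2 ^ (- s - 2) * z2 ^ (- (- m - 1)).
  by rewrite -expfzDr //; congr (_ ^ _); lia.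
move: (z2 ^ _) (z2 ^ _) (z1 ^ _) (v' _) => a b c d; ring.
Qed.

Let slice s w m := Y u1 m (Y u2 (s - m) w).

Let t3_at N s i z1 z2 : k = e + d1 + d2 - 2 * s - 4 -> z1 != z2 -> z2 != 0 ->
  local (super_sign d1 d2 : C) N (Y u1) (Y u2) ->
  t3 u1 u2 v v' z1 z2 (d2 + d1 - 2 * (N%:Z - 1 - i) - 2) =
  (z1 - z2) ^ (- N%:Z) * z2 ^ (N%:Z - s - 2) *
  (v' (taylor i (iter N (@dl _ V) (slice s v))) * ((z1 - z2) / z2) ^ i).
Proof.
move=> kE z12 z20 loc; pose j := N%:Z - 1 - i.
have x0 : z1 - z2 != 0 by rewrite subr_eq0.
rewrite /t3 {2}/vertex_op (fld_at (z1 - z2) (m := j) Yl1 Yd1 h2) //.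
rewrite pairZu (pair_at z2 (m := s - j) (@Yd1 j _ _ h2) hv); last by rewrite /j; lia.
rewrite (sf_prod sfY j h1 h2 loc) /nprod.
have -> : N%:Z - 1 - j = i by rewrite /j; lia.
have -> : j + (s - j) = s by lia.
rewrite -/(slice s v) divz_exp //.
have -> : (z1 - z2) ^ (- j - 1) = (z1 - z2) ^ (- N%:Z) * (z1 - z2) ^ i.
  by rewrite -expfzDr //; congr (_ ^ _); rewrite /j; lia.
have -> : z2 ^ (- (s - j) - 1) = z2 ^ (N%:Z - s - 2) * z2 ^ (- i).
  by rewrite -expfzDr //; congr (_ ^ _); rewrite /j; lia.
move: (z2 ^ _) (z2 ^ _) ((z1 - z2) ^ _) ((z1 - z2) ^ _) (v' _) => a b c d y; ring.
Qed.

Let dlN_dual N (h : int -> V) :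
  iter N (@sdl R) (fun m => v' (h m)) = fun m => v' (iter N (@dl _ V) h m).
Proof.
elim: N => // N IH; rewrite !iterS IH; apply/funext => m.
by rewrite /sdl /dl linearB.
Qed.

(** For homogeneous data a single total index s contributes, or none. With x =
    z1 / z2, the three series are, up to a power of z2, the expansions at
    infinity, at 0 and at 1 of the same rational function: the Laurent
    polynomial with coefficients f divided by (x - 1)^N. *)
Lemma dual_homog b : odd (absz d1) && odd (absz d2) = b ->
  dual_fam b (t1 u1 u2 v v') (t2 u1 u2 v v') (t3 u1 u2 v v').
Proof.
move=> bE; have sgE : super_sign d1 d2 = (-1) ^+ b :> C by rewrite /super_sign bE.
have [[s kE]|no] := pselect (exists s, k = e + d1 + d2 - 2 * s - 4); last first.
  have noE s : k != e + d1 + d2 - 2 * s - 4 by apply: contra_notN no => /eqP h; exists s.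
  apply: dual_fam0 => z1 z2 n z10 z20 z12; split.
  - rewrite /t1; have [[r ->]|nr] := index e d2 n; last first.
      by rewrite {2}/vertex_op (fld_no z2 Yl2 Yd2 hv nr) pair0.
    rewrite {2}/vertex_op (fld_at z2 (m := r) Yl2 Yd2 hv) // pairZ.
    rewrite (pair_no z1 h1 (@Yd2 r _ _ hv)) ?mulr0 // => m.
    by apply: contra_neq (noE (m + r)) => ->; lia.
  - rewrite /t2; have [[r ->]|nr] := index e d1 n; last first.
      by rewrite {2}/vertex_op (fld_no z1 Yl1 Yd1 hv nr) pair0.
    rewrite {2}/vertex_op (fld_at z1 (m := r) Yl1 Yd1 hv) // pairZ.
    rewrite (pair_no z2 h2 (@Yd1 r _ _ hv)) ?mulr0 // => m.
    by apply: contra_neq (noE (m + r)) => ->; lia.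
  - rewrite /t3; have [[r ->]|nr] := index d2 d1 n; last first.
      by rewrite {2}/vertex_op (fld_no (z1 - z2) Yl1 Yd1 h2 nr) pair00.
    rewrite {2}/vertex_op (fld_at (z1 - z2) (m := r) Yl1 Yd1 h2) // pairZu.
    rewrite (pair_no z2 (@Yd1 r _ _ h2) hv) ?mulr0 // => m.
    by apply: contra_neq (noE (m + r)) => ->; lia.
have [N loc] := sf_local sfY h1 h2.
have Y1t : trunc (Y u1) := deg_trunc (restricted_bounded hG) Yl1 Yd1.
have Y2t : trunc (Y u2) := deg_trunc (restricted_bounded hG) Yl2 Yd2.
pose f m := v' (iter N (@dl _ V) (slice s v) m).
have ff : fsupp (iter N (@dl _ V) (slice s v)) := local_fsupp s v Yl1 Yl2 Y1t Y2t loc.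
have [S hS] : fsupp f by apply: (fsupp_map (f := fun=> v') _ ff) => _; exact: dual0.
pose Sx (x : C) := zs (fun m => f m * x ^ (- m - 1)).
pose Phi z1 z2 := z2 ^ (- s - 2) * (Sx (z1 / z2) / (z1 / z2 - 1) ^+ N).
have hsumf (x : C) : hsum (fun m => f m * x ^ (- m - 1)) (Sx x).
  have fS m : m \notin S -> f m * x ^ (- m - 1) = 0 by move=> /hS ->; rewrite mul0r.
  by rewrite /Sx (zsE fS); exact: hsum_fin.
exists Phi; split.
  apply: (@lrat_ext R (fun z1 z2 => \sum_(m <- S) f m *
      (z1 ^ (- m - 1) * z2 ^ (m + 1 - s - 2 + N%:Z) * (z1 - z2) ^ (- N%:Z)))); last first.
    by apply: lrat_sum => m; apply: lratZ; exact: lrat_mono.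
  move=> z1 z2 z10 z20 z12; have x0 : z1 - z2 != 0 by rewrite subr_eq0.
  rewrite /Phi /Sx (zsE (A := S)) => [|m /hS ->]; last by rewrite mul0r.
  have -> : z1 / z2 - 1 = (z1 - z2) / z2 by field.
  rewrite divX_inv mulr_suml mulr_sumr.
  apply: eq_bigr => m _; rewrite divz_exp //.
  have -> : z2 ^ (m + 1 - s - 2 + N%:Z) = z2 ^ (- s - 2) * z2 ^ (- (- m - 1)) * z2 ^ N%:Z.
    by rewrite -!expfzDr //; congr (_ ^ _); lia.
  move: (z2 ^ _) (z2 ^ _) (z2 ^ _) (z1 ^ _) ((z1 - z2) ^ _) (f m) => a b' c d y t; ring.
move=> z1 z2; split; [|split] => hz.
- have [z10 z20 z12] := regions (Or31 _ _ hz); have /andP[_ h12] := hz.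
  have inj : injective (fun m : int => e + d2 - 2 * (s - m) - 2) by move=> m m'; lia.
  have z0 j : (forall i, e + d2 - 2 * (s - i) - 2 != j) -> t1 u1 u2 v v' z1 z2 j = 0.
    move=> hj; rewrite /t1 {2}/vertex_op (fld_no z2 Yl2 Yd2 hv) ?pair0 // => m.
    by rewrite eq_sym; have := hj (s - m); rewrite subKr.
  apply/(hsum_inj inj _ z0).
  have [n0 low] := prod_lowz s v Yl1 Y2t.
  have low' m : m < n0 -> v' (slice s v m) = 0.
    by move=> hm; rewrite /slice low ?dual0.
  have x1 : 1 < nm (z1 / z2).
    by rewrite nmM nmV ltr_pdivlMr ?mul1r // nm_gt0.
  have H := hsum_out (N := N) x1 low'.
  rewrite dlN_dual in H.
  by apply: hsum_ext (hsumZ _ (H _ (hsumf _))) => m; rewrite t1_at.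
- have [z10 z20 z12] := regions (Or32 _ _ hz); have /andP[_ h12] := hz.
  have inj : injective (fun m : int => e + d1 - 2 * m - 2) by move=> m m'; lia.
  have z0 j : (forall i, e + d1 - 2 * i - 2 != j) ->
      (-1) ^+ b * t2 u1 u2 v v' z1 z2 j = 0.
    move=> hj; rewrite /t2 {2}/vertex_op (fld_no z1 Yl1 Yd1 hv) ?pair0 ?mulr0 // => m.
    by rewrite eq_sym.
  apply/(hsum_inj inj _ z0).
  have [n0 high] := prod_highz s v Yl2 Y1t.
  have high' m : n0 < m -> v' (super_sign d1 d2 *: Y u2 (s - m) (Y u1 m v)) = 0.
    by move=> hm; rewrite high ?scaler0 ?dual0.
  have x1 : 0 < nm (z1 / z2) < 1.
    rewrite nm_gt0 mulf_neq0 ?invr_eq0 //=.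
    by rewrite nmM nmV ltr_pdivrMr ?mul1r // nm_gt0.
  have H := hsum_in (N := N) x1 high'.
  rewrite dlN_dual -loc in H.
  apply: hsum_ext (hsumZ _ (H _ (hsumf _))) => m; rewrite (@t2_at s m z1 z2 kE z10 z20) dualZ sgE.
  by rewrite -[in LHS]mulrA mulrCA.
- have [z10 z20 z12] := regions (Or33 _ _ hz); have /andP[_ h12] := hz.
  have x0 : z1 - z2 != 0 by rewrite subr_eq0.
  have inj : injective (fun i : int => d2 + d1 - 2 * (N%:Z - 1 - i) - 2) by move=> m m'; lia.
  have z0 j : (forall i, d2 + d1 - 2 * (N%:Z - 1 - i) - 2 != j) -> t3 u1 u2 v v' z1 z2 j = 0.
    move=> hj; rewrite /t3 {2}/vertex_op (fld_no (z1 - z2) Yl1 Yd1 h2) ?pair00 // => m.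
    by rewrite eq_sym; have := hj (N%:Z - 1 - m); rewrite subKr.
  apply/(hsum_inj inj _ z0).
  have x1 : nm ((z1 - z2) / z2) < 1.
    by rewrite nmM nmV ltr_pdivrMr ?mul1r // nm_gt0.
  have fsf : fsupp f by exists S.
  have := hsumZ ((z1 - z2) ^ (- N%:Z) * z2 ^ (N%:Z - s - 2)) (hsum_taylor fsf x1).
  have -> : 1 + (z1 - z2) / z2 = z1 / z2 by field.
  have -> : (z1 - z2) ^ (- N%:Z) * z2 ^ (N%:Z - s - 2) * Sx (z1 / z2) = Phi z1 z2.
    rewrite /Phi; have -> : z1 / z2 - 1 = (z1 - z2) / z2 by field.
    rewrite divX_inv.
    have -> : z2 ^ (N%:Z - s - 2) = z2 ^ (- s - 2) * z2 ^ N%:Z.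
      by rewrite -expfzDr //; congr (_ ^ _); lia.
    move: (z2 ^ _) (z2 ^ _) ((z1 - z2) ^ _) (Sx _) => a b' c d; ring.
  apply: hsum_ext => i; rewrite (@t3_at N s i z1 z2 kE z12 z20 loc); congr (_ * (_ * _)).
  case: i => i; last by rewrite /taylor dual0 zs0 // => m; rewrite mul0r.
  rewrite /taylor dual_zs; last exact: fsupp_gbin.
  by apply: eq_zs => m; rewrite dualZ.
Qed.

End Homogeneous.

Lemma par_ind (p : bool) (P : V -> Prop) :
  (forall d u, homog G d u -> odd (absz d) = p -> P u) ->
  (forall u v, P u -> P v -> P (u + v)) -> forall u, parity_part G p u -> P u.
Proof.
move=> Ph PD u hu; rewrite (pi_sum G u); have [S hS] := pi_fsupp G u.
have P0 : P 0 by apply: (Ph (p : nat)); [exact: homog0 | case: (p)].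
rewrite (zsE hS); elim: (S : seq int) => [|n r IH]; first by rewrite big_nil.
rewrite big_cons; apply: PD => //.
have [np|np] := eqVneq (odd (absz n)) p; first exact: Ph (homog_pi G n u) np.
by rewrite hu.
Qed.

Lemma vertex_op_duality : duality G vop.
Proof.
move=> p1 p2 u1 u2 v v' hp1 hp2.
have key : dual_fam (p1 && p2) (t1 u1 u2 v v') (t2 u1 u2 v v') (t3 u1 u2 v v').
  move: u1 hp1 u2 hp2.
  apply: par_ind => [d1 u1 h1 o1|u1 w1 IH1 IH2 u2 hu2]; last first.
    apply: dual_famD (IH1 u2 hu2) (IH2 u2 hu2) => z1 z2 n z10 z20 z12.
    split; rewrite /t1 /t2 /t3; first exact: pvDu.
      by rewrite vopDu // pvDv.
    by rewrite vopDu ?subr_eq0 // pvDu.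
  apply: par_ind => [d2 u2 h2 o2|u2 w2 IH1 IH2]; last first.
    apply: dual_famD IH1 IH2 => z1 z2 n z10 z20 z12.
    split; rewrite /t1 /t2 /t3; last by rewrite vopDv pvDu.
      by rewrite vopDu // pvDv.
    exact: pvDu.
  move: v; apply: (homog_ind (G := G)) => [e v hv|v w IH1 IH2]; last first.
    apply: dual_famD IH1 IH2 => z1 z2 n z10 z20 z12.
    by split; rewrite /t1 /t2 /t3 ?vopDv pvDv.
  have [S [_ hS]] := dual_support v'.
  suff H (r : seq int) (w' : graded_dual G) : (forall x, w' x = \sum_(n <- r) v' (pi n x)) ->
      dual_fam (p1 && p2) (t1 u1 u2 v w') (t2 u1 u2 v w') (t3 u1 u2 v w') by exact: H hS.
  elim: r w' => [|k r IH] w' hw.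
    apply: dual_fam0 => z1 z2 n _ _ _.
    by split; rewrite /t1 /t2 /t3 pvE zs0 // => m; rewrite hw big_nil mul0r.
  have [wk hk] := dual_pi v' k.
  have [wr hr] : exists wr : graded_dual G, forall x, wr x = \sum_(n <- r) v' (pi n x).
    have wl : scalar_lin (fun x => w' x - v' (pi k x)).
      by move=> x a b; rewrite (pi_lin G k) !dual_lin; ring.
    have [N hN] := gd_finite w'; have [M hM] := gd_finite v'.
    have [|wr hr] := @mk_dual _ _ G _ wl.
      exists (maxn N M) => n x; rewrite gtn_max => /andP[hn hm] hx.
      rewrite (hN n x hn hx) sub0r.
      have [->|kn] := eqVneq k n; first by rewrite hx (hM n x hm hx) oppr0.
      by rewrite (homog_piN hx kn) dual0 oppr0.
    by exists wr => x; rewrite hr hw big_cons addrC addKr.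
  have hk' x : wk x = wk (pi k x) by rewrite !hk graded_projK eqxx.
  have wE x : w' x = wk x + wr x by rewrite hw big_cons hk hr.
  have b12 : odd (absz d1) && odd (absz d2) = p1 && p2 by rewrite o1 o2.
  apply: dual_famD (dual_homog h1 h2 hv hk' b12) (IH wr hr) => z1 z2 n z10 z20 z12.
  by split; rewrite /t1 /t2 /t3; exact: pvDd.
have [Phi [rP hP]] := key; have [F [rF hF]] := lrat_rational rP.
exists F; split=> // z1 z2; have [k1 [k2 k3]] := hP z1 z2.
have n0 (z : C) : (0 < `|z|) = (0 < nm z) by rewrite normr_gt0 nm_gt0.
rewrite !n0 !nm_lt; split; [|split] => hz; apply/abs_convP.
- by have [z10 z20 z12] := regions (Or31 _ _ hz); rewrite hF //; exact: k1.
- by have [z10 z20 z12] := regions (Or32 _ _ hz); rewrite hF //; exact: k2.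
- by have [z10 z20 z12] := regions (Or33 _ _ hz); rewrite hF //; exact: k3.
Qed.

End Duality.

(** * Arrays of coefficients in several variables *)
Section Arrays.
Context {R : realType} (k : nat).
Local Notation C := (Cplx R).
Implicit Types (f g : k.-tuple int -> C) (n : k.-tuple int) (x z : k.-tuple C)
  (i j l : 'I_k) (c : 'I_k -> C).

Definition upd n j (p : int) : k.-tuple int :=
  [tuple (if i == j then p else tnth n i) | i < k].

Lemma tnth_upd n j p i : tnth (upd n j p) i = if i == j then p else tnth n i.
Proof. by rewrite tnth_mktuple. Qed.

Lemma upd_upd n j p q : upd (upd n j p) j q = upd n j q.
Proof. by apply: eq_from_tnth => i; rewrite !tnth_upd; case: eqP. Qed.

Lemma upd_id n j : upd n j (tnth n j) = n.
Proof. by apply: eq_from_tnth => i; rewrite !tnth_upd; case: eqP => // ->. Qed.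

Lemma updC n i j p q : i != j -> upd (upd n i p) j q = upd (upd n j q) i p.
Proof.
move=> ij; apply: eq_from_tnth => l; rewrite !tnth_upd.
by case: (eqVneq l j) => [->|//]; rewrite eq_sym (negbTE ij).
Qed.

Definition sh j n := upd n j (tnth n j + 1).
Definition sh' j n := upd n j (tnth n j - 1).

Lemma shK j : cancel (sh j) (sh' j).
Proof. by move=> n; rewrite /sh' /sh upd_upd tnth_upd eqxx addrK upd_id. Qed.
Lemma shK' j : cancel (sh' j) (sh j).
Proof. by move=> n; rewrite /sh' /sh upd_upd tnth_upd eqxx subrK upd_id. Qed.

Lemma shC i j n : sh i (sh j n) = sh j (sh i n).
Proof.
have [->//|ij] := eqVneq i j.
by rewrite /sh !tnth_upd [j == i]eq_sym (negbTE ij) updC // eq_sym.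
Qed.

Lemma mono_sh z j n : tnth z j != 0 -> mono z n = tnth z j * mono z (sh j n).
Proof.
move=> z0; rewrite /mono (bigD1 j) //= [in RHS](bigD1 j) //= mulrA; congr (_ * _).
  rewrite tnth_upd eqxx.
  have -> : - tnth n j - 1 = 1 + (- (tnth n j + 1) - 1) by lia.
  by rewrite expfzDr // expr1z.
by apply: eq_bigr => i ij; rewrite tnth_upd (negbTE ij).
Qed.

Lemma hsum_shift f z j s : (forall j, tnth z j != 0) ->
  hsum (fun n => f n * mono z n) s ->
  hsum (fun n => f (sh j n) * mono z n) (tnth z j * s).
Proof.
move=> z0 hs.
have surj n : (forall n', sh j n' != n) -> f n * mono z n = 0.
  by move=> /(_ (sh' j n)); rewrite shK' eqxx.
have := hsumZ (tnth z j) ((hsum_inj (can_inj (shK j)) s surj).1 hs).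
by apply: hsum_ext => n; rewrite (mono_sh n (z0 j)) mulrCA.
Qed.

(** The linear factors of the denominators: [inl j] stands for z_j and [inr (j,
    l)] for z_j - z_l. Arrays are expansions in the variables x_j = z_j - c_j,
    so that these factors act as x_j + c_j and (x_j + c_j) - (x_l + c_l). *)
Definition lfactor : Type := 'I_k + 'I_k * 'I_k.

Definition app c (phi : lfactor) f : k.-tuple int -> C := fun n =>
  match phi with
  | inl j => f (sh j n) + c j * f n
  | inr (j, l) => f (sh j n) - f (sh l n) + (c j - c l) * f n
  end.

Definition fval c (phi : lfactor) x : C :=
  match phi with
  | inl j => tnth x j + c j
  | inr (j, l) => (tnth x j + c j) - (tnth x l + c l)
  end.

Definition appl c (r : seq lfactor) f := foldr (app c) f r.

Lemma hsum_app c phi f x s : (forall j, tnth x j != 0) ->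
  hsum (fun n => f n * mono x n) s ->
  hsum (fun n => app c phi f n * mono x n) (fval c phi x * s).
Proof.
move=> x0 hs; case: phi => [j|[j l]] /=.
  rewrite mulrDl; apply: hsum_ext (hsumD (hsum_shift j x0 hs) (hsumZ (c j) hs)) => n.
  by rewrite mulrDl mulrA.
have -> : (tnth x j + c j - (tnth x l + c l)) * s =
    tnth x j * s - tnth x l * s + (c j - c l) * s by ring.
apply: hsum_ext (hsumD (hsumB (hsum_shift j x0 hs) (hsum_shift l x0 hs))
  (hsumZ (c j - c l) hs)) => n.
by move: (mono x n) (f _) (f _) (f _) (c j) (c l) => *; ring.
Qed.

Lemma hsum_appl c r f x s : (forall j, tnth x j != 0) ->
  hsum (fun n => f n * mono x n) s ->
  hsum (fun n => appl c r f n * mono x n) ((\prod_(phi <- r) fval c phi x) * s).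
Proof.
move=> x0 hs; elim: r => [|phi r IH]; first by rewrite big_nil mul1r.
by rewrite big_cons -mulrA; exact: hsum_app.
Qed.

(** The support condition satisfied by products of modes: given the indices to
    the right of n_l, only finitely many positive n_l contribute. *)
Definition truncated f := forall l n, exists B : int, forall n',
  (forall i, (l < i)%N -> tnth n' i = tnth n i) -> B < tnth n' l -> f n' = 0.

Lemma truncated_shift f j : truncated f -> truncated (fun n => f (sh j n)).
Proof.
move=> ft l n; have [B hB] := ft l (sh j n); exists B => n' hn hl; apply: hB.
  by move=> i li; rewrite !tnth_upd; case: eqP => [<-|_]; rewrite hn.
by rewrite tnth_upd; case: eqP => [<-|//]; lia.
Qed.

Lemma truncatedD f g : truncated f -> truncated g -> truncated (fun n => f n + g n).
Proof.
move=> ft gt l n; have [B hB] := ft l n; have [B' hB'] := gt l n.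
exists (Num.max B B') => n' hn; rewrite gt_max => /andP[h h'].
by rewrite hB // hB' // addr0.
Qed.

Lemma truncatedZ f (a : C) : truncated f -> truncated (fun n => a * f n).
Proof.
by move=> ft l n; have [B hB] := ft l n; exists B => n' hn h; rewrite hB // mulr0.
Qed.

Lemma truncated_app c phi f : truncated f -> truncated (app c phi f).
Proof.
move=> ft; case: phi => [j|[j l]] /=.
  exact: truncatedD (truncated_shift j ft) (truncatedZ (c j) ft).
apply: truncatedD; last exact: truncatedZ.
apply: truncatedD; first exact: truncated_shift.
have := truncatedZ (-1) (truncated_shift l ft).
by move=> h l' n; have [B hB] := h l' n; exists B => n' h1 h2; rewrite -mulN1r hB.
Qed.

Lemma truncated_appl c r f : truncated f -> truncated (appl c r f).
Proof. by move=> ft; elim: r => //= phi r IH; exact: truncated_app. Qed.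

Definition ordered_factor (phi : lfactor) : bool :=
  match phi with inl _ => true | inr (j, l) => (j < l)%N end.

(** In the region |zeta| > |x_1| > ... > |x_k| > 0 the factors x_j + zeta and
    x_j - x_l, for j < l, have a dominant term and are inverted by a geometric
    series; truncation of f makes it vanish along the orbits of the
    corresponding shifts of indices. *)
Lemma hsum_unapp (zeta : C) phi f x s : radially_ordered x ->
  (forall j, nm (tnth x j) < nm zeta) -> ordered_factor phi -> truncated f ->
  hsum (fun n => app (fun=> zeta) phi f n * mono x n) s ->
  hsum (fun n => f n * mono x n) (s / fval (fun=> zeta) phi x).
Proof.
move=> xo xz op ft hs; have x0 := radial_neq0 xo.
pose F n := f n * mono x n.
have FE j n : f (sh j n) * mono x n = tnth x j * F (sh j n).
  by rewrite /F mulrCA -mono_sh.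
case: phi op hs => [j _|[j l] /= jl] /=.
  have z0 : zeta != 0 by rewrite -nm_gt0; apply: le_lt_trans (xz j); exact: nm_ge0.
  have y0 : tnth x j + zeta != 0.
    rewrite addr_eq0; apply: contraTneq (xz j) => ->.
    by rewrite nmN ltxx.
  move=> /(hsumZ zeta^-1) hs.
  have -> : s / (tnth x j + zeta) = zeta^-1 * s / (1 - - (tnth x j / zeta)).
    by field; rewrite z0 opprK addrC y0.
  apply: (hsum_div (shK j) (shK' j)).
  - by rewrite nmN nmM nmV ltr_pdivrMr ?mul1r // nm_gt0.
  - move=> n; have [B hB] := ft j n.
    exists (absz (B - tnth n j)%R).+1 => t ht; rewrite /F hB ?mul0r //.
      move=> i ji; elim: t {ht} => //= t <-.
      by rewrite tnth_upd ifN //; apply: contraTneq ji => ->; rewrite ltnn.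
    have -> : tnth (iter t (sh j) n) j = tnth n j + t%:Z.
      by elim: t {ht} => /= [|t IH]; rewrite ?addr0 // tnth_upd eqxx IH; lia.
    by lia.
  - apply: hsum_ext hs => n; rewrite mulrDl FE /F; field.
    exact: z0.
move=> hs; have xj0 := x0 j.
have xjl : nm (tnth x l) < nm (tnth x j) by rewrite -nm_lt; exact: xo.2.
have y0 : tnth x j - tnth x l != 0.
  by rewrite subr_eq0; apply: contraTneq xjl => ->; rewrite ltxx.
have -> : s / (tnth x j + zeta - (tnth x l + zeta)) =
    (tnth x j)^-1 * s / (1 - tnth x l / tnth x j).
  by field; rewrite xj0.
(* Multiplication of the series by x_l / x_j is a translation of the indices by
   tau. *)
pose tau n := sh l (sh' j n); pose sigma n := sh j (sh' l n).
have jl' : j != l by apply: contraTneq jl => ->; rewrite ltnn.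
apply: (@hsum_div R _ tau sigma (fun n => f n * mono x n) (tnth x l / tnth x j)).
- by move=> n; rewrite /tau /sigma shK shK'.
- by move=> n; rewrite /tau /sigma shK shK'.
- by rewrite nmM nmV ltr_pdivrMr ?mul1r // nm_gt0.
- move=> n; have [B hB] := ft l n.
  have step m i : tnth (tau m) i = if i == l then tnth m l + 1 else
      if i == j then tnth m j - 1 else tnth m i.
    rewrite !tnth_upd; case: eqP => // _.
    by rewrite eq_sym (negbTE jl').
  exists (absz (B - tnth n l)%R).+1 => t ht; rewrite hB ?mul0r //.
    move=> i li; elim: t {ht} => //= t <-; rewrite step.
    rewrite ifN; last by apply: contraTneq li => ->; rewrite ltnn.
    by rewrite ifN //; apply: contraTneq li => ->; rewrite -leqNgt ltnW.
  have -> : tnth (iter t tau n) l = tnth n l + t%:Z.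
    by elim: t {ht} => /= [|t IH]; rewrite ?addr0 // step eqxx IH; lia.
  by lia.
- have surj n : (forall m, sh' j m != n) ->
      app (fun=> zeta) (inr (j, l)) f n * mono x n = 0.
    by move=> /(_ (sh j n)); rewrite shK eqxx.
  have h2 := (hsum_inj (can_inj (shK' j)) s surj).1 hs.
  apply: hsum_ext (hsumZ (tnth x j)^-1 h2) => n /=.
  rewrite subrr mul0r addr0 shK' mulrBl !FE -!/(F _).
  have -> : f n * mono x (sh' j n) = tnth x j * F n.
    by rewrite -[in f n](shK' j n) FE shK'.
  by rewrite /tau; field.
Qed.

Lemma hsum_unappl (zeta : C) r f x s : radially_ordered x ->
  (forall j, nm (tnth x j) < nm zeta) -> all ordered_factor r -> truncated f ->
  hsum (fun n => appl (fun=> zeta) r f n * mono x n) s ->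
  hsum (fun n => f n * mono x n) (s / \prod_(phi <- r) fval (fun=> zeta) phi x).
Proof.
move=> xo xz; elim: r s => [|phi r IH] s /=; first by rewrite big_nil divr1.
move=> /andP[op ar] ft hs; rewrite big_cons invfM mulrA.
by apply: IH => //; apply: hsum_unapp => //; exact: truncated_appl.
Qed.

(** The coefficient of x ^ (- p - 1) in (x + a) ^ al. *)
Definition tcoef (a : C) (al : nat) (p : int) : C :=
  if - p - 1 is Posz i then 'C(al, i)%:R * a ^+ (al - i) else 0.

Lemma tcoef_fin (a y : C) (al : nat) :
  hsum (fun p => tcoef a al p * y ^ (- p - 1)) ((y + a) ^+ al).
Proof.
rewrite addrC exprDn.
have E : \sum_(i < al.+1) a ^+ (al - i) * y ^+ i *+ 'C(al, i) =
    \sum_(p <- [fset (- (t%:Z) - 1)%R | t in iota 0 al.+1]%fset)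
       tcoef a al p * y ^ (- p - 1).
  rewrite big_imfset /=; last by move=> t u _ _ h; lia.
  rewrite -(big_mkord predT (fun t => a ^+ (al - t) * y ^+ t *+ 'C(al, t))).
  rewrite /index_iota subn0 [in RHS]ifN ?mem_iota // undup_id ?iota_uniq //.
  apply: eq_bigr => t _; rewrite /tcoef.
  have -> : - (- (t%:Z) - 1) - 1 = t :> int by lia.
  by rewrite -exprnP -mulr_natl mulrA.
rewrite E; apply: hsum_fin => p pN; rewrite /tcoef.
case Ep : (- p - 1) => [t|t]; last by rewrite mul0r.
case: (ltnP al t) => hi; first by rewrite bin_small // !mul0r.
case/negP: pN; apply/imfsetP; exists t; last by lia.
by rewrite mem_iota add0n ltnS.
Qed.

(** The array of the polynomial P(x_1 + c_1, ..., x_k + c_k). *)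
Definition arrP c (P : mpoly.mpoly k C) n : C :=
  \sum_(m <- mpoly.msupp P) mpoly.mcoeff m P * \prod_(j < k) tcoef (c j) (m j) (tnth n j).

Lemma hsum_arrP c P x :
  hsum (fun n => arrP c P n * mono x n) (mpoly.meval (fun j => tnth x j + c j) P).
Proof.
rewrite mpoly.mevalE.
apply: (hsum_ext (a := fun n => \sum_(m <- mpoly.msupp P) mpoly.mcoeff m P *
   \prod_(j < k) (tcoef (c j) (m j) (tnth n j) * tnth x j ^ (- tnth n j - 1)))).
  move=> n; rewrite /arrP mulr_suml; apply: eq_bigr => m _.
  by rewrite -mulrA -big_split.
apply: hsum_sum => m _; apply: hsumZ.
exact: (hsum_prod (fun j => tcoef_fin (c j) (tnth x j) (m j))).
Qed.

Definition facs (a : 'I_k -> nat) (b : 'I_k -> 'I_k -> nat) : seq lfactor :=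
  flatten [seq nseq (a j) (inl j) | j <- enum 'I_k] ++
  flatten [seq flatten [seq nseq (b j l) (inr (j, l)) | l <- enum 'I_k & (j < l)%N]
          | j <- enum 'I_k].

Lemma facs_ordered a b : all ordered_factor (facs a b).
Proof.
apply/allP => phi; rewrite mem_cat => /orP[] /flattenP[r /mapP[j _ ->]].
  by move=> /nseqP[-> _].
move=> /flattenP[r' /mapP[l]]; rewrite mem_filter => /andP[jl _] ->.
by move=> /nseqP[-> _].
Qed.

Lemma facs_prod a b c x : \prod_(phi <- facs a b) fval c phi x =
  (\prod_(j < k) (tnth x j + c j) ^+ a j) *
  \prod_(j < k) \prod_(l < k | (j < l)%N) ((tnth x j + c j) - (tnth x l + c l)) ^+ b j l.
Proof.
have nseqE (m : nat) phi : \prod_(psi <- nseq m phi) fval c psi x = fval c phi x ^+ m.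
  by rewrite big_nseq iter_mulr_1.
rewrite big_cat; congr (_ * _).
  by rewrite big_flatten big_map big_enum; apply: eq_bigr => j _; rewrite nseqE.
rewrite big_flatten big_map big_enum; apply: eq_bigr => j _.
rewrite big_flatten big_map big_filter big_enum_cond; apply: eq_bigr => l _.
by rewrite nseqE.
Qed.

Lemma rat_evalE a b P x : rat_eval a b P x =
  mpoly.meval (tnth x) P / \prod_(phi <- facs a b) fval (fun=> 0) phi x.
Proof.
rewrite /rat_eval facs_prod; congr (_ / (_ * _)).
  by apply: eq_bigr => j _; rewrite addr0.
by apply: eq_bigr => j _; apply: eq_bigr => l _; rewrite !addr0.
Qed.

Definition generic_point x := (forall j, tnth x j != 0) /\
  forall j l, (j < l)%N -> tnth x j != tnth x l.

Lemma radial_generic x : radially_ordered x -> generic_point x.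
Proof.
move=> xo; split=> [j|j l jl]; first exact: radial_neq0.
by apply: contraTneq (xo.2 _ _ jl) => ->; rewrite ltxx.
Qed.

Lemma facs_neq0 a b x : generic_point x -> \prod_(phi <- facs a b) fval (fun=> 0) phi x != 0.
Proof.
move=> [x0 xd]; rewrite facs_prod mulf_neq0 //.
  by apply/prodf_neq0 => j _; rewrite addr0 expf_neq0.
apply/prodf_neq0 => j _; apply/prodf_neq0 => l jl.
by rewrite !addr0 expf_neq0 // subr_eq0; exact: xd.
Qed.

Lemma arrP0_sum P x : hsum (fun n => arrP (fun=> 0) P n * mono x n) (mpoly.meval (tnth x) P).
Proof.
have := hsum_arrP (fun=> 0) P x; congr hsum.
by apply: mpoly.meval_eq => j; rewrite addr0.
Qed.

Lemma radial_unique f g :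
  (forall x, radially_ordered x -> exists s,
     hsum (fun n => f n * mono x n) s /\ hsum (fun n => g n * mono x n) s) -> f = g.
Proof.
move=> h; apply/funext => n; apply/eqP; rewrite -subr_eq0; apply/eqP.
have [x0 [xo _]] := @radial_exists R k 1 ltr01.
apply: (@multi_unique R k (@radially_ordered R k) (fun n => f n - g n) x0) => //.
- by move=> x xr j; exact: radial_neq0.
- move=> x j zeta xr z1.
  have E (i : 'I_k) : nm (tnth (turn x j zeta) i) = nm (tnth x i).
    by rewrite tnth_mktuple; case: eqP => // _; rewrite nmM z1 mul1r.
  split=> [i|i l il]; first by rewrite normr_gt0 -nm_gt0 E nm_gt0; exact: radial_neq0.
  by rewrite nm_lt !E -nm_lt; exact: xr.2.
- move=> x xr; have [s [hf hg]] := h x xr.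
  by rewrite -(subrr s); apply: hsum_ext (hsumB hf hg) => m; rewrite mulrBl.
Qed.

(** Both sides converge to the numerator on the region of radially ordered
    points, and convergent expansions there are unique. From here on,
    convergence is an identity between arrays. *)
Lemma formal_of_converges f a b P :
  (forall x, radially_ordered x -> hsum (fun n => f n * mono x n) (rat_eval a b P x)) ->
  appl (fun=> 0) (facs a b) f = arrP (fun=> 0) P.
Proof.
move=> h; apply: radial_unique => x xr; exists (mpoly.meval (tnth x) P); split.
  have := hsum_appl (fun=> 0) (facs a b) (radial_neq0 xr) (h x xr).
  rewrite rat_evalE mulrC divfK //; apply: facs_neq0; exact: radial_generic.
exact: arrP0_sum.
Qed.

(** After clearing denominators both sides are polynomials, whose coefficients
    are determined by their values on the region of radially ordered points. *)
Lemma rat_unique a b P a' b' P' :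
  (forall x, radially_ordered x -> rat_eval a b P x = rat_eval a' b' P' x) ->
  forall x, generic_point x -> rat_eval a b P x = rat_eval a' b' P' x.
Proof.
move=> h x xg.
pose X := appl (fun=> 0) (facs a' b') (arrP (fun=> 0) P).
pose X' := appl (fun=> 0) (facs a b) (arrP (fun=> 0) P').
have hX y : (forall j, tnth y j != 0) -> hsum (fun n => X n * mono y n)
    ((\prod_(phi <- facs a' b') fval (fun=> 0) phi y) * mpoly.meval (tnth y) P).
  by move=> y0; apply: hsum_appl => //; exact: arrP0_sum.
have hX' y : (forall j, tnth y j != 0) -> hsum (fun n => X' n * mono y n)
    ((\prod_(phi <- facs a b) fval (fun=> 0) phi y) * mpoly.meval (tnth y) P').
  by move=> y0; apply: hsum_appl => //; exact: arrP0_sum.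
have XX : X = X'.
  apply: radial_unique => y yr; have yg := radial_generic yr.
  have y0 := radial_neq0 yr; eexists; split; first exact: hX.
  have := hX' y y0; congr hsum; have := h y yr; rewrite !rat_evalE.
  move: (facs_neq0 a b yg) (facs_neq0 a' b' yg).
  move: (\prod_(phi <- _) _) (\prod_(phi <- _) _) => d d' d0 d0'.
  by move/eqP; rewrite eqr_div // => /eqP; rewrite mulrC => e; rewrite mulrC -e mulrC.
have := hsum_unique (hX x xg.1) _; rewrite XX => /(_ _ (hX' x xg.1)).
rewrite !rat_evalE; move: (facs_neq0 a b xg) (facs_neq0 a' b' xg).
move: (\prod_(phi <- _) _) (\prod_(phi <- _) _) => d d' d0 d0' e.
by apply/eqP; rewrite eqr_div // mulrC e mulrC.
Qed.

End Arrays.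

(** * Locality from two expansions *)
Section FactorAlgebra.
Context {R : realType} (k : nat).
Local Notation C := (Cplx R).
Implicit Types (f g : k.-tuple int -> C) (n : k.-tuple int) (phi psi : lfactor k)
  (c : 'I_k -> C).

Lemma app_comb c phi (x : C) f g :
  app c phi (fun n => f n - x * g n) = fun n => app c phi f n - x * app c phi g n.
Proof.
apply/funext => n; case: phi => [j|[j l]] /=; first by ring.
by move: (f _) (f _) (f _) (g _) (g _) (g _) (c j) (c l) => *; ring.
Qed.

Lemma appl_comb c r (x : C) f g :
  appl c r (fun n => f n - x * g n) = fun n => appl c r f n - x * appl c r g n.
Proof. by elim: r => //= phi r ->; exact: app_comb. Qed.

Lemma app_comm c phi psi f : app c phi (app c psi f) = app c psi (app c phi f).
Proof.
apply/funext => n; case: phi => [j|[j l]]; case: psi => [p|[p q]] /=;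
  rewrite ?(shC p j) ?(shC q j) ?(shC p l) ?(shC q l); by ring.
Qed.

Lemma app_appl c phi r f : app c phi (appl c r f) = appl c r (app c phi f).
Proof. by elim: r => //= psi r <-; exact: app_comm. Qed.

Lemma appl_cat c r r' f : appl c (r ++ r') f = appl c r (appl c r' f).
Proof. exact: foldr_cat. Qed.

Lemma appl_comm c r r' f : appl c r (appl c r' f) = appl c r' (appl c r f).
Proof. by elim: r => //= phi r ->; exact: app_appl. Qed.

End FactorAlgebra.

Section TwoVariables.
Context {R : realType}.
Local Notation C := (Cplx R).
Local Notation o0 := (ord0 : 'I_2).
Local Notation o1 := (ord_max : 'I_2).
Implicit Types (f g : 2.-tuple int -> C) (n : 2.-tuple int).

Definition swap {X : Type} (x : 2.-tuple X) : 2.-tuple X :=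
  [tuple tnth x o1; tnth x o0].

Definition flip (i : 'I_2) : 'I_2 := if i == o0 then o1 else o0.

Lemma tuple2E X (x : 2.-tuple X) : x = [tuple tnth x o0; tnth x o1].
Proof.
case/tupleP: x => a x; case/tupleP: x => b x; rewrite (tuple0 x).
by apply: val_inj => /=; rewrite !(tnth_nth a).
Qed.

Lemma tnth_swap X (x : 2.-tuple X) i : tnth (swap x) i = tnth x (flip i).
Proof.
by rewrite /flip; case: i => [[|[|i]] hi] //; rewrite (tnth_nth (tnth x o0)).
Qed.

Lemma flipK : involutive flip.
Proof. by case=> [[|[|i]] hi] //; apply: val_inj. Qed.

Lemma swapK X : involutive (@swap X).
Proof. by move=> x; apply: eq_from_tnth => i; rewrite !tnth_swap flipK. Qed.

Definition fflip (phi : lfactor 2) : lfactor 2 :=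
  match phi with inl j => inl (flip j) | inr (j, l) => inr (flip j, flip l) end.

Lemma swap_sh j n : swap (sh j n) = sh (flip j) (swap n).
Proof.
apply: eq_from_tnth => i; rewrite tnth_swap !tnth_upd !tnth_swap flipK.
by rewrite -(can_eq flipK (flip i)) flipK.
Qed.

Lemma app_swap phi f :
  app (fun=> 0) (fflip phi) (fun n => f (swap n)) = fun n => app (fun=> 0) phi f (swap n).
Proof. by apply/funext => n; case: phi => [j|[j l]] /=; rewrite !swap_sh !flipK. Qed.

Lemma appl_swap r f : appl (fun=> 0) (map fflip r) (fun n => f (swap n)) =
  fun n => appl (fun=> 0) r f (swap n).
Proof. by elim: r => //= phi r ->; exact: app_swap. Qed.

Lemma fval_fflip phi (x : 2.-tuple C) : fval (fun=> 0) (fflip phi) x = fval (fun=> 0) phi (swap x).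
Proof. by case: phi => [j|[j l]] /=; rewrite !tnth_swap. Qed.

Lemma mono_swap (x : 2.-tuple C) n : mono (swap x) (swap n) = mono x n.
Proof.
rewrite /mono (reindex_inj (can_inj flipK)); apply: eq_bigr => i _.
by rewrite !tnth_swap flipK.
Qed.

Lemma hsum_swap f (x : 2.-tuple C) s : hsum (fun n => f n * mono (swap x) n) s ->
  hsum (fun n => f (swap n) * mono x n) s.
Proof.
move=> hs; have := (hsum_inj (can_inj (@swapK int)) s _).1 hs.
move=> h; apply: hsum_ext (h _) => [n|n /(_ (swap n))]; first by rewrite /= mono_swap.
by rewrite swapK eqxx.
Qed.

Definition diff_factor (phi : lfactor 2) : bool := if phi is inr _ then true else false.
Definition nondegenerate (phi : lfactor 2) : bool :=
  if phi is inr (j, l) then j != l else true.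

Notation mdiff := (app (fun=> 0 : C) (inr (o0, o1))).

Lemma mdiffN f : mdiff (fun n => - f n) = fun n => - mdiff f n.
Proof. by apply/funext => n /=; ring. Qed.

(** A factor z_j acts by an invertible shift of the indices and can be
    cancelled; the remaining factors are z_1 - z_2 up to sign. *)
Lemma appl_cancel r f p : all nondegenerate r ->
  iter p mdiff (appl (fun=> 0) r f) = (fun=> 0) ->
  iter (p + count diff_factor r) mdiff f = (fun=> 0).
Proof.
elim: r p => [|phi r IH] p; first by rewrite addn0.
rewrite /=; set g := appl (fun=> 0) r f.
case: phi => [j|[j l]] /= => [rn|/andP[phin rn]].
  have -> : app (fun=> 0) (inl j) g = fun n => g (sh j n).
    by apply/funext => n /=; rewrite mul0r addr0.
  have -> : iter p mdiff (fun n => g (sh j n)) = fun n => iter p mdiff g (sh j n).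
    elim: p => // p IHp; rewrite iterS IHp; apply/funext => n /=.
    by rewrite (shC o0 j) (shC o1 j).
  move=> h; rewrite add0n; apply: IH => //; apply/funext => n.
  by have := congr1 (fun f => f (sh' j n)) h; rewrite /= shK'.
rewrite addnA addn1 => h; apply: IH => //; rewrite iterSr.
have [j0|j1] := eqVneq j o0.
  have l1 : l = o1.
    by move: phin; rewrite j0; case: (l) => [[|[|q]] hq] // _; exact: val_inj.
  by move: h; rewrite j0 l1.
have {}j1 : j = o1 by case: (j) j1 => [[|[|q]] hq] // _; exact: val_inj.
have l0 : l = o0.
  by move: phin; rewrite j1; case: (l) => [[|[|q]] hq] // _; exact: val_inj.
move: h; rewrite j1 l0.
have -> : app (fun=> 0) (inr (o1, o0)) g = fun n => - mdiff g n.
  by apply/funext => n /=; ring.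
have -> : iter p mdiff (fun n => - mdiff g n) = fun n => - iter p mdiff (mdiff g) n.
  by elim: p => // p IHp; rewrite iterS IHp mdiffN.
move=> h; apply/funext => n; apply/eqP; rewrite -oppr_eq0; apply/eqP.
exact: (congr1 (fun f => f n) h).
Qed.

(** Multiplied by all linear factors of the two denominators, both arrays become
    the same Laurent polynomial, up to eps. The factors z_1 and z_2 are then
    cancelled, which leaves a number of factors z_1 - z_2 that depends only on
    the pole orders b and b'. *)
Lemma two_region_local (eps : C) f f' (a a' : 'I_2 -> nat) (b b' : 'I_2 -> 'I_2 -> nat)
    (P P' : mpoly.mpoly 2 C) :
  (forall x, radially_ordered x -> hsum (fun n => f n * mono x n) (rat_eval a b P x)) ->
  (forall x, radially_ordered x -> hsum (fun n => f' n * mono x n) (rat_eval a' b' P' x)) ->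
  (forall x, generic_point x -> rat_eval a b P x = eps * rat_eval a' b' P' (swap x)) ->
  iter (b o0 o1 + b' o0 o1) mdiff (fun n => f n - eps * f' (swap n)) = (fun=> 0).
Proof.
move=> hf hf' hr.
have ef := formal_of_converges hf; have ef' := formal_of_converges hf'.
pose r := facs a b; pose r' := map fflip (facs a' b').
have cnt (a1 : 'I_2 -> nat) (b1 : 'I_2 -> 'I_2 -> nat) : count diff_factor (facs a1 b1) = b1 o0 o1.
  rewrite /facs !enum_ordSl enum_ord0 /= !count_cat !count_nseq /=.
  rewrite !mul0n !mul1n !addn0 !add0n.
  by congr (b1 _ _); exact: val_inj.
have nd (a1 : 'I_2 -> nat) (b1 : 'I_2 -> 'I_2 -> nat) : all nondegenerate (facs a1 b1).
  apply: sub_all (facs_ordered a1 b1) => -[//|[j l] /=].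
  by apply: contraTneq => ->; rewrite ltnn.
have -> : (b o0 o1 + b' o0 o1 = 0 + count diff_factor (r ++ r'))%N.
  rewrite count_cat count_map cnt add0n -(cnt a' b'); congr (_ + _)%N.
  by apply: eq_count => -[j|[j l]].
apply: appl_cancel.
  rewrite all_cat nd all_map; apply/allP => phi phir /=.
  have := allP (nd a' b') _ phir; case: phi {phir} => //= -[j l] /=.
  by rewrite (can_eq flipK).
rewrite /= appl_comb; apply/funext => n; apply/eqP; rewrite subr_eq0; apply/eqP.
rewrite !(appl_cat _ r r') [in LHS]appl_comm ef appl_swap ef'.
suff -> : appl (fun=> 0) r' (arrP (fun=> 0) P) =
    fun n => eps * appl (fun=> 0) r (fun n => arrP (fun=> 0) P' (swap n)) n by [].
apply: radial_unique => x xr; have xg := radial_generic xr.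
have x0 := radial_neq0 xr.
have x'g : generic_point (swap x).
  split=> [j|j l jl]; first by rewrite tnth_swap x0.
  rewrite !tnth_swap; have [|lj|/val_inj lj] := ltngtP (flip j) (flip l).
  - exact: xg.2.
  - by rewrite eq_sym; exact: xg.2.
  - by move: jl; rewrite -(flipK j) lj flipK ltnn.
have h1 := hsum_appl (fun=> 0) r' x0 (arrP0_sum P x).
have h2 := hsumZ eps (hsum_appl (fun=> 0) r x0 (hsum_swap (arrP0_sum P' (swap x)))).
eexists; split; first exact: h1.
move: h2; have := hr _ xg; rewrite !rat_evalE /r' big_map.
under [in X in _ -> _ -> hsum _ (X * _)]eq_bigr => phi _ do rewrite fval_fflip.
move: (facs_neq0 a b xg) (facs_neq0 a' b' x'g); rewrite -/r.
move: (\prod_(phi <- r) fval (fun=> 0) phi x)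
  (\prod_(phi <- facs a' b') fval (fun=> 0) phi (swap x)) => d d' d0 d0' e h.
have e' : mpoly.meval (tnth x) P = d * (eps * (mpoly.meval (tnth (swap x)) P' / d')).
  by rewrite -e mulrCA divff // mulr1.
rewrite e'; have -> : d' * (d * (eps * (mpoly.meval (tnth (swap x)) P' / d'))) =
   eps * (d * mpoly.meval (tnth (swap x)) P').
  by move: (mpoly.meval _ _) => y; field.
by apply: hsum_ext h => m; rewrite mulrA.
Qed.

End TwoVariables.

(** * The generating fields *)
Section Generators.
Context {R : realType} {V : lmodType (Cplx R)} (G : grading V).
Local Notation C := (Cplx R).
Context (hG : grading_restricted G).
Context (I : Type) (phi : I -> C -> V -> int -> V).
Hypothesis hphi : forall i, analytic_field G (phi i).
Context (L : {linear V -> V}) (vac : V) (hvac : homog G 0 vac).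
Context (wt : I -> int).
Hypothesis h1 : forall i v (v' : graded_dual G) z, z != 0 ->
  pairing v' (bracket G (L0 G) (phi i z) v) =
    z * derive1 (matrix_coef v' (phi i) v) z +
    ((wt i)%:~R / 2) * matrix_coef v' (phi i) v z.
Hypothesis h2vac : L vac = 0.
Hypothesis h2 : forall i n v,
  L (mode G (phi i) n v) - mode G (phi i) n (L v) =
    - n%:~R *: mode G (phi i) (n - 1) v.
Hypothesis h3 : forall i,
  (forall v' : graded_dual G,
     matrix_coef v' (phi i) vac z @[z --> 0^'] --> v' (mode G (phi i) (-1) vac)) /\
  (parity_part G false (mode G (phi i) (-1) vac) \/
   parity_part G true (mode G (phi i) (-1) vac)).
Hypothesis h4 : forall v, exists s : seq (C * seq (I * int)),
  v = \sum_(p <- s) p.1 *: mode_product G phi p.2 vac.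
Context (A : forall k, 'I_k -> I -> V -> nat) (B : forall k, 'I_k -> 'I_k -> I -> I -> nat).
Local Notation pole_at0 i v := (fun j => A j (tnth i j) v).
Local Notation pole_diag i := (fun j l => B j l (tnth i j) (tnth i l)).
Hypothesis h5 : forall k (i : k.-tuple I) (v : V) (v' : graded_dual G),
  exists P : mpoly.mpoly k C,
    correlation_converges phi v' i v (rat_eval (pole_at0 i v) (pole_diag i) P).
Hypothesis h6 : forall (i1 i2 : I) (v : V) (v' : graded_dual G) (z1 z2 : C),
  z1 != 0 -> z2 != 0 -> z1 != z2 ->
  rational_correlation phi v' [tuple i1; i2] v [tuple z1; z2] =
    (-1) ^+ (field_parity G phi vac i1 && field_parity G phi vac i2) *
    rational_correlation phi v' [tuple i2; i1] v [tuple z2; z1].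

Definition gen i : int -> V -> V := modes_of G (phi i) (wt i).

Lemma gen_mode i m v : mode G (phi i) m v = gen i m v.
Proof. exact: (modeE hG (hphi i) (h1 i) m v). Qed.

Lemma gen_mp s v : mode_product G phi s v = modes_prod gen v s.
Proof. by elim: s => //= p s ->; exact: gen_mode. Qed.

Lemma gen_lin i : modes_lin (gen i).
Proof. exact: modes_of_lin (hphi i). Qed.

Lemma gen_deg i : field_deg G (wt i) (gen i).
Proof. exact: modes_of_deg. Qed.

Lemma gen_transl i : transl L (gen i).
Proof. by move=> n v; have := h2 i n v; rewrite !gen_mode. Qed.

Lemma gen_fld i z v k : z != 0 -> phi i z v k = fld G (gen i) z v k.
Proof. exact: (modes_of_fld hG (hphi i) (h1 i)). Qed.

Lemma gen_span v : exists s : seq (C * seq (I * int)),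
  v = \sum_(p <- s) p.1 *: modes_prod gen vac p.2.
Proof.
by have [s ->] := h4 v; exists s; apply: eq_bigr => p _; rewrite gen_mp.
Qed.

Lemma gen_wt i : homog G (wt i) (gen i (-1) vac).
Proof. by apply: homog_eq (gen_deg i (-1) hvac) _; lia. Qed.

Lemma lim0_expM (q : C -> C) (l : C) (m : nat) : q h @[h --> 0^'] --> l ->
  (h ^+ m.+1 * q h) @[h --> 0^'] --> (0 : C).
Proof.
have step (r : C -> C) (l' : C) : r h @[h --> 0^'] --> l' ->
    (h * r h) @[h --> 0^'] --> (0 : C).
  by move=> hr; have := lim0M (@id_lim0 R) hr; rewrite mul0r.
move=> hq; elim: m => [|m IH].
  apply: (lim0_eq (step _ _ hq) (@ltr01 R)) => h _.
  by rewrite expr1.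
apply: (lim0_eq (step _ _ IH) (@ltr01 R)) => h _.
by rewrite mulrA -exprS.
Qed.

(** In a suitable homogeneous component, phi^i(z) 1 is the single term phi^i_m 1
    z ^ (- m - 1). Having a limit at z = 0, it cannot be a nonzero multiple of a
    negative power of z. *)
Lemma gen_creat i m : 0 <= m -> gen i m vac = 0.
Proof.
move=> m0; apply: (dual_eq hG) => v'; rewrite dual0.
have [w' hw] := dual_pi v' (wt i - 2 * m - 2).
have := (h3 i).1 w'.
have E h : h != 0 -> matrix_coef w' (phi i) vac h = v' (gen i m vac) * h ^ (- m - 1).
  move=> h0; rewrite (modes_of_coef hG (hphi i) (h1 i) w' vac h0).
  rewrite (zs_single (i0 := m)) => [|m' mm].
    by rewrite hw (homog_eq (gen_deg i m hvac)) //; lia.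
  rewrite hw (homog_piN (gen_deg i m' hvac)) ?dual0 ?mul0r //.
  by apply: contra_neq mm; lia.
case: m m0 E {hw} => // m _ E /(lim0_expM m).
set q := fun h : C => _; move=> hq.
apply: nm_eps => e e0.
have /lim0P/(_ _ e0)[r r0 /(_ ((r / 2)%:C%C))] := hq.
have r2 : 0 < r / 2 by rewrite divr_gt0.
have h0 : ((r / 2)%:C%C : C) != 0 by rewrite -nm_gt0 nm_real ?(ltW r2).
rewrite nm_real ?(ltW r2) // r2 ltr_pdivrMr // ltr_pMr // ltr1n => /(_ isT).
rewrite subr0 /q E // mulrCA exprnP -expfzDr //.
have -> : m.+1%:Z + (- m%:Z - 1) = 0 by lia.
by rewrite expr0z mulr1.
Qed.

(** Two rational functions to which the series converges agree off their poles,
    so that the choice of one of them is immaterial there. *)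
Lemma rational_correlationE k (i : k.-tuple I) v (v' : graded_dual G) P x :
  correlation_converges phi v' i v (rat_eval (pole_at0 i v) (pole_diag i) P) ->
  generic_point x ->
  rational_correlation phi v' i v x = rat_eval (pole_at0 i v) (pole_diag i) P x.
Proof.
move=> hP xg; rewrite /rational_correlation.
case: xgetP => [F _ [[a [b [Q ->]]] hQ]|no]; last first.
  by case: (no (rat_eval (pole_at0 i v) (pole_diag i) P)); split=> //;
    exists (pole_at0 i v), (pole_diag i), P.
apply: rat_unique => // y yr.
exact: hsum_unique ((abs_convP _ _).1 (hQ y yr)) ((abs_convP _ _).1 (hP y yr)).
Qed.

Lemma gen_converges k (i : k.-tuple I) v (v' : graded_dual G) P x :
  correlation_converges phi v' i v (rat_eval (pole_at0 i v) (pole_diag i) P) ->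
  radially_ordered x ->
  hsum (fun n : k.-tuple int => v' (modes_prod gen v (zip i n)) * mono x n)
       (rat_eval (pole_at0 i v) (pole_diag i) P x).
Proof.
move=> hP xr; have /abs_convP := hP x xr.
by apply: hsum_ext => n; rewrite gen_mp.
Qed.

(** The order of the pole at z_1 = z_2 depends neither on v nor on v', hence
    neither does the order of locality. *)
Lemma gen_local_parity i j : exists N,
  local ((-1) ^+ (field_parity G phi vac i && field_parity G phi vac j) : C) N
    (gen i) (gen j).
Proof.
set eps : C := (-1) ^+ _.
pose o0 : 'I_2 := ord0; pose o1 : 'I_2 := ord_max.
exists (@B 2 o0 o1 i j + @B 2 o0 o1 j i)%N => s v.
apply/funext => m; apply/eqP; rewrite -subr_eq0; apply/eqP.
pose H p q := gen i p (gen j q v) - eps *: gen j q (gen i p v).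
set N := (_ + _)%N.
have -> : iter N dl (fun m => gen i m (gen j (s - m) v)) m -
    iter N dl (fun m => eps *: gen j (s - m) (gen i m v)) m =
    iter N dl (fun m => H m (s - m)) m.
  by rewrite /H dlN_sub.
pose q : int := s - N%:Z - m.
have -> : iter N dl (fun m => H m (s - m)) m = iter N dkm H m q.
  rewrite iter_dkm; congr (iter N dl _ m); apply/funext => k.
  by congr (H k _); rewrite /q; lia.
apply: (dual_eq hG) => v'; rewrite dual0.
have [P hP] := h5 [tuple i; j] v v'; have [P' hP'] := h5 [tuple j; i] v v'.
have := @two_region_local R eps _ _ _ _ _ _ P P'
  (fun x => gen_converges hP (x := x)) (fun x => gen_converges hP' (x := x)).
have gsw (x : 2.-tuple C) : generic_point x -> generic_point (swap x).
  move=> [x0 xd]; split=> [t|]; first by rewrite tnth_swap.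
  move=> [[|[|t]] ht] [[|[|u]] hu] //= _; rewrite !tnth_swap /flip /=.
  by rewrite eq_sym; apply: xd.
have hr (x : 2.-tuple C) : generic_point x ->
    rat_eval (pole_at0 [tuple i; j] v) (pole_diag [tuple i; j]) P x =
    eps * rat_eval (pole_at0 [tuple j; i] v) (pole_diag [tuple j; i]) P' (swap x).
  move=> xg; rewrite -(rational_correlationE hP xg).
  rewrite -(rational_correlationE hP' (gsw _ xg)) {1}(tuple2E x).
  by case: xg => x0 xd; rewrite h6 //; apply: xd.
move=> /(_ hr) {hr}.
have dB u (x : C) w : v' (u - x *: w) = v' u - x * v' w.
  by rewrite -scaleNr dualD dualZ mulNr.
have -> : (fun n : 2.-tuple int => v' (modes_prod gen v (zip [tuple i; j] n)) -
    eps * v' (modes_prod gen v (zip [tuple j; i] (swap n)))) =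
    fun n => v' (H (tnth n o0) (tnth n o1)).
  apply/funext => n; rewrite /H dB.
  by rewrite {1}(tuple2E n).
pose M := app (fun=> 0 : C) (inr (o0, o1)).
have tr p (n : 2.-tuple int) :
    iter p M (fun n => v' (H (tnth n o0) (tnth n o1))) n =
    v' (iter p dkm H (tnth n o0) (tnth n o1)).
  elim: p n => // p IH n; rewrite !iterS /M /= -/M !IH /dkm !tnth_upd /=.
  by rewrite subrr mul0r addr0 -[X in _ = v' (_ - X)]scale1r dB mul1r.
move=> /(congr1 (fun f => f [tuple m; q])); rewrite -/o0 -/o1 -/M.
by rewrite [X in iter X](_ : _ = N) // tr.
Qed.

(** If phi^i_{-1} 1 is nonzero, it is homogeneous of weight wt i / 2, so its
    parity is that of wt i. If it is zero, then so is the whole field, by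
    Goddard's uniqueness, and any sign will do. *)
Lemma gen_local i j : exists N, local (super_sign (wt i) (wt j) : C) N (gen i) (gen j).
Proof.
have bb := restricted_bounded hG.
have L_lin : lin L by move=> x u v; rewrite linearP.
have zero l : gen l (-1) vac = 0 -> gen l = fun _ _ => 0.
  move=> g0; apply/funext => n; apply/funext => v.
  apply: (goddard bb L_lin h2vac gen_lin gen_deg gen_span (gen_lin l) (gen_transl l)).
    move=> m hm; case: (eqVneq m (-1)) => [-> //|m1].
    by apply: gen_creat; lia.
  by move=> t; have [N hN] := gen_local_parity l t; eexists; exists N; exact: hN.
have par l : gen l (-1) vac <> 0 -> field_parity G phi vac l = odd (absz (wt l)).
  move=> g0; rewrite /field_parity gen_mode; have hw := gen_wt l.
  have pp p : parity_part G p (gen l (-1) vac) -> odd (absz (wt l)) = p.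
    move=> hp; apply/eqP; apply: contra_notT g0 => ne.
    by rewrite -hw; exact: hp.
  have [_] := h3 l; rewrite gen_mode => -[] hp.
    by rewrite (pp _ hp) asboolT.
  rewrite (pp _ hp) asboolF // => /pp; by rewrite (pp _ hp).
have [i0|i0] := pselect (gen i (-1) vac = 0).
  exists 0%N => s v; rewrite (zero _ i0); apply/funext => m /=.
  by rewrite (lin0 (gen_lin j _)) scaler0.
have [j0|j0] := pselect (gen j (-1) vac = 0).
  exists 0%N => s v; rewrite (zero _ j0); apply/funext => m /=.
  by rewrite (lin0 (gen_lin i _)) scaler0.
by have := gen_local_parity i j; rewrite !par.
Qed.

Lemma state_field_gen : exists2 Y, state_field_map G L vac Y &
  forall i, Y (gen i (-1) vac) = gen i.
Proof.
apply: (state_field_exists (restricted_bounded hG) (wt := wt)) => //.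
- by move=> x u v; rewrite linearP.
- exact: gen_lin.
- exact: gen_deg.
- exact: gen_transl.
- exact: gen_creat.
- exact: gen_local.
- exact: gen_span.
Qed.

End Generators.

(** * Re-expansion at another point *)
Section Reexpansion.
Context {R : realType}.
Local Notation C := (Cplx R).
Implicit Types (e f : int -> C^o) (zeta : C).

(** e gives an expansion in powers of y of p(y) (y - 1)^{-N}, for a Laurent
    polynomial p; then e' n is the coefficient of (y - 1)^{-n-1} in the expansion
    of the same function at y = 1. *)
Definition reexpands_at (N : nat) e e' : Prop :=
  fsupp (iter N dl e) /\ forall n, e' n = taylor (N%:Z - 1 - n) (iter N dl e).

Definition reexpands e e' : Prop := exists N : nat, reexpands_at N e e'.

Lemma fsupp_dlN M e : fsupp e -> fsupp (iter M dl e).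
Proof. by move=> h; elim: M => //= M; exact: fsupp_dl. Qed.

Lemma reexpands_raise N M e e' : reexpands_at N e e' -> reexpands_at (M + N) e e'.
Proof.
move=> [h1 h2]; rewrite /reexpands_at iterD; split=> [|n]; first exact: fsupp_dlN.
by rewrite taylor_dlN // h2; congr (taylor _ _); lia.
Qed.

Lemma reexpands_comb (x : C) e e' f f' : reexpands e e' -> reexpands f f' ->
  reexpands (fun m => x *: e m + f m) (fun m => x *: e' m + f' m).
Proof.
move=> [N hN] [M hM]; exists (N + M)%N.
have [h1 h2] := reexpands_raise M hN; have [h3 h4] := reexpands_raise N hM.
rewrite addnC in h1 h2; rewrite /reexpands_at dlN_comb; split=> [|n].
  apply: fsuppD => //.
  by apply: (fsupp_map (f := fun _ v => x *: v) _ h1) => _; rewrite scaler0.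
rewrite taylor_comb // h2 h4; by [].
Qed.

Lemma reexpands0 : reexpands (fun=> 0) (fun=> 0).
Proof.
exists 0%N; split=> [|n]; first by exists fset0.
by rewrite taylor0.
Qed.

Lemma reexpandsZ (x : C) e e' : reexpands e e' ->
  reexpands (fun m => x *: e m) (fun m => x *: e' m).
Proof.
move=> h; have := reexpands_comb x h reexpands0; congr reexpands;
by apply/funext => m; rewrite addr0.
Qed.

Lemma reexpandsD e e' f f' : reexpands e e' -> reexpands f f' ->
  reexpands (fun m => e m + f m) (fun m => e' m + f' m).
Proof.
move=> h h'; have := reexpands_comb 1 h h'; congr reexpands;
by apply/funext => m; rewrite scale1r.
Qed.

Lemma reexpands_sum (S : Type) (r : seq S) (e e' : S -> int -> C^o) :
  (forall s, reexpands (e s) (e' s)) ->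
  reexpands (fun m => \sum_(s <- r) e s m) (fun m => \sum_(s <- r) e' s m).
Proof.
move=> h; elim: r => [|s r IH].
  by have := reexpands0; congr reexpands; apply/funext => m; rewrite big_nil.
have := reexpandsD (h s) IH; congr reexpands; apply/funext => m;
by rewrite big_cons.
Qed.

(** Multiplication by y = 1 + (y - 1). *)
Lemma reexpands_shift e e' : reexpands e e' ->
  reexpands (fun m => e (m + 1)) (fun m => e' (m + 1) + e' m).
Proof.
move=> [N [h1 h2]]; exists N; rewrite /reexpands_at.
have -> : iter N dl (fun m => e (m + 1)) = fun m => iter N dl e (m + 1).
  by elim: N {h1 h2} => // N IH; rewrite !iterS IH.
split=> [|n]; first exact: (fsupp_inj (f := +%R^~ 1) (@addIr _ 1) h1).
have -> : (fun m => iter N dl e (m + 1)) =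
    fun m => 1 *: dl (iter N dl e) m + iter N dl e m.
  by apply/funext => m; rewrite scale1r /dl subrK.
rewrite taylor_comb ?scale1r //; last exact: fsupp_dl.
by rewrite taylor_dl // !h2; congr (taylor _ _ + _); lia.
Qed.

Lemma reexpands_fin e : fsupp e -> reexpands e (fun n => taylor (- 1 - n) e).
Proof. by move=> h; exists 0%N; split=> // n; congr (taylor _ _); lia. Qed.

Lemma reexpands_unique e e' f' : reexpands e e' -> reexpands e f' -> e' = f'.
Proof.
move=> h h'; have [N [h1 h2]] := reexpands_comb (- 1) h h'.
have E : (fun m => - 1 *: e m + e m) = fun=> 0.
  by apply/funext => m; rewrite scaleN1r addNr.
apply/funext => n; apply/eqP; rewrite -subr_eq0 -oppr_eq0 opprB addrC -scaleN1r h2.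
by rewrite E dlN0 taylor0.
Qed.

(** Both families are coefficients of the polynomial z ^ al, expanded at 0 and
    at zeta, with z = zeta y. *)
Lemma reexpands_tcoef zeta al : zeta != 0 ->
  reexpands (fun m => zeta ^ (- m) * tcoef 0 al m) (fun m => zeta ^ (- m) * tcoef zeta al m).
Proof.
move=> z0; set e := fun m => _ : C^o.
have e0 m : m != - al%:Z - 1 -> e m = 0.
  rewrite /e /tcoef => hm; case E : (- m - 1) => [i|i]; last by rewrite mulr0.
  case: (ltngtP i al) => h; last by case/eqP: hm; lia.
    by rewrite expr0n subn_eq0 leqNgt h /= !mulr0.
  by rewrite bin_small // mul0r mulr0.
have fe : fsupp e by exists [fset - al%:Z - 1]%fset => i; rewrite inE; exact: e0.
have := reexpands_fin fe; congr reexpands; apply/funext => n.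
rewrite /tcoef; have -> : - n - 1 = - 1 - n by lia.
case E : (- 1 - n) => [j|j] /=; last by rewrite mulr0.
rewrite (zs_single (i0 := - al%:Z - 1)); last by move=> m /e0 ->; rewrite scaler0.
have E1 : - (- al%:Z - 1) - 1 = al :> int by lia.
rewrite /e /tcoef E1 -pmulrn gbin_nat binn mul1r subnn expr0 mulr1.
have [ja|aj] := leqP j al; last by rewrite bin_small // scale0r mul0r mulr0.
rewrite [RHS]mulrCA exprnP -expfzDr // -[_ *: _]/(_ * _).
by congr (_ * _ ^ _); lia.
Qed.

Context (k : nat).
Implicit Types (F : k.-tuple int -> C) (n : k.-tuple int).

(** F is an expansion in powers of z_s and F' one in powers of z_s - zeta, the
    other variables being treated alike. The powers of zeta come from z_s = zeta
    y. *)
Definition reexpands_in zeta (s : 'I_k) F F' : Prop := forall n,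
  reexpands (fun m => zeta ^ (- m) * F (upd n s m)) (fun m => zeta ^ (- m) * F' (upd n s m)).

Lemma reexpands_in_unique zeta s F F' F'' : zeta != 0 ->
  reexpands_in zeta s F F' -> reexpands_in zeta s F F'' -> F' = F''.
Proof.
move=> z0 h h'; apply/funext => n.
have := congr1 (fun f => f (tnth n s)) (reexpands_unique (h n) (h' n)).
by rewrite upd_id => /mulfI; apply; rewrite expfz_neq0.
Qed.

Definition mulz (c : C) (j : 'I_k) F : k.-tuple int -> C := fun n => F (sh j n) + c * F n.

(** Multiplication by z_s is multiplication by zeta y before, and by zeta + x_s
    after the re-expansion. *)
Lemma reexpands_mulz zeta s (c c' : 'I_k -> C) j F F' : zeta != 0 ->
  c s = 0 -> c' s = zeta -> (forall i, i != s -> c i = c' i) ->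
  reexpands_in zeta s F F' -> reexpands_in zeta s (mulz (c j) j F) (mulz (c' j) j F').
Proof.
move=> z0 cs cs' cc h n; have [->|js] := eqVneq j s.
  have E (X : k.-tuple int -> C) m : X (sh s (upd n s m)) = X (upd n s (m + 1)).
    by rewrite /sh upd_upd tnth_upd eqxx.
  have zE m : zeta ^ (- m) = zeta * zeta ^ (- (m + 1)).
    by rewrite -{2}[zeta]expr1z -expfzDr //; congr (_ ^ _); lia.
  have := reexpandsZ zeta (reexpands_shift (h n)); congr reexpands; apply/funext => m.
    by rewrite /mulz cs mul0r addr0 E -[LHS]/(_ * _) mulrA -zE.
  rewrite /mulz cs' E -[LHS]/(_ * _) [LHS]mulrDr [RHS]mulrDr mulrA -zE.
  by rewrite [in LHS]mulrCA.
rewrite /mulz -cc //.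
have E m : sh j (upd n s m) = upd (sh j n) s m.
  by rewrite /sh tnth_upd (negbTE js) updC // eq_sym.
have := reexpands_comb (c j) (h n) (h (sh j n)); congr reexpands; apply/funext => m;
by rewrite E mulrDr addrC mulrCA.
Qed.

Lemma reexpands_inB zeta s F F' H H' : reexpands_in zeta s F F' ->
  reexpands_in zeta s H H' ->
  reexpands_in zeta s (fun n => F n - H n) (fun n => F' n - H' n).
Proof.
move=> h h' n; have := reexpands_comb (- 1) (h' n) (h n); congr reexpands;
by apply/funext => m; rewrite scaleN1r addrC -mulrBr.
Qed.

Lemma reexpands_app zeta s (c c' : 'I_k -> C) phi F F' : zeta != 0 ->
  c s = 0 -> c' s = zeta -> (forall i, i != s -> c i = c' i) ->
  reexpands_in zeta s F F' -> reexpands_in zeta s (app c phi F) (app c' phi F').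
Proof.
move=> z0 cs cs' cc h; case: phi => [j|[j l]]; first exact: reexpands_mulz.
have E (d : 'I_k -> C) (X : k.-tuple int -> C) :
    app d (inr (j, l)) X = fun n => mulz (d j) j X n - mulz (d l) l X n.
  by apply/funext => n; rewrite /mulz /=; ring.
by rewrite !E; apply: reexpands_inB; apply: reexpands_mulz.
Qed.

Lemma reexpands_appl zeta s (c c' : 'I_k -> C) r F F' : zeta != 0 ->
  c s = 0 -> c' s = zeta -> (forall i, i != s -> c i = c' i) ->
  reexpands_in zeta s F F' -> reexpands_in zeta s (appl c r F) (appl c' r F').
Proof.
move=> z0 cs cs' cc h; elim: r => [|phi r IH]; first exact: h.
exact: (reexpands_app phi z0 cs cs' cc IH).
Qed.

Lemma reexpands_arrP zeta s (c c' : 'I_k -> C) P : zeta != 0 ->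
  c s = 0 -> c' s = zeta -> (forall i, i != s -> c i = c' i) ->
  reexpands_in zeta s (arrP c P) (arrP c' P).
Proof.
move=> z0 cs cs' cc n.
pose K (p : mpoly.multinom k) : C := mpoly.mcoeff p P *
  \prod_(j < k | j != s) tcoef (c j) (p j) (tnth n j).
have E (d : 'I_k -> C) m : (forall i, i != s -> d i = c i) ->
    zeta ^ (- m) * arrP d P (upd n s m) =
    \sum_(p <- mpoly.msupp P) K p *: (zeta ^ (- m) * tcoef (d s) (p s) m).
  move=> dc; rewrite /arrP mulr_sumr; apply: eq_bigr => p _.
  rewrite (bigD1 s) //= tnth_upd eqxx.
  have -> : \prod_(j < k | j != s) tcoef (d j) (p j) (tnth (upd n s m) j) =
      \prod_(j < k | j != s) tcoef (c j) (p j) (tnth n j).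
    by apply: eq_bigr => j js; rewrite tnth_upd (negbTE js) dc.
  rewrite -[_ *: _]/(_ * _) /K.
  by move: (\prod_(_ < k | _) _) (mpoly.mcoeff _ _) (tcoef _ _ _) (_ ^ _) => *; ring.
have hK p : reexpands (fun m => K p *: (zeta ^ (- m) * tcoef (c s) (p s) m))
    (fun m => K p *: (zeta ^ (- m) * tcoef (c' s) (p s) m)).
  by rewrite cs cs'; exact: reexpandsZ (reexpands_tcoef (p s) z0).
have := reexpands_sum (mpoly.msupp P) hK; congr reexpands; apply/funext => m.
  by rewrite (E c m (fun _ _ => erefl)).
by rewrite (E c' m (fun i is' => esym (cc i is'))).
Qed.

End Reexpansion.

(** * The residue formula *)
Section Residue.
Context {R : realType} {V : lmodType (Cplx R)} (G : grading V).
Local Notation C := (Cplx R).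
Local Notation pi := (graded_proj G).
Implicit Types (u v w : V) (zeta : C).
Context (hG : grading_restricted G) (L : V -> V) (vac : V) (hvac : homog G 0 vac).
Context (Y : V -> int -> V -> V) (sfY : state_field_map G L vac Y).
Context (I : Type) (a : I -> int -> V -> V) (wt : I -> int).
Hypothesis a_wt : forall i, homog G (wt i) (a i (-1) vac).
Hypothesis Ya : forall i, Y (a i (-1) vac) = a i.

Let bb := restricted_bounded hG.

Let a_lin i : modes_lin (a i).
Proof. by rewrite -Ya; exact: (sf_lin sfY). Qed.

Let a_deg i : field_deg G (wt i) (a i).
Proof. by rewrite -Ya; exact: (sf_deg sfY (a_wt i)). Qed.

Let Y_trunc u : trunc (Y u).
Proof.
elim/(homog_ind (G := G)): u => [d u hu|u v hu hv].
  exact: (deg_trunc bb (sf_lin sfY u) (sf_deg sfY hu)).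
move=> w; have [M hM] := hu w; have [N hN] := hv w; exists (Num.max M N) => n.
by rewrite gt_max => /andP[h h']; rewrite (Y_stateD sfY) hM // hN // addr0.
Qed.

Let a_trunc i : trunc (a i).
Proof. by rewrite -Ya; exact: Y_trunc. Qed.

Lemma modes_prod_lin (s : seq (I * int)) : lin (fun v => modes_prod a v s).
Proof. by elim: s => [|p s IH] x u v //=; rewrite IH a_lin. Qed.

Lemma modes_prod_homog_ex (s : seq (I * int)) d v : homog G d v ->
  exists e, homog G (d + e) (modes_prod a v s).
Proof.
move=> hv; elim: s => [|p s [e IH]]; first by exists 0; rewrite addr0.
exists (e + wt p.1 - 2 * p.2 - 2); apply: homog_eq (a_deg p.1 p.2 IH) _; lia.
Qed.

Lemma dual_mp (v' : graded_dual G) (s : seq (I * int)) :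
  exists w' : graded_dual G, forall v, w' v = v' (modes_prod a v s).
Proof.
elim: s v' => [|[i n] s IH] v'; first by exists v'.
have [w1 h1] : exists w1 : graded_dual G, forall v, w1 v = v' (a i n v).
  apply: (dual_comp v' (a_lin i n) (d := wt i - 2 * n - 2)) => d v hv.
  by apply: homog_eq (a_deg i n hv) _; lia.
by have [w2 h2] := IH w1; exists w2 => v; rewrite h2 h1.
Qed.

Lemma dlN_dual (w' : graded_dual G) (h : int -> V) N :
  iter N dl (fun m => w' (h m) : C^o) = fun m => w' (iter N dl h m).
Proof.
elim: N => // N IH; rewrite !iterS IH; apply/funext => m.
by rewrite /dl [RHS]linearB.
Qed.

Lemma taylor_dual (w' : graded_dual G) (j : int) (F : int -> V) : fsupp F ->
  taylor j (fun m => w' (F m) : C^o) = w' (taylor j F).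
Proof.
move=> fF; case: j => j /=; last by rewrite dual0.
rewrite dual_zs; first by apply: eq_zs => m; rewrite dualZ.
exact: fsupp_gbin.
Qed.

(** The formula for the field of a product, read as the re-expansion at x = 1 of
    the product of two fields. *)
Lemma slice_reexpands i e u s (w' : graded_dual G) v : homog G e u ->
  reexpands (fun m => w' (a i m (Y u (s - m) v)))
            (fun n => w' (Y (a i n u) (s - n) v)).
Proof.
move=> hu; have [N hN] := sf_local sfY (a_wt i) hu; have := hN.
rewrite Ya => hN'; exists N.
have fs := local_fsupp s v (a_lin i) (sf_lin sfY u) (@a_trunc i) (@Y_trunc u) hN'.
rewrite /reexpands_at dlN_dual; split=> [|n].
  by apply: (fsupp_map (f := fun _ : int => w') _ fs) => _; exact: dual0.
rewrite taylor_dual //; congr (w' _).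
have := sf_prod sfY n (a_wt i) hu hN; rewrite Ya => ->.
rewrite /nprod; congr (taylor _ (iter N dl _)); apply/funext => m.
by congr (a i m (Y u _ v)); lia.
Qed.

(** For homogeneous v the functional w' only sees finitely many total indices s
    = m + r, and each of them is a slice. *)
Lemma step_reexpands zeta i e u (w' : graded_dual G) v : zeta != 0 -> homog G e u ->
  reexpands
    (fun m => zeta ^ (- m) * zs (fun r => w' (a i m (Y u r v)) * zeta ^ (- r - 1)))
    (fun n => zeta ^ (- n) * zs (fun r => w' (Y (a i n u) r v) * zeta ^ (- r - 1))).
Proof.
move=> z0 hu.
have gfa m : exists w1 : graded_dual G, forall x, w1 x = w' (a i m x).
  by have [w1 h] := dual_mp w' [:: (i, m)]; exists w1.
have fs u1 (w1 : graded_dual G) v1 : fsupp (fun r => w1 (Y u1 r v1) * zeta ^ (- r - 1)).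
  apply: (fsupp_map (f := fun r x => x * zeta ^ (- r - 1)) _
    (gf_fsupp w1 v1 (Y_gfield sfY u1))) => r.
  by rewrite mul0r.
elim/(homog_ind (G := G)): v => [d v hv|v1 v2 h1 h2]; last first.
  have := reexpandsD h1 h2; congr reexpands; apply/funext => m;
    rewrite -mulrDr -zsD //; try exact: fs.
  - by congr (_ * _); apply: eq_zs => r;
      rewrite (linD _ _ (sf_lin sfY u r)) (linD _ _ (a_lin i m)) dualD mulrDl.
  - by have [w1 h] := gfa m; apply: eq_fsupp (fs u w1 v1) => r; rewrite h.
  - by have [w1 h] := gfa m; apply: eq_fsupp (fs u w1 v2) => r; rewrite h.
  - by congr (_ * _); apply: eq_zs => r;
      rewrite (linD _ _ (sf_lin sfY _ r)) dualD mulrDl.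
have [S0 [hS0 _]] := dual_support w'.
pose D := d + e + wt i - 4.
have fI : injective (fun s : int => D - 2 * s) by move=> s t /= h; lia.
have [S hS] := fpreim_ex fI S0.
have vanish x s : homog G (D - 2 * s) x -> s \notin S -> w' x = 0.
  by move=> hx sS; rewrite -hx; apply: hS0; rewrite -hS.
have E (X : int -> int -> V) m : (forall r, homog G (D - 2 * (m + r)) (X m r)) ->
    zeta ^ (- m) * zs (fun r => w' (X m r) * zeta ^ (- r - 1)) =
    \sum_(s <- S) zeta ^ (- s - 1) *: (w' (X m (s - m)) : C^o).
  move=> hX; rewrite -(zs_shift _ (- m)) (zsE (A := S)); last first.
    move=> s sS; rewrite (vanish _ s) ?mul0r //.
    by apply: homog_eq (hX (s - m)) _; lia.
  rewrite mulr_sumr; apply: eq_bigr => s _; rewrite -[RHS]/(_ * _) mulrCA mulrC.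
  by rewrite -expfzDr //; congr (_ ^ _ * _); lia.
have h s := reexpandsZ (zeta ^ (- s - 1)) (slice_reexpands i s w' v hu).
have := reexpands_sum S h; congr reexpands; apply/funext => m.
  rewrite (E (fun m r => a i m (Y u r v))) // => r.
  by apply: homog_eq (a_deg i m (sf_deg sfY hu r hv)) _; rewrite /D; lia.
rewrite (E (fun m r => Y (a i m u) r v)) // => r.
by apply: homog_eq (sf_deg sfY (a_deg i m hu) r hv) _; rewrite /D; lia.
Qed.

(** Interpolates between the correlation function, for s = k, and the matrix
    coefficients of the vertex operators of products of modes, for s = 0: the
    first s fields act on V, the others inside the state. *)
Definition interp (zeta : C) (v' : graded_dual G) v k (i : k.-tuple I) (s : nat)
    (n : k.-tuple int) : C :=
  zs (fun r => v' (modes_prod a (Y (modes_prod a vac (drop s (zip i n))) r v) (take s (zip i n)))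
               * zeta ^ (- r - 1)).

Lemma zip_upd k (i : k.-tuple I) (n : k.-tuple int) (s : 'I_k) m :
  [/\ take s (zip i (upd n s m)) = take s (zip i n),
      drop s.+1 (zip i (upd n s m)) = drop s.+1 (zip i n),
      take s.+1 (zip i (upd n s m)) = rcons (take s (zip i n)) (tnth i s, m) &
      drop s (zip i (upd n s m)) = (tnth i s, m) :: drop s.+1 (zip i n)].
Proof.
pose x0 := (tnth i s, 0 : int).
have sz (p : k.-tuple int) : size (zip i p) = k.
  by rewrite size_zip !size_tuple minnn.
have nthE (p : k.-tuple int) j (jk : (j < k)%N) :
    nth x0 (zip i p) j = (tnth i (Ordinal jk), tnth p (Ordinal jk)).
  rewrite nth_zip ?size_tuple //; congr (_, _).
    by rewrite [RHS](tnth_nth (tnth i s)).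
  by rewrite [RHS](tnth_nth 0).
have nthU j : (j < k)%N -> j != s :> nat ->
    nth x0 (zip i (upd n s m)) j = nth x0 (zip i n) j.
  by move=> jk js; rewrite !nthE tnth_upd -val_eqE /= (negbTE js).
have nthS : nth x0 (zip i (upd n s m)) s = (tnth i s, m).
  rewrite (nthE _ _ (ltn_ord s)) tnth_upd -val_eqE /= eqxx.
  by congr (tnth i _, _); exact: val_inj.
have h1 : take s (zip i (upd n s m)) = take s (zip i n).
  apply: (@eq_from_nth _ x0); rewrite !size_take !sz ltn_ord // => j js.
  by rewrite !nth_take // nthU ?ltn_eqF //; exact: ltn_trans js _.
have h2 : drop s.+1 (zip i (upd n s m)) = drop s.+1 (zip i n).
  apply: (@eq_from_nth _ x0); rewrite !size_drop !sz // => j js.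
  by rewrite !nth_drop nthU //; lia.
split=> //; first by rewrite (take_nth x0) ?sz // nthS h1.
by rewrite (drop_nth x0) ?sz // nthS h2.
Qed.

(** The s-th field moves from acting on V to acting inside the state, which is a
    re-expansion at zeta of its own variable. *)
Lemma interp_reexpands zeta (v' : graded_dual G) v k (i : k.-tuple I) (s : 'I_k) :
  zeta != 0 -> reexpands_in zeta s (interp zeta v' v i s.+1) (interp zeta v' v i s).
Proof.
move=> z0 n; have [w' hw] := dual_mp v' (take s (zip i n)).
have [e he] := modes_prod_homog_ex (drop s.+1 (zip i n)) hvac.
have := step_reexpands (tnth i s) w' v z0 he.
congr reexpands; apply/funext => m; congr (_ * _); apply: eq_zs => r;
  have [h1 h2 h3 h4] := zip_upd i n s m.
  by rewrite h2 h3 hw /modes_prod -cats1 foldr_cat.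
by rewrite h1 h4 hw.
Qed.

Lemma interp_last zeta (v' : graded_dual G) v k (i : k.-tuple I) n :
  interp zeta v' v i k n = v' (modes_prod a v (zip i n)).
Proof.
have sz : size (zip i n) = k by rewrite size_zip !size_tuple minnn.
rewrite /interp drop_oversize ?sz // take_oversize ?sz // [modes_prod a vac [::]]/= (sf_vac sfY).
rewrite (zs_single (i0 := -1)); first by rewrite /idfield eqxx expr0z mulr1.
move=> r /negbTE r1; rewrite /idfield r1 (lin0 (f := fun v => modes_prod a v (zip i n))).
  by rewrite dual0 mul0r.
exact: modes_prod_lin.
Qed.

Lemma interp_first zeta (v' : graded_dual G) v k (i : k.-tuple I) n :
  interp zeta v' v i 0 n = pairing v' (vertex_op G Y (modes_prod a vac (zip i n)) zeta v).
Proof. by rewrite /interp drop0 take0 /vertex_op (pairing_fld _ _ _ (Y_gfield sfY _)). Qed.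

(** phi_{n_l} kills the vector to its right for n_l large, and does not see the
    indices to its left. *)
Lemma truncated_interp zeta (v' : graded_dual G) v k (i : k.-tuple I) :
  truncated (interp zeta v' v i 0).
Proof.
move=> l n; have [M hM] := @a_trunc (tnth i l) (modes_prod a vac (drop l.+1 (zip i n))).
exists M => n' hn' hl; rewrite interp_first.
have [_ h2 _ h4] := zip_upd i n' l (tnth n' l).
rewrite upd_id in h2 h4.
have E : drop l.+1 (zip i n') = drop l.+1 (zip i n).
  pose x0 := (tnth i l, 0 : int).
  apply: (@eq_from_nth _ x0); rewrite !size_drop !size_zip !size_tuple // => j js.
  rewrite !nth_drop; have jk : (l.+1 + j < k)%N by lia.
  rewrite !nth_zip ?size_tuple //; congr (_, _).
  have := hn' (Ordinal jk); rewrite !(tnth_nth 0) /=; apply.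
  by rewrite addSn ltnS leq_addr.
have -> : modes_prod a vac (zip i n') = 0.
  rewrite -(cat_take_drop l (zip i n')) h4 /modes_prod foldr_cat /= -/(modes_prod a vac _) E hM //.
  exact: (lin0 (modes_prod_lin _)).
rewrite (pairing_fld _ _ _ (Y_gfield sfY _)).
apply: zs0 => r; have := Y_stateZ sfY 0 vac r v; rewrite !scale0r => ->.
by rewrite dual0 mul0r.
Qed.

(** The first s variables are expanded as in the correlation function, the others
    around zeta. *)
Definition center (zeta : C) k (s : nat) (j : 'I_k) : C := if (j < s)%N then 0 else zeta.

Section OneCorrelation.
Context (zeta : C) (zeta0 : zeta != 0) (v' : graded_dual G) (v : V).
Context (k : nat) (i : k.-tuple I) (al : 'I_k -> nat) (be : 'I_k -> 'I_k -> nat).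
Context (P : mpoly.mpoly k C).
Hypothesis correlation : forall x, radially_ordered x ->
  hsum (fun n : k.-tuple int => v' (modes_prod a v (zip i n)) * mono x n) (rat_eval al be P x).

(** Descending induction on s: the identity of arrays that expresses the
    convergence of the correlation function is re-expanded in one variable after
    the other, and re-expansions are unique. *)
Lemma interp_formal s : (s <= k)%N ->
  appl (center zeta s) (facs al be) (interp zeta v' v i s) = arrP (center zeta s) P.
Proof.
move=> sk; rewrite -(subKn sk); elim: (k - s)%N => [|t IH].
  rewrite subn0.
  have -> : center zeta k = fun _ : 'I_k => 0.
    by apply/funext => j; rewrite /center ltn_ord.
  have -> : interp zeta v' v i k = fun n => v' (modes_prod a v (zip i n)).
    by apply/funext => n; exact: interp_last.
  exact: formal_of_converges.
have [kt|tk] := leqP k t.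
  have -> : (k - t.+1 = k - t)%N by lia.
  exact: IH.
have sk' : (k - t.+1 < k)%N by lia.
pose o := Ordinal sk'; have E : (k - t = (k - t.+1).+1)%N by lia.
rewrite E in IH.
have c1 : center zeta (k - t.+1).+1 o = 0 by rewrite /center ltnSn.
have c2 : center zeta (k - t.+1) o = zeta by rewrite /center ltnn.
have c3 j : j != o -> center zeta (k - t.+1).+1 j = center zeta (k - t.+1) j.
  by rewrite -val_eqE /= /center ltnS leq_eqVlt => /negbTE ->.
apply: (reexpands_in_unique zeta0 _ (reexpands_arrP P zeta0 c1 c2 c3)).
rewrite -IH; apply: (reexpands_appl _ zeta0 c1 c2 c3).
exact: (interp_reexpands v' v i o zeta0).
Qed.

Lemma shift_generic (x : k.-tuple C) : radially_ordered x ->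
  (forall j, nm (tnth x j) < nm zeta) -> generic_point [tuple tnth x j + zeta | j < k].
Proof.
move=> xr xz; split=> [j|j l jl]; rewrite !tnth_mktuple.
  by rewrite addr_eq0; apply: contraTneq (xz j) => ->; rewrite nmN ltxx.
by rewrite (inj_eq (addIr _)); exact: (radial_generic xr).2.
Qed.

(** For s = 0 all variables are expanded around zeta; the denominators can be
    divided out because the array is truncated. *)
Lemma shifted_converges (x : k.-tuple C) : radially_ordered x ->
  (forall j, nm (tnth x j) < nm zeta) ->
  hsum (fun n : k.-tuple int =>
          pairing v' (vertex_op G Y (modes_prod a vac (zip i n)) zeta v) * mono x n)
       (rat_eval al be P [tuple tnth x j + zeta | j < k]).
Proof.
move=> xr xz; have F := interp_formal (leq0n k).
have cE : center zeta 0 = fun _ : 'I_k => zeta by [].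
rewrite cE in F.
have h := hsum_arrP (fun=> zeta) P x; rewrite -F in h.
have := hsum_unappl xr xz (facs_ordered al be) (truncated_interp zeta v' v i) h.
have -> : mpoly.meval (fun j => tnth x j + zeta) P / \prod_(phi <- facs al be)
    fval (fun=> zeta) phi x = rat_eval al be P [tuple tnth x j + zeta | j < k].
  rewrite /rat_eval facs_prod; congr (_ / (_ * _)).
  - by apply: mpoly.meval_eq => j; rewrite tnth_mktuple.
  - by apply: eq_bigr => j _; rewrite tnth_mktuple.
  - by apply: eq_bigr => j _; apply: eq_bigr => l _; rewrite !tnth_mktuple.
by apply: hsum_ext => n; rewrite interp_first.
Qed.

(** The factor xi_1^(m_1) ... xi_k^(m_k) shifts the indices of the expansion by
    m, and the iterated residue reads off the entry at 0 of the shifted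
    array. *)
Lemma residue_of_correlation (F : k.-tuple C -> C) (m : k.-tuple int) :
  (forall x, generic_point x -> F x = rat_eval al be P x) ->
  pairing v' (vertex_op G Y (modes_prod a vac (zip i m)) zeta v) =
  iterated_residue (fun xi : k.-tuple C =>
    (\prod_(j < k) tnth xi j ^ tnth m j) * F [tuple tnth xi j + zeta | j < k]).
Proof.
move=> hF.
pose d n := pairing v' (vertex_op G Y (modes_prod a vac (zip i n)) zeta v).
pose add (n : k.-tuple int) : k.-tuple int := [tuple tnth n j + tnth m j | j < k].
pose sub (n : k.-tuple int) : k.-tuple int := [tuple tnth n j - tnth m j | j < k].
have addK' : cancel add sub.
  by move=> n; apply: eq_from_tnth => j; rewrite !tnth_mktuple addrK.
have subK' : cancel sub add.
  by move=> n; apply: eq_from_tnth => j; rewrite !tnth_mktuple subrK.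
rewrite (@iterated_residueE R k (nm zeta) _ (fun n => d (add n))) ?nm_gt0 //.
  rewrite /d; congr (pairing v' (vertex_op G Y (modes_prod a vac (zip i _)) zeta v)).
  by congr (tval _); apply: eq_from_tnth => j; rewrite !tnth_mktuple add0r.
move=> x xr xz; rewrite hF; last exact: shift_generic.
have h := hsumZ (\prod_(j < k) tnth x j ^ tnth m j) (shifted_converges xr xz).
have surj n : (forall n', add n' != n) ->
    (\prod_(j < k) tnth x j ^ tnth m j) * (d n * mono x n) = 0.
  by move=> /(_ (sub n)); rewrite subK' eqxx.
have := (hsum_inj (can_inj addK') _ surj).1 h.
apply: hsum_ext => n /=; rewrite mulrCA; congr (_ * _).
rewrite /mono -big_split; apply: eq_bigr => j _ /=.
rewrite tnth_mktuple -expfzDr; last exact: radial_neq0.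
by congr (_ ^ _); lia.
Qed.

End OneCorrelation.

End Residue.

(** * Uniqueness of the vertex superalgebra structure *)
Section StructureUniqueness.
Context {R : realType} {V : lmodType (Cplx R)} (G : grading V).
Local Notation C := (Cplx R).
Local Notation pi := (graded_proj G).
Implicit Types (u v w : V) (z x : C).
Context (hG : grading_restricted G) (vac : V) (hvac : homog G 0 vac).
Context (I : Type) (a : I -> int -> V -> V) (wt : I -> int).
Hypothesis a_deg : forall i, field_deg G (wt i) (a i).
Hypothesis a_span : forall v, exists s : seq (C * seq (I * int)),
  v = \sum_(p <- s) p.1 *: modes_prod a vac p.2.

Lemma pairingZ (v' : graded_dual G) (c : C) (f : int -> V) : in_completion G f ->
  pairing v' (fun n => c *: f n) = c * pairing v' f.
Proof.
move=> hf; have [S [hS _]] := dual_support v'.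
rewrite /pairing -!/(zs _).
have h0 n : n \notin S -> v' (f n) = 0 by move=> /hS h; rewrite -(hf n) h.
rewrite (zsE (A := S)) => [|n /h0]; last by rewrite dualZ => ->; rewrite mulr0.
by rewrite (zsE h0) mulr_sumr; apply: eq_bigr => n _; rewrite dualZ.
Qed.

Lemma homog_parity d u : homog G d u -> parity_part G (odd (absz d)) u.
Proof.
move=> hu n hn; apply: (homog_piN hu); apply: contraNneq hn => ->; exact: eqxx.
Qed.

Lemma map_eq_mp (Y1 Y2 : V -> C -> V -> int -> V) z v : z != 0 ->
  is_vertex_map G Y1 -> is_vertex_map G Y2 ->
  (forall s, Y1 (modes_prod a vac s) z v = Y2 (modes_prod a vac s) z v) ->
  forall u, Y1 u z v = Y2 u z v.
Proof.
move=> z0 [_ l1] [_ l2] h u; apply/funext => n; have [s ->] := a_span u.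
have f1 : lin (fun u => Y1 u z v n) by move=> x u1 u2; exact: l1.
have f2 : lin (fun u => Y2 u z v n) by move=> x u1 u2; exact: l2.
rewrite (lin_sum _ _ f1) (lin_sum _ _ f2); apply: eq_bigr => p _.
by rewrite (linZ _ _ f1) (linZ _ _ f2) h.
Qed.

(** Applied to a homogeneous vector, the inner vertex operator has one mode in
    each component: the third series of the duality axiom is a Laurent series in
    z_1 - z_2. *)
Lemma third_expansion (Y' : V -> C -> V -> int -> V) i e u (v' : graded_dual G) z v x t :
  is_vertex_map G Y' -> z != 0 -> homog G e u ->
  hsum (fun n => pairing v' (Y' (fld G (a i) x u n) z v)) t ->
  hsum (fun m => pairing v' (Y' (a i m u) z v) * x ^ (- m - 1)) t.
Proof.
move=> [hom hlin] z0 hu hs.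
pose f (m : int) := e + wt i - 2 * m - 2.
have fI : injective f by rewrite /f => m m' h; lia.
have l1 n : lin (fun u => Y' u z v n) by move=> y u1 u2; exact: hlin.
have surj n : (forall m, f m != n) -> pairing v' (Y' (fld G (a i) x u n) z v) = 0.
  move=> hn; have -> : fld G (a i) x u n = 0.
    apply: zs0 => m; rewrite (homog_piN (a_deg i m hu)) ?scaler0 //.
    by rewrite eq_sym; exact: hn.
  have -> : Y' 0 z v = fun n => 0 *: Y' 0 z v n.
    by apply/funext => m; rewrite scale0r (lin0 (l1 m)).
  by rewrite pairingZ ?mul0r //; exact: (hom 0 z z0).1.
have := (hsum_inj fI _ surj).1 hs; apply: hsum_ext => m /=.
rewrite /fld (zs_single (i0 := m)) => [|m' mm]; last first.
  by rewrite (homog_piN (a_deg i m' hu)) ?scaler0 //; apply: contra_neq mm; rewrite /f; lia.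
rewrite (a_deg i m hu).
have -> : Y' (x ^ (- m - 1) *: a i m u) z v = fun n => x ^ (- m - 1) *: Y' (a i m u) z v n.
  by apply/funext => n; exact: (linZ _ _ (l1 n)).
by rewrite pairingZ 1?mulrC //; exact: (hom _ z z0).1.
Qed.

Lemma rational_eq (F F' : 2.-tuple C -> C) : is_rational F -> is_rational F' ->
  (forall z1 z2, 0 < nm z2 < nm z1 -> F [tuple z1; z2] = F' [tuple z1; z2]) ->
  forall z1 z2, z1 != 0 -> z2 != 0 -> z1 != z2 -> F [tuple z1; z2] = F' [tuple z1; z2].
Proof.
move=> [al [be [P ->]]] [al' [be' [P' ->]]] h z1 z2 z10 z20 z12.
apply: rat_unique => [x xr|].
  rewrite (tuple2E x); apply: h; rewrite nm_gt0 radial_neq0 //= -nm_lt.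
  exact: xr.2.
split=> [[[|[|j]] hj] //|[[|[|j]] hj] [[|[|l]] hl] //= _].
Qed.

(** By the first series of the duality axiom, the rational function is
    determined by Y(u, z) and phi^i; by the third one, its Laurent coefficients
    at z_1 = z_2 are the matrix coefficients of Y(phi^i_m u, z_2). *)
Lemma product_unique (Y1 Y2 : V -> C -> V -> int -> V) i m e u :
  is_vertex_superalgebra G vac Y1 -> is_vertex_superalgebra G vac Y2 ->
  (forall z v, z != 0 -> Y1 (a i (-1) vac) z v = fld G (a i) z v) ->
  (forall z v, z != 0 -> Y2 (a i (-1) vac) z v = fld G (a i) z v) ->
  homog G e u -> (forall z v, z != 0 -> Y1 u z v = Y2 u z v) ->
  forall z v, z != 0 -> Y1 (a i m u) z v = Y2 (a i m u) z v.
Proof.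
move=> v1 v2 g1 g2 hu hY z v z0.
have hi : homog G (wt i) (a i (-1) vac).
  by apply: homog_eq (a_deg i (-1) hvac) _; lia.
apply: (pairing_ext hG); [exact: ((vsa_map v1).1 _ z z0).1|exact: ((vsa_map v2).1 _ z z0).1|].
move=> v'.
have [F1 [r1 h1]] := vsa_duality v1 v v' (homog_parity hi) (homog_parity hu).
have [F2 [r2 h2]] := vsa_duality v2 v v' (homog_parity hi) (homog_parity hu).
have FE : forall z1 z2, z1 != 0 -> z2 != 0 -> z1 != z2 ->
    F1 [tuple z1; z2] = F2 [tuple z1; z2].
  apply: rational_eq => // z1 z2 hz.
  have hz' : 0 < `|z2| < `|z1|.
    by case/andP: hz => p q; rewrite nm_lt q normr_gt0 -nm_gt0 p.
  have /abs_convP c1 := (h1 z1 z2).1 hz'.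
  have /abs_convP c2 := (h2 z1 z2).1 hz'.
  case/andP: hz => p q; have z10 : z1 != 0 by rewrite -nm_gt0; exact: lt_trans q.
  apply: hsum_unique c1 _; apply: hsum_ext c2 => n.
  by rewrite g1 // g2 // hY // -nm_gt0.
have ex (Y' : V -> C -> V -> int -> V) (F : 2.-tuple C -> C) x :
    is_vertex_map G Y' -> (forall z v, z != 0 -> Y' (a i (-1) vac) z v = fld G (a i) z v) ->
    (0 < `|(z + x) - z| < `|z| -> abs_converges_to
      (fun n : int => pairing v' (Y' (Y' (a i (-1) vac) ((z + x) - z) u n) z v))
      (F [tuple z + x; z])) ->
    0 < nm x < nm z ->
    hsum (fun m => pairing v' (Y' (a i m u) z v) * x ^ (- m - 1)) (F [tuple z + x; z]).
  move=> mY' gY'; rewrite addrAC subrr add0r => hF /andP[x0 xz].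
  apply: (third_expansion mY' z0 hu).
  have /hF/abs_convP : 0 < `|x| < `|z| by rewrite nm_lt xz normr_gt0 -nm_gt0 x0.
  by apply: hsum_ext => n; rewrite gY' // -nm_gt0.
pose D m := pairing v' (Y1 (a i m u) z v) - pairing v' (Y2 (a i m u) z v).
apply/eqP; rewrite -subr_eq0 -/(D m); apply/eqP.
have nz : 0 < nm z by rewrite nm_gt0.
suff : forall n, D (- n - 1) = 0.
  by move=> /(_ (- m - 1)); congr (D _ = 0); lia.
apply: (laurent_unique nz) => x xz.
have c1 := ex _ F1 x (vsa_map v1) g1 (h1 (z + x) z).2.2 xz.
have c2 := ex _ F2 x (vsa_map v2) g2 (h2 (z + x) z).2.2 xz.
have E : F1 [tuple z + x; z] = F2 [tuple z + x; z].
  case/andP: xz => x0 xz; apply: FE => //.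
    by rewrite addrC addr_eq0; apply: contraTneq xz => ->; rewrite nmN ltxx.
  by rewrite -subr_eq0 addrAC subrr add0r -nm_gt0.
have := hsumB c1 c2; rewrite E subrr => h0.
have bI : injective (fun n : int => - n - 1) by move=> n n' /= h; lia.
have surj m' : (forall n, - n - 1 != m' :> int) ->
    pairing v' (Y1 (a i m' u) z v) * x ^ (- m' - 1) -
    pairing v' (Y2 (a i m' u) z v) * x ^ (- m' - 1) = 0.
  by move=> /(_ (- m' - 1)) /eqP[]; lia.
have := (hsum_inj bI _ surj).1 h0; apply: hsum_ext => n /=.
rewrite -mulrBl -/(D _); congr (_ * x ^ _); lia.
Qed.

Lemma structure_unique (Y1 Y2 : V -> C -> V -> int -> V) :
  is_vertex_superalgebra G vac Y1 -> is_vertex_superalgebra G vac Y2 ->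
  (forall i z v, z != 0 -> Y1 (a i (-1) vac) z v = fld G (a i) z v) ->
  (forall i z v, z != 0 -> Y2 (a i (-1) vac) z v = fld G (a i) z v) ->
  forall u z v, z != 0 -> Y1 u z v = Y2 u z v.
Proof.
move=> v1 v2 g1 g2 u z v z0.
apply: (map_eq_mp z0 (vsa_map v1) (vsa_map v2)) => s.
elim: s z v z0 => [|[i m] s IH] z v z0.
  by apply/funext => n; rewrite (vsa_identity v1) // (vsa_identity v2).
have [e he] : exists e, homog G e (modes_prod a vac s).
  elim: s {IH} => [|[j n] s [e IH]]; first by exists 0.
  by eexists; exact: (a_deg j n IH).
exact: (product_unique m v1 v2 (g1 i) (g2 i) he IH v z0).
Qed.

End StructureUniqueness.

Theorem theorem3p5 (R : realType) (V : lmodType (Cplx R)) (G : grading V)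
    (hG : grading_restricted G)
    (I : Type) (phi : I -> Cplx R -> V -> int -> V)
    (hphi : forall i, analytic_field G (phi i))
    (L : {linear V -> V}) (vac : V) (hvac : homog G 0 vac)
    (h1 : forall i, exists wt : int, forall v v' z, z != 0 ->
       pairing v' (bracket G (L0 G) (phi i z) v) =
         z * derive1 (matrix_coef v' (phi i) v) z +
         (wt%:~R / 2) * matrix_coef (G := G) v' (phi i) v z)
    (h2vac : L vac = 0)
    (h2 : forall i n v,
       L (mode G (phi i) n v) - mode G (phi i) n (L v) =
         - n%:~R *: mode G (phi i) (n - 1) v)
    (h3 : forall i,
       (forall v' : graded_dual G,
          matrix_coef v' (phi i) vac z @[z --> 0^'] -->
            v' (mode G (phi i) (-1) vac)) /\
       (parity_part G false (mode G (phi i) (-1) vac) \/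
        parity_part G true (mode G (phi i) (-1) vac)))
    (h4 : forall v, exists s : seq (Cplx R * seq (I * int)),
       v = \sum_(p <- s) p.1 *: mode_product G phi p.2 vac)
    (h5 : exists (A : forall k, 'I_k -> I -> V -> nat)
                 (B : forall k, 'I_k -> 'I_k -> I -> I -> nat),
       forall k (i : k.-tuple I) (v : V) (v' : graded_dual G),
       exists P : mpoly.mpoly k (Cplx R),
         correlation_converges phi v' i v
           (rat_eval (fun j => A k j (tnth i j) v)
                     (fun j l => B k j l (tnth i j) (tnth i l)) P))
    (h6 : forall (i1 i2 : I) (v : V) (v' : graded_dual G) (z1 z2 : Cplx R),
       z1 != 0 -> z2 != 0 -> z1 != z2 ->
       rational_correlation phi v' [tuple i1; i2] v [tuple z1; z2] =
         (-1) ^+ (field_parity G phi vac i1 && field_parity G phi vac i2) *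
         rational_correlation phi v' [tuple i2; i1] v [tuple z2; z1]) :
  let residue_formula (Y : V -> Cplx R -> V -> int -> V) :=
    forall k (i : k.-tuple I) (m : k.-tuple int) (v : V) (v' : graded_dual G)
      (z : Cplx R), z != 0 ->
      pairing v' (Y (mode_product G phi (zip i m) vac) z v) =
      iterated_residue (fun xi : k.-tuple (Cplx R) =>
        (\prod_(j < k) tnth xi j ^ tnth m j) *
        rational_correlation phi v' i v [tuple tnth xi j + z | j < k]) in
  exists Y : V -> Cplx R -> V -> int -> V,
    (* the formula defines a map Y, and only one *)
    (is_vertex_map G Y /\ residue_formula Y /\
     forall Y' : V -> Cplx R -> V -> int -> V,
       is_vertex_map G Y' -> residue_formula Y' ->
       forall u z v, z != 0 -> Y' u z v = Y u z v) /\
    is_vertex_superalgebra G vac Y /\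
    (parity_part G true `<=` [set 0] -> is_vertex_algebra G vac Y) /\
    generated_by G vac Y [set mode G (phi i) (-1) vac | i in [set: I]] /\
    (forall i z v, z != 0 -> Y (mode G (phi i) (-1) vac) z v = phi i z v) /\
    (forall Y' : V -> Cplx R -> V -> int -> V,
       is_vertex_superalgebra G vac Y' ->
       (forall i z v, z != 0 -> Y' (mode G (phi i) (-1) vac) z v = phi i z v) ->
       forall u z v, z != 0 -> Y' u z v = Y u z v).
Proof.
move=> residue_formula.
have [wt hwt] := choice h1; have [A [B h5']] := h5.
pose a := gen G phi wt.
have gm j m v : mode G (phi j) m v = a j m v by exact: gen_mode.
have gmp s v : mode_product G phi s v = modes_prod a v s by exact: (gen_mp hG hphi hwt).
have aspan := gen_span hG hphi hwt h4.
have adeg : forall j, field_deg G (wt j) (a j) := gen_deg hphi wt.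
have awt j : homog G (wt j) (a j (-1) vac) by exact: gen_wt.
have atr j : transl L (a j) by exact: (gen_transl hG hphi hwt h2).
have Llin : lin L by move=> x u v; rewrite linearP.
have [Y sfY Ya] := state_field_gen hG hphi hvac hwt h2vac h2 h3 h4 h5' h6.
have vY : is_vertex_map G (vertex_op G Y) := vertex_op_map sfY.
have resY : residue_formula (vertex_op G Y).
  move=> k i m v v' z z0; have [P hP] := h5' k i v v'.
  rewrite gmp.
  apply: (residue_of_correlation hG hvac sfY awt Ya z0
    (fun x => gen_converges hG hphi hwt hP (x := x))) => x.
  exact: (rational_correlationE hP).
have genY i z v : z != 0 -> vertex_op G Y (mode G (phi i) (-1) vac) z v = phi i z v.
  move=> z0; apply/funext => n; rewrite gm /vertex_op Ya.
  by rewrite (gen_fld hG hphi hwt i v n z0).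
have vsaY : is_vertex_superalgebra G vac (vertex_op G Y).
  split=> //.
  - by move=> u; exact: (vertex_op_analytic sfY).
  - exact: (vertex_op_L0 sfY).
  - exact: (vertex_op_identity sfY).
  - exact: (vertex_op_creation sfY).
  - exact: (vertex_op_translation Llin h2vac hvac sfY).
  - exact: (vertex_op_duality hG sfY).
exists (vertex_op G Y); split; [|split; [|split; [|split; [|split]]]] => //.
- split=> //; split=> // Y' vY' resY' u z v z0.
  apply: (map_eq_mp aspan z0 vY' vY) => s.
  apply: (pairing_ext hG); [exact: (vY'.1 _ z z0).1|exact: (vY.1 _ z z0).1|].
  move=> v'; have := resY _ (map_tuple fst (in_tuple s)) (map_tuple snd (in_tuple s)) v v' z z0.
  rewrite -(resY' _ _ _ v v' z z0) zip_unzip gmp.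
  by move=> ->.
- rewrite (_ : [set mode G (phi i) (-1) vac | i in [set: I]] =
     [set a i (-1) vac | i in [set: I]]).
    exact: (generated_gen sfY adeg Ya aspan).
  by congr image; apply/funext => i; exact: gm.
- move=> Y' vsaY' gY'.
  apply: (structure_unique hG hvac adeg aspan vsaY' vsaY) => i z v z0.
    by rewrite -gm gY' //; apply/funext => n; exact: (gen_fld hG hphi hwt).
  by rewrite -gm genY //; apply/funext => n; exact: (gen_fld hG hphi hwt).
Qed.
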